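(* Let $u=(u_1,\dots,u_d)$ be the canonical unitary generators of the full group C*-algebra $C^*(\mathbb{F}_d)$ of the free group $\mathbb{F}_d$ on $d$ generators, and let $\overline{\operatorname{alg}}(u_1,\dots,u_d)$ be the norm-closed unital subalgebra of $C^*(\mathbb{F}_d)$ generated by $u_1,\dots,u_d$. There is a completely isometric isomorphism $\varphi:A(\mathfrak{D}_d)\to\overline{\operatorname{alg}}(u_1,\dots,u_d)$ determined by $\varphi(Z_j)=u_j$ for all $j=1,\dots,d$. Consequently, $C^*_e(A(\mathfrak{D}_d))=C^*(\mathbb{F}_d)$.
   Context: $M_n^d$ is the set of $d$-tuples of complex $n\times n$ matrices. The nc unit polydisk is $\mathfrak{D}_d=\sqcup_{n\ge1}\{X\in M_n^d:\max_j\|X_j\|<1\}$. $A(\mathfrak{D}_d)$ is the completion (closure) of the free nc polynomials $\mathbb{C}\langle Z_1,\dots,Z_d\rangle$, viewed as functions on $\mathfrak{D}_d$, in the norm $\|p\|=\sup_{X\in\mathfrak{D}_d}\|p(X)\|$, with matrix norms $\|[p_{jk}]\|=\sup_{X\in\mathfrak{D}_d}\|[p_{jk}(X)]\|$; it is a unital operator algebra. $Z_j$ denotes the $j$-th coordinate function. For a unital operator algebra $\mathcal{A}$ completely isometrically embedded in a C*-algebra $\mathcal{B}=C^*(\mathcal{A})$ that it generates, the Shilov ideal $\mathcal{J}\triangleleft\mathcal{B}$ is the largest closed ideal such that the quotient map $\mathcal{B}\to\mathcal{B}/\mathcal{J}$ is completely isometric on $\mathcal{A}$, and the C*-envelope is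 $C_e^*(\mathcal{A})=\mathcal{B}/\mathcal{J}$ (independent of the embedding up to isomorphism). *)

(* Defs.v *)
From HB Require Import structures.
From mathcomp Require Import all_boot all_order all_algebra.
From mathcomp Require Import all_classical all_reals all_analysis.
From mathcomp Require Export complex.
From mathcomp Require Import ring.

Set Implicit Arguments.
Unset Strict Implicit.
Unset Printing Implicit Defensive.

Import Order.TTheory GRing.Theory Num.Theory.
Import numFieldNormedType.Exports.

Local Open Scope classical_set_scope.
Local Open Scope ring_scope.
Local Open Scope complex_scope.

(* The norm of a complex normed space takes its values in R[i]; [rnorm] is the
   same number in R. *)
Definition rnorm (R : realType) (V : normedZmodType R[i]) (x : V) : R :=
  complex.Re `|x|.

Definition l2norm (R : realType) (V : normedZmodType R[i]) (n : nat)
    (x : 'I_n -> V) : R :=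
  Num.sqrt (\sum_i rnorm (x i) ^+ 2).

HB.mixin Record isHilbertSpace (R : realType) H
    of CompleteNormedModule R[i] H := {
  dot : H -> H -> R[i] ;
  dot_scalar : forall y : H, scalar (dot^~ y) ;
  dot_conj : forall x y : H, dot y x = (dot x y)^*%C ;
  dot_norm : forall x : H, dot x x = `|x| ^+ 2
}.

#[short(type="hilbertType")]
HB.structure Definition HilbertSpace (R : realType) :=
  {H of CompleteNormedModule R[i] H & isHilbertSpace R H}.

Section Operators.
Context (R : realType) (H : hilbertType R).
Local Notation C := R[i].

Definition is_op : {pred H -> H} :=
  mem [set f : H -> H | linear f /\ continuous f].

Record op := Op { op_fun :> H -> H ; _ : op_fun \in is_op }.

HB.instance Definition _ := [isSub for op_fun].
HB.instance Definition _ := [Choice of op by <:].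

Lemma is_opP f : reflect (linear f /\ continuous f) (f \in is_op).
Proof. by apply: (iffP idP) => [/set_mem|?]; last exact: mem_set. Qed.

Lemma is_op_submod : submod_closed is_op.
Proof.
split.
  apply/is_opP; split; last exact: cst_continuous.
  by move=> a x y; rewrite scaler0 addr0.
move=> a f g /is_opP[lf cf] /is_opP[lg cg]; apply/is_opP; split.
  move=> b x y; rewrite /= !fctE lf lg !scalerDr.
  by rewrite !scalerA [a * b]mulrC addrACA.
move=> x; apply: (@cvgD _ _ _ _ _ (a \*: f) g).
  by apply: cvgZr; exact: cf.
exact: cg.
Qed.

HB.instance Definition _ :=
  GRing.isSubmodClosed.Build C (H -> H) is_op is_op_submod.
HB.instance Definition _ := [SubChoice_isSubLmodule of op by <:].

Lemma op_linear (a : op) : linear a.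
Proof. by case: a => f /= /is_opP[]. Qed.

Lemma op_continuous (a : op) : continuous a.
Proof. by case: a => f /= /is_opP[]. Qed.

HB.instance Definition _ (a : op) :=
  GRing.isLinear.Build C H H _ (op_fun a) (op_linear a).

Lemma opP (a b : op) : (forall x, a x = b x) -> a = b.
Proof. by move=> ab; apply: val_inj; apply/funext. Qed.

Lemma op_one_subproof : (id : H -> H) \in is_op.
Proof. by apply/is_opP; split => // x; exact: cvg_id. Qed.

Definition op_one : op := Op op_one_subproof.

Lemma op_mul_subproof (a b : op) : (a \o b) \in is_op.
Proof.
apply/is_opP; split; first by move=> k x y; rewrite /= !linearP.
by move=> x; apply: continuous_comp; exact: op_continuous.
Qed.

Definition op_mul (a b : op) : op := Op (op_mul_subproof a b).

Fact op_mulA : associative op_mul. Proof. by move=> a b c; apply: opP. Qed.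
Fact op_mul1l : left_id op_one op_mul. Proof. by move=> a; apply: opP. Qed.
Fact op_mul1r : right_id op_one op_mul. Proof. by move=> a; apply: opP. Qed.
Fact op_mulDl : left_distributive op_mul +%R.
Proof. by move=> a b c; apply: opP. Qed.
Fact op_mulDr : right_distributive op_mul +%R.
Proof. by move=> a b c; apply: opP => x; exact: (linearD a (b x) (c x)). Qed.

(* Only a possibly trivial ring, since H may be the zero space. *)
HB.instance Definition _ := GRing.Zmodule_isPzRing.Build op
  op_mulA op_mul1l op_mul1r op_mulDl op_mulDr.

Definition adjoint (a b : op) : Prop := forall x y, dot (a x) y = dot x (b y).

Definition unitary_op (u : op) : Prop :=
  exists v, [/\ adjoint u v, u * v = 1 & v * u = 1].

Definition opnorm (a : op) : R :=
  sup [set rnorm (a x) | x in [set x : H | rnorm x <= 1]].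

(* The norm as an operator on the Hilbert sum H^n. *)
Definition opmxnorm (n : nat) (a : 'M[op]_n) : R :=
  sup [set l2norm (fun i => \sum_j a i j (x j)) |
        x in [set x : 'I_n -> H | l2norm x <= 1]].

Definition norm_closed (S : set op) : Prop :=
  forall a, (forall e : R, 0 < e -> exists2 b, S b & opnorm (a - b) < e) -> S a.

Definition linear_subspace (S : set op) : Prop :=
  S 0 /\ forall (k : C) a b, S a -> S b -> S (k *: a + b).

Definition closed_unital_algebra (S : set op) : Prop :=
  [/\ linear_subspace S, S 1, forall a b, S a -> S b -> S (a * b)
    & norm_closed S].

(* C*-algebras are unital and concrete, so that M_n(S) has the norm [opmxnorm].
   The adjoint is a relation, which saves a choice of representing vectors. *)
Definition cstar_algebra (S : set op) : Prop :=
  closed_unital_algebra S /\ forall a b, S a -> adjoint a b -> S b.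

Definition closed_algebra_gen (G : set op) : set op :=
  smallest closed_unital_algebra G.

Definition cstar_gen (G : set op) : set op := smallest cstar_algebra G.

Definition closed_ideal (B J : set op) : Prop :=
  [/\ J `<=` B, linear_subspace J, norm_closed J
    & forall b c, B b -> J c -> J (b * c) /\ J (c * b)].

(* The norm of the image of a in M_n(B / J) = M_n(B) / M_n(J). *)
Definition quotient_mxnorm (J : set op) (n : nat) (a : 'M[op]_n) : R :=
  inf [set opmxnorm (a + c) | c in [set c : 'M[op]_n | forall i j, J (c i j)]].

Definition boundary_ideal (A B J : set op) : Prop :=
  closed_ideal B J /\
  forall n (a : 'M[op]_n), (forall i j, A (a i j)) ->
    quotient_mxnorm J a = opmxnorm a.

Definition shilov_ideal (A B J : set op) : Prop :=
  boundary_ideal A B J /\ forall I, boundary_ideal A B I -> I `<=` J.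

End Operators.

Arguments op {R} H.

(* A *-isomorphism from B / J onto E, given as the *-homomorphism from B onto E
   with kernel J that it induces.  Only the values of pi on B matter. *)
Definition quotient_star_iso (R : realType) (K H : hilbertType R)
    (B J : set (op K)) (E : set (op H)) (pi : op K -> op H) : Prop :=
  [/\ forall (k : R[i]) a b, B a -> B b -> pi (k *: a + b) = k *: pi a + pi b,
      forall a b, B a -> B b -> pi (a * b) = pi a * pi b,
      forall a b, B a -> adjoint a b -> adjoint (pi a) (pi b),
      pi @` B = E
    & forall b, B b -> (pi b = 0 <-> J b)].

(* nrm n is the norm of M_n(A). *)
Definition completely_isometric_hom (R : realType) (A : algType R[i])
    (nrm : forall n, 'M[A]_n -> R) (H : hilbertType R) (f : A -> op H) : Prop :=
  [/\ linear f, monoid_morphism f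
    & forall n (a : 'M[A]_n), opmxnorm (map_mx f a) = nrm n a].

(* E is the C*-envelope of A, with phi : A -> E as the canonical embedding: for
   every completely isometric embedding j of A, the quotient of C*(j(A)) by the
   Shilov ideal is isomorphic to E, by an isomorphism that sends the class of
   j(a) to phi(a). *)
Definition is_cstar_envelope (R : realType) (A : algType R[i])
    (nrm : forall n, 'M[A]_n -> R) (H : hilbertType R) (E : set (op H))
    (phi : A -> op H) : Prop :=
  forall (K : hilbertType R) (j : A -> op K), completely_isometric_hom nrm j ->
    exists2 J, shilov_ideal (range j) (cstar_gen (range j)) J &
      exists2 pi, quotient_star_iso (cstar_gen (range j)) J E pi &
        forall a, pi (j a) = phi a.

Definition free_on (d : nat) (F : groupType) (s : 'I_d -> F) : Prop :=
  forall (G : groupType) (t : 'I_d -> G),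
    exists! f : F -> G,
      {morph f : x y / (x * y)%g} /\ (forall j, f (s j) = t j).

Definition unitary_rep (R : realType) (F : groupType) (H : hilbertType R)
    (U : F -> op H) : Prop :=
  [/\ U 1%g = 1, {morph U : g h / (g * h)%g >-> g * h}
    & forall g, unitary_op (U g)].

Definition group_alg_eval (R : realType) (F : groupType) (H : hilbertType R)
    (U : F -> op H) (s : seq F) (c : F -> R[i]) : op H :=
  \sum_(g <- s) c g *: U g.

(* The norm that U induces on the group algebra is the largest one induced by a
   unitary representation, so that the closure of the image of the group algebra,
   which is cstar_gen (range U), is the full group C*-algebra. *)
Definition universal_rep (R : realType) (F : groupType) (H : hilbertType R)
    (U : F -> op H) : Prop :=
  unitary_rep U /\
  forall (K : hilbertType R) (V : F -> op K), unitary_rep V ->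
    forall s c, opnorm (group_alg_eval V s c) <= opnorm (group_alg_eval U s c).

Definition spectral_norm (R : realType) (m n : nat) (A : 'M[R[i]]_(m, n)) : R :=
  sup [set l2norm (fun i => \sum_j A i j * x j) |
        x in [set x : 'I_n -> R[i] | l2norm x <= 1]].

Section SpectralNorm.
Context {R : realType}.
Local Notation C := R[i].

Lemma rnormE (V : normedZmodType C) (x : V) : (rnorm x)%:C = `|x|.
Proof. by rewrite /rnorm RRe_real // normr_real. Qed.

Lemma rnorm_ge0 (V : normedZmodType C) (x : V) : 0 <= rnorm x.
Proof. by rewrite -lecR rnormE normr_ge0. Qed.

Lemma ler_rnormD (V : normedZmodType C) (x y : V) :
  rnorm (x + y) <= rnorm x + rnorm y.
Proof. by rewrite -lecR raddfD /= !rnormE ler_normD. Qed.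

Lemma ler_rnorm_sum (V : normedZmodType C) n (x : 'I_n -> V) :
  rnorm (\sum_i x i) <= \sum_i rnorm (x i).
Proof.
elim/big_ind2: _ => [|x1 x2 y1 y2 h1 h2|//]; first by rewrite /rnorm normr0.
exact: le_trans (ler_rnormD _ _) (lerD h1 h2).
Qed.

Lemma rnormM (x y : C) : rnorm (x * y) = rnorm x * rnorm y.
Proof. by apply: complexI; rewrite rmorphM /= !rnormE normrM. Qed.


Lemma l2norm_ge0 (V : normedZmodType C) n (x : 'I_n -> V) : 0 <= l2norm x.
Proof. exact: sqrtr_ge0. Qed.

Lemma sqr_l2norm (V : normedZmodType C) n (x : 'I_n -> V) :
  l2norm x ^+ 2 = \sum_i rnorm (x i) ^+ 2.
Proof. by rewrite sqr_sqrtr // sumr_ge0 // => i _; exact: sqr_ge0. Qed.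

Lemma ler_rnorm_l2norm (V : normedZmodType C) n (x : 'I_n -> V) i :
  rnorm (x i) <= l2norm x.
Proof.
rewrite -[leLHS]ger0_norm ?rnorm_ge0// -sqrtr_sqr ler_sqrt ?sumr_ge0//.
  rewrite (bigD1 i) //= lerDl sumr_ge0// => j _; exact: sqr_ge0.
by move=> j _; exact: sqr_ge0.
Qed.

Lemma CauchySchwarz_sum n (a b : 'I_n -> R) :
  (\sum_i a i * b i) ^+ 2 <= (\sum_i a i ^+ 2) * (\sum_i b i ^+ 2).
Proof.
have : 0 <= \sum_i \sum_j (a i * b j - a j * b i) ^+ 2.
  by apply: sumr_ge0 => i _; apply: sumr_ge0 => j _; exact: sqr_ge0.
set S := \sum_i _; set A := \sum_i a i ^+ 2; set B := \sum_i b i ^+ 2.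
set D := \sum_i a i * b i.
suff -> : S = (A * B - D ^+ 2) *+ 2 by rewrite pmulrn_lge0// subr_ge0.
have -> : S = \sum_i (a i ^+ 2 * B - (a i * b i * D) *+ 2 + b i ^+ 2 * A).
  apply: eq_bigr => i _.
  rewrite /A /B /D !mulr_sumr -sumrMnl -sumrB -big_split /=.
  by apply: eq_bigr => j _; ring.
by rewrite big_split /= sumrB sumrMnl -!mulr_suml -/A -/B -/D; ring.
Qed.

Lemma ler_l2normD (V : normedZmodType C) n (x y : 'I_n -> V) :
  l2norm (fun i => x i + y i) <= l2norm x + l2norm y.
Proof.
rewrite -(ler_pXn2r (n := 2)) ?nnegrE ?addr_ge0 ?l2norm_ge0//.
rewrite sqrrD !sqr_l2norm.
apply: (@le_trans _ _ (\sum_i (rnorm (x i) + rnorm (y i)) ^+ 2)).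
  apply: ler_sum => i _; rewrite ler_pXn2r ?nnegrE ?addr_ge0 ?rnorm_ge0//.
  exact: ler_rnormD.
under eq_bigr do rewrite sqrrD.
rewrite big_split /= big_split /= sumrMnl lerD2r lerD2l ler_pMn2r//.
rewrite -(ler_pXn2r (n := 2)) ?nnegrE ?mulr_ge0 ?l2norm_ge0//; last first.
  by apply: sumr_ge0 => i _; rewrite mulr_ge0 ?rnorm_ge0.
by rewrite exprMn !sqr_l2norm; exact: CauchySchwarz_sum.
Qed.

Lemma l2normZ n (k : C) (x : 'I_n -> C) :
  l2norm (fun i => k * x i) = rnorm k * l2norm x.
Proof.
rewrite -[rnorm k]ger0_norm ?rnorm_ge0// -sqrtr_sqr -sqrtrM ?sqr_ge0//.
by congr Num.sqrt; rewrite mulr_sumr; apply: eq_bigr => i _; rewrite rnormM exprMn.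
Qed.

Definition mxact m n (A : 'M[C]_(m, n)) (x : 'I_n -> C) (i : 'I_m) : C :=
  \sum_j A i j * x j.

Lemma spectral_norm_has_sup m n (A : 'M[C]_(m, n)) :
  has_sup [set l2norm (mxact A x) | x in [set x : 'I_n -> C | l2norm x <= 1]].
Proof.
split.
  exists (l2norm (mxact A (fun=> 0))); exists (fun=> 0) => //=.
  rewrite /l2norm big1 ?sqrtr0 ?ler01// => i _.
  by rewrite /rnorm normr0 expr0n.
exists (Num.sqrt (\sum_i (\sum_j rnorm (A i j)) ^+ 2)) => _ [x /= x1 <-].
rewrite ler_sqrt ?sumr_ge0// => [|i _]; last exact: sqr_ge0.
apply: ler_sum => i _.
rewrite ler_pXn2r ?nnegrE ?rnorm_ge0 ?sumr_ge0// => [|j _]; last exact: rnorm_ge0.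
apply: le_trans (ler_rnorm_sum _) _; apply: ler_sum => j _.
rewrite rnormM ler_piMr ?rnorm_ge0//.
exact: le_trans (ler_rnorm_l2norm _ _) x1.
Qed.

Lemma spectral_norm_ub m n (A : 'M[C]_(m, n)) x :
  l2norm (mxact A x) <= spectral_norm A * l2norm x.
Proof.
have ub y : l2norm y <= 1 -> l2norm (mxact A y) <= spectral_norm A.
  move=> y1; apply: ub_le_sup; first exact: (spectral_norm_has_sup A).2.
  by exists y.
have [x0|x0] := eqVneq (l2norm x) 0.
  suff -> : mxact A x = fun=> 0.
    rewrite x0 mulr0 /l2norm big1 ?sqrtr0// => i _.
    by rewrite /rnorm normr0 expr0n.
  apply/funext => i; rewrite /mxact big1// => j _.
  have /eqP : rnorm (x j) = 0.
    by apply/eqP; rewrite eq_le rnorm_ge0 andbT -x0 ler_rnorm_l2norm.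
  by rewrite -(inj_eq (@complexI _)) /= rnormE normr_eq0 => /eqP ->; rewrite mulr0.
set l := l2norm x in x0 *.
have l0 : 0 < l by rewrite lt_neqAle eq_sym x0 l2norm_ge0.
have rl : rnorm (l^-1)%:C = l^-1.
  by rewrite /rnorm ger0_norm// lecR invr_ge0 ltW.
have := ub (fun i => (l^-1)%:C * x i).
rewrite l2normZ rl -/l mulVf// => /(_ (lexx _)).
have -> : mxact A (fun i => (l^-1)%:C * x i) = fun i => (l^-1)%:C * mxact A x i.
  by apply/funext => i; rewrite /mxact mulr_sumr; apply: eq_bigr => j _; ring.
by rewrite l2normZ rl mulrC ler_pdivrMr.
Qed.

Lemma spectral_norm_le m n (A : 'M[C]_(m, n)) c : 0 <= c ->
  (forall x, l2norm (mxact A x) <= c * l2norm x) -> spectral_norm A <= c.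
Proof.
move=> c0 h; apply: ge_sup; first exact: (spectral_norm_has_sup A).1.
by move=> _ [x /= x1 <-]; apply: le_trans (h x) _; rewrite ler_piMr.
Qed.

Lemma spectral_norm_ge0 m n (A : 'M[C]_(m, n)) : 0 <= spectral_norm A.
Proof.
apply: (@le_trans _ _ (l2norm (mxact A (fun=> 0)))); first exact: l2norm_ge0.
apply: ub_le_sup; first exact: (spectral_norm_has_sup A).2.
exists (fun=> 0) => //=.
by rewrite /l2norm big1 ?sqrtr0 ?ler01// => i _; rewrite /rnorm normr0 expr0n.
Qed.

Lemma spectral_normD m n (A B : 'M[C]_(m, n)) :
  spectral_norm (A + B) <= spectral_norm A + spectral_norm B.
Proof.
apply: spectral_norm_le; first by rewrite addr_ge0 ?spectral_norm_ge0.
move=> x; have -> : mxact (A + B) x = fun i => mxact A x i + mxact B x i.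
  apply/funext => i; rewrite /mxact -big_split /=.
  by apply: eq_bigr => j _; rewrite mxE mulrDl.
rewrite mulrDl; apply: le_trans (ler_l2normD _ _) _.
by apply: lerD; exact: spectral_norm_ub.
Qed.

Lemma spectral_normZ m n k (A : 'M[C]_(m, n)) :
  spectral_norm (k *: A) <= rnorm k * spectral_norm A.
Proof.
apply: spectral_norm_le; first by rewrite mulr_ge0 ?rnorm_ge0 ?spectral_norm_ge0.
move=> x; have -> : mxact (k *: A) x = fun i => k * mxact A x i.
  apply/funext => i; rewrite /mxact mulr_sumr.
  by apply: eq_bigr => j _; rewrite mxE mulrA.
by rewrite l2normZ -mulrA ler_wpM2l ?rnorm_ge0// spectral_norm_ub.
Qed.

Lemma spectral_normM m n p (A : 'M[C]_(m, n)) (B : 'M[C]_(n, p)) :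
  spectral_norm (A *m B) <= spectral_norm A * spectral_norm B.
Proof.
apply: spectral_norm_le; first by rewrite mulr_ge0 ?spectral_norm_ge0.
move=> x; have -> : mxact (A *m B) x = mxact A (mxact B x).
  apply/funext => i; rewrite /mxact.
  under eq_bigr do rewrite mxE mulr_suml.
  rewrite exchange_big /=; apply: eq_bigr => j _; rewrite mulr_sumr.
  by apply: eq_bigr => l _; rewrite mulrA.
apply: le_trans (spectral_norm_ub _ _) _.
by rewrite -mulrA ler_wpM2l ?spectral_norm_ge0// spectral_norm_ub.
Qed.

Lemma spectral_norm0 m n : spectral_norm (0 : 'M[C]_(m, n)) = 0.
Proof.
apply/le_anti/andP; split; last exact: spectral_norm_ge0.
have := spectral_normZ 0 (0 : 'M[C]_(m, n)).
by rewrite scale0r {1}/rnorm normr0 mul0r.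
Qed.

Lemma spectral_norm1 n : spectral_norm (1%:M : 'M[C]_n) <= 1.
Proof.
apply: spectral_norm_le => // x; rewrite mul1r.
suff -> : mxact 1%:M x = x by [].
apply/funext => i; rewrite /mxact (bigD1 i)//= big1 => [|j ji].
  by rewrite mxE eqxx mul1r addr0.
by rewrite mxE eq_sym (negbTE ji) mul0r.
Qed.

End SpectralNorm.

Record polydisk (R : realType) (d : nat) := Polydisk {
  pd_pred_size : nat ;
  pd_point : 'I_d -> 'M[R[i]]_pd_pred_size.+1 ;
  pd_lt1 : forall j, spectral_norm (pd_point j) < 1
}.

Definition ncfun (R : realType) (d : nat) : Type :=
  forall X : polydisk R d, 'M[R[i]]_((pd_pred_size X).+1).

Section NcFunctions.
Context (R : realType) (d : nat).
Local Notation C := R[i].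
Local Notation ncfun := (ncfun R d).

Definition ncfun_zero : ncfun := fun=> 0.
Definition ncfun_opp (f : ncfun) : ncfun := fun X => - f X.
Definition ncfun_add (f g : ncfun) : ncfun := fun X => f X + g X.
Definition ncfun_one : ncfun := fun=> 1.
Definition ncfun_mul (f g : ncfun) : ncfun := fun X => f X * g X.
Definition ncfun_scale (k : C) (f : ncfun) : ncfun := fun X => k *: f X.

Lemma ncfunP (f g : ncfun) : (forall X, f X = g X) -> f = g.
Proof. exact: functional_extensionality_dep. Qed.

HB.instance Definition _ := gen_eqMixin ncfun.
HB.instance Definition _ := gen_choiceMixin ncfun.

Fact ncfun_addA : associative ncfun_add.
Proof. by move=> f g h; apply: ncfunP => X; exact: addrA. Qed.
Fact ncfun_addC : commutative ncfun_add.
Proof. by move=> f g; apply: ncfunP => X; exact: addrC. Qed.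
Fact ncfun_add0 : left_id ncfun_zero ncfun_add.
Proof. by move=> f; apply: ncfunP => X; exact: add0r. Qed.
Fact ncfun_addN : left_inverse ncfun_zero ncfun_opp ncfun_add.
Proof. by move=> f; apply: ncfunP => X; exact: addNr. Qed.

HB.instance Definition _ := GRing.isZmodule.Build ncfun
  ncfun_addA ncfun_addC ncfun_add0 ncfun_addN.

Lemma disk0_subproof (j : 'I_d) : spectral_norm (0 : 'M[C]_1) < 1.
Proof. by rewrite spectral_norm0. Qed.

Definition disk0 : polydisk R d := Polydisk disk0_subproof.

Fact ncfun_mulA : associative ncfun_mul.
Proof. by move=> f g h; apply: ncfunP => X; exact: mulrA. Qed.
Fact ncfun_mul1l : left_id ncfun_one ncfun_mul.
Proof. by move=> f; apply: ncfunP => X; exact: mul1r. Qed.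
Fact ncfun_mul1r : right_id ncfun_one ncfun_mul.
Proof. by move=> f; apply: ncfunP => X; exact: mulr1. Qed.
Fact ncfun_mulDl : left_distributive ncfun_mul +%R.
Proof. by move=> f g h; apply: ncfunP => X; exact: mulrDl. Qed.
Fact ncfun_mulDr : right_distributive ncfun_mul +%R.
Proof. by move=> f g h; apply: ncfunP => X; exact: mulrDr. Qed.
Fact ncfun_one_neq0 : ncfun_one != 0.
Proof.
apply/eqP => /(congr1 (fun f : ncfun => f disk0)) /eqP.
by rewrite /ncfun_one oner_eq0.
Qed.

HB.instance Definition _ := GRing.Zmodule_isNzRing.Build ncfun
  ncfun_mulA ncfun_mul1l ncfun_mul1r ncfun_mulDl ncfun_mulDr ncfun_one_neq0.

Fact ncfun_scaleA k l (f : ncfun) :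
  ncfun_scale k (ncfun_scale l f) = ncfun_scale (k * l) f.
Proof. by apply: ncfunP => X; exact: scalerA. Qed.
Fact ncfun_scale1 : left_id 1 ncfun_scale.
Proof. by move=> f; apply: ncfunP => X; exact: scale1r. Qed.
Fact ncfun_scaleDr : right_distributive ncfun_scale +%R.
Proof. by move=> k f g; apply: ncfunP => X; exact: scalerDr. Qed.
Fact ncfun_scaleDl (f : ncfun) : {morph ncfun_scale^~ f : k l / k + l}.
Proof. by move=> k l; apply: ncfunP => X; exact: scalerDl. Qed.

HB.instance Definition _ := GRing.Zmodule_isLmodule.Build C ncfun
  ncfun_scaleA ncfun_scale1 ncfun_scaleDr ncfun_scaleDl.

Fact ncfun_scaleAl k (f g : ncfun) : k *: (f * g) = k *: f * g.
Proof. by apply: ncfunP => X; exact: scalerAl. Qed.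
Fact ncfun_scaleAr k (f g : ncfun) : k *: (f * g) = f * (k *: g).
Proof. by apply: ncfunP => X; exact: scalerAr. Qed.

HB.instance Definition _ :=
  GRing.Lmodule_isLalgebra.Build C ncfun ncfun_scaleAl.
HB.instance Definition _ := GRing.Lalgebra_isAlgebra.Build C ncfun ncfun_scaleAr.

Definition nccoord (j : 'I_d) : ncfun := fun X => pd_point X j.

(* A free polynomial, as a list of coefficients and words in the variables. *)
Definition ncpoly : Type := seq (C * seq 'I_d).

Definition ncpoly_fun (p : ncpoly) : ncfun :=
  \sum_(t <- p) t.1 *: \prod_(j <- t.2) nccoord j.

(* The completion of the free polynomials for the supremum norm over the
   polydisk, realized as their uniform closure among all nc functions. *)
Definition in_ncA : {pred ncfun} :=
  mem [set f : ncfun | forall e : R, 0 < e ->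
    exists p, forall X, spectral_norm (f X - ncpoly_fun p X) <= e].

Definition ncbounded (f : ncfun) : Prop :=
  exists M : R, forall X, spectral_norm (f X) <= M.

Lemma ncbounded_ge0 f : ncbounded f ->
  exists2 M, 0 <= M & forall X, spectral_norm (f X) <= M.
Proof.
move=> [M fM]; exists M => //.
exact: le_trans (spectral_norm_ge0 _) (fM disk0).
Qed.

Lemma ncboundedD f g : ncbounded f -> ncbounded g -> ncbounded (f + g).
Proof.
move=> [M fM] [N gN]; exists (M + N) => X.
exact: le_trans (spectral_normD _ _) (lerD (fM X) (gN X)).
Qed.

Lemma ncboundedZ k f : ncbounded f -> ncbounded (k *: f).
Proof.
move=> [M fM]; exists (rnorm k * M) => X.
by apply: le_trans (spectral_normZ _ _) _; rewrite ler_wpM2l ?rnorm_ge0.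
Qed.

Lemma ncboundedM f g : ncbounded f -> ncbounded g -> ncbounded (f * g).
Proof.
move=> /ncbounded_ge0[M M0 fM] [N gN]; exists (M * N) => X.
apply: le_trans (spectral_normM _ _) _.
by apply: ler_pM => //; exact: spectral_norm_ge0.
Qed.

Lemma ncbounded1 : ncbounded 1.
Proof. by exists 1 => X; exact: spectral_norm1. Qed.

Lemma ncbounded_poly p : ncbounded (ncpoly_fun p).
Proof.
rewrite /ncpoly_fun; elim/big_ind: _ => [||t _].
- by exists 0 => X; rewrite [X in spectral_norm X]/(0 X) spectral_norm0.
- exact: ncboundedD.
- apply: ncboundedZ; elim/big_ind: _ => [||j _].
  + exact: ncbounded1.
  + exact: ncboundedM.
  + by exists 1 => X; exact/ltW/pd_lt1.
Qed.

Lemma ncpoly_funD p q : ncpoly_fun (p ++ q) = ncpoly_fun p + ncpoly_fun q.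
Proof. by rewrite /ncpoly_fun big_cat. Qed.

Lemma ncpoly_funZ k p :
  ncpoly_fun [seq (k * t.1, t.2) | t <- p] = k *: ncpoly_fun p.
Proof.
by rewrite /ncpoly_fun big_map scaler_sumr; apply: eq_bigr => t _; rewrite scalerA.
Qed.

Lemma ncpoly_funM p q :
  ncpoly_fun [seq (s.1 * t.1, s.2 ++ t.2) | s <- p, t <- q] =
  ncpoly_fun p * ncpoly_fun q.
Proof.
rewrite /ncpoly_fun big_allpairs_dep mulr_suml; apply: eq_bigr => s _.
rewrite mulr_sumr; apply: eq_bigr => t _.
by rewrite big_cat -scalerAl -scalerAr scalerA.
Qed.

Lemma in_ncAP f : reflect (forall e : R, 0 < e ->
    exists p, forall X, spectral_norm (f X - ncpoly_fun p X) <= e)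
  (f \in in_ncA).
Proof. by apply: (iffP idP) => [/set_mem|?]; last exact: mem_set. Qed.

Lemma ncpoly_in_ncA p : ncpoly_fun p \in in_ncA.
Proof.
apply/in_ncAP => e e0; exists p => X; rewrite subrr spectral_norm0; exact: ltW.
Qed.

Lemma ncA_bounded f : f \in in_ncA -> ncbounded f.
Proof.
move=> /in_ncAP /(_ 1 ltr01)[p fp]; have [M pM] := ncbounded_poly p.
exists (1 + M) => X; rewrite -[f X](subrK (ncpoly_fun p X)).
exact: le_trans (spectral_normD _ _) (lerD (fp X) (pM X)).
Qed.

Lemma nccoordE j : nccoord j = ncpoly_fun [:: (1, [:: j])].
Proof. by rewrite /ncpoly_fun !big_seq1 scale1r. Qed.

Lemma in_ncA_subalg : subalg_closed in_ncA.
Proof.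
split.
- suff -> : 1 = ncpoly_fun [:: (1, [::])] by exact: ncpoly_in_ncA.
  by rewrite /ncpoly_fun big_seq1 big_nil scale1r.
- move=> k f g /in_ncAP fA /in_ncAP gA; apply/in_ncAP => e e0.
  have r0 : 0 < rnorm k + 1 by rewrite ltr_wpDl ?rnorm_ge0.
  have [p fp] := fA _ (divr_gt0 (divr_gt0 e0 (ltr0n R 2)) r0).
  have [q gq] := gA _ (divr_gt0 e0 (ltr0n R 2)).
  exists ([seq (k * t.1, t.2) | t <- p] ++ q) => X.
  rewrite ncpoly_funD ncpoly_funZ.
  have -> : (k *: f + g) X - (k *: ncpoly_fun p + ncpoly_fun q) X =
      k *: (f X - ncpoly_fun p X) + (g X - ncpoly_fun q X).
    by rewrite scalerBr addrACA -opprD.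
  apply: le_trans (spectral_normD _ _) _; rewrite [leRHS]splitr.
  apply: lerD (gq X); apply: le_trans (spectral_normZ _ _) _.
  apply: (@le_trans _ _ ((rnorm k + 1) * (e / 2 / (rnorm k + 1)))).
    by apply: ler_pM; rewrite ?rnorm_ge0 ?spectral_norm_ge0 ?lerDl.
  by rewrite mulrCA divff ?mulr1// gt_eqF.
- move=> f g fA gA.
  have /ncbounded_ge0[M M0 fM] := ncA_bounded fA.
  have /ncbounded_ge0[N N0 gN] := ncA_bounded gA.
  move/in_ncAP: fA => fA; move/in_ncAP: gA => gA; apply/in_ncAP => e e0.
  have N1 : 0 < N + 1 by rewrite ltr_wpDl.
  have [p fp] := fA _ (divr_gt0 (divr_gt0 e0 (ltr0n R 2)) N1).
  have /ncbounded_ge0[L L0 pL] := ncbounded_poly p.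
  have L1 : 0 < L + 1 by rewrite ltr_wpDl.
  have [q gq] := gA _ (divr_gt0 (divr_gt0 e0 (ltr0n R 2)) L1).
  exists [seq (s.1 * t.1, s.2 ++ t.2) | s <- p, t <- q] => X.
  rewrite ncpoly_funM.
  have -> : (f * g) X - (ncpoly_fun p * ncpoly_fun q) X =
      (f X - ncpoly_fun p X) * g X + ncpoly_fun p X * (g X - ncpoly_fun q X).
    by rewrite mulrBl mulrBr addrA subrK.
  apply: le_trans (spectral_normD _ _) _; rewrite [leRHS]splitr.
  apply: lerD; apply: le_trans (spectral_normM _ _) _.
    apply: (@le_trans _ _ (e / 2 / (N + 1) * (N + 1))); last by rewrite divfK ?gt_eqF.
    apply: ler_pM; rewrite ?spectral_norm_ge0//.
    by apply: le_trans (gN X) _; rewrite lerDl.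
  apply: (@le_trans _ _ ((L + 1) * (e / 2 / (L + 1)))).
    apply: ler_pM; rewrite ?spectral_norm_ge0//.
    by apply: le_trans (pL X) _; rewrite lerDl.
  by rewrite mulrCA divff ?mulr1// gt_eqF.
Qed.

HB.instance Definition _ :=
  GRing.isSubalgClosed.Build C ncfun in_ncA in_ncA_subalg.

Record ncA := NcA { ncA_fun :> ncfun ; _ : ncA_fun \in in_ncA }.

HB.instance Definition _ := [isSub for ncA_fun].
HB.instance Definition _ := [Choice of ncA by <:].
HB.instance Definition _ := [SubChoice_isSubAlgebra of ncA by <:].

Lemma nccoord_in_ncA j : nccoord j \in in_ncA.
Proof. by rewrite nccoordE; exact: ncpoly_in_ncA. Qed.

Definition ncA_coord (j : 'I_d) : ncA := NcA (nccoord_in_ncA j).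

Definition ncA_mxnorm (n : nat) (F : 'M[ncA]_n) : R :=
  sup [set spectral_norm (\mxblock_(i < n, j < n) ncA_fun (F i j) X) |
        X in [set: polydisk R d]].

End NcFunctions.

Arguments ncA_coord {R d} j.
Arguments ncA_mxnorm {R d} n F.

(* Main.v *)
Require Import Defs.
From HB Require Import structures.
From mathcomp Require Import all_boot all_order all_algebra.
From mathcomp Require Import all_classical all_reals all_analysis.
From mathcomp Require Import complex ring lra spectral sesquilinear.

(* Both norms are compared on polynomials.  For a point X of the polydisk, an
   Egervary dilation of the X_k, built on their Julia operators, gives unitaries
   W_k on a finite sum of copies of C^m that compress to the words in X of bounded
   length; freeness and universality bound the scalar polynomials in W by those in
   U, and the trick of taking powers of a^* a passes to matrices.  Conversely P(U) x
   only involves the span of finitely many U_w x_i, so that it can be computed with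
   the compressions of r U_k to that span, and r tends to 1.

   For the C*-envelope, let T = j(Z).  The point is that |q(U)| <= |q(T) + b| for every
   *-polynomial q and every b in a boundary ideal; the usual Arveson extension and
   multiplicative domain argument is replaced by one quadratic form.  On vectors y_w
   indexed by a suffix-closed set of words,
     |sum c_w y_w + b y_1|^2 - rho^2 |y_1|^2 - C sum_(w = l v) |y_w - l y_v|^2
   is affine in T, up to terms in the ideal, once |T y_v|^2 is replaced by |y_v|^2, so
   that its numerical range is controlled by the norms of matrices over j(A).  It is
   nearly nonpositive for rho = |q(T) + b| and C large, hence also at y_w = U_w x,
   where the last sum vanishes.  The map q(T) |-> q(U) thus extends to a
   *-homomorphism of C*(j(A)) that kills all boundary ideals, and it is onto because
   elements can be lifted approximately with norm control. *)

Set Implicit Arguments.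
Unset Strict Implicit.
Unset Printing Implicit Defensive.

Import Order.TTheory GRing.Theory Num.Theory.
Import numFieldNormedType.Exports.

Local Open Scope classical_set_scope.
Local Open Scope ring_scope.
Local Open Scope complex_scope.

(** * Real norms and inner products *)

(** For the envelope only norms of matrices over [j(A)] are at hand. They see numerical ranges
    because [Re a <= c] forces |1 + t (a - c)| <= 1 + O(t^2) as t tends to 0, while conversely this
    growth bounds [Re a] by c; so a comparison of norms for every t > 0 transfers upper bounds on
    forms. The obstacle is that [j(A)] contains T_k but not T_k^* T_k, so that |y_w - T_k y_v|^2 is
    out of reach. Putting |y_v|^2 for |T_k y_v|^2 can only increase it, T_k being contractive, so
    the new expression still controls the distance from y_w to T_k y_v; for the unitaries U_k
    nothing changes. An adjoint letter needs no adjoint in the form, since <T_k^* y_v, y_w> = <y_v,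
    T_k y_w>. A *-polynomial is not determined by its value q(T), so *-homomorphisms are handled as
    relations; contractivity is proved for the relation and makes it single-valued afterwards. That
    the image is closed usually rests on functional calculus. Here a bounded lift comes from the
    factor 1 + a^* a / 2, which dominates both 1 and a, and whose inverse is approximated by
    polynomials in it. *)

Section RealNorm.
Context {R : realType}.
Local Notation C := R[i].

Lemma rnorm0 (V : normedZmodType C) : rnorm (0 : V) = 0.
Proof. by rewrite /rnorm normr0. Qed.

Lemma rnormN (V : normedZmodType C) (x : V) : rnorm (- x) = rnorm x.
Proof. by rewrite /rnorm normrN. Qed.

Lemma rnormC (V : normedZmodType C) (x y : V) : rnorm (x - y) = rnorm (y - x).
Proof. by rewrite -rnormN opprB. Qed.

Lemma rnorm_triangle (V : normedZmodType C) (z x y : V) :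
  rnorm (x - y) <= rnorm (x - z) + rnorm (z - y).
Proof. by have := ler_rnormD (x - z) (z - y); rewrite addrA subrK. Qed.

Lemma rnorm_eq0 (V : normedZmodType C) (x : V) : rnorm x = 0 -> x = 0.
Proof. by move=> x0; apply/eqP; rewrite -normr_eq0 -rnormE x0. Qed.

Lemma rnormZ (V : normedModType C) (k : C) (x : V) :
  rnorm (k *: x) = rnorm k * rnorm x.
Proof. by apply: complexI; rewrite rmorphM /= !rnormE normrZ. Qed.

Lemma rnormRe (r : R) : rnorm r%:C = `|r|.
Proof.
apply: complexI; rewrite rnormE; have [r0|r0] := leP 0 r.
  by rewrite !ger0_norm// lecR.
by rewrite !ltr0_norm// ?ltcR// rmorphN.
Qed.

Lemma ler_Re_rnorm (z : C) : complex.Re z <= rnorm z.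
Proof.
by rewrite -lecR rnormE; apply: le_trans (normc_ge_Re z);
  rewrite lecR ler_norm.
Qed.

Lemma rnorm_conj (z : C) : rnorm (z^*)%C = rnorm z.
Proof. by case: z => a b; rewrite /rnorm !normc_def /= sqrrN. Qed.

Lemma Re_realM (a : R) (z : C) : complex.Re (a%:C * z) = a * complex.Re z.
Proof. by case: z => x y /=; rewrite mul0r subr0. Qed.

Lemma realCM (a b : R) : (a * b)%:C = a%:C * b%:C.
Proof. exact: rmorphM. Qed.

Lemma invS_small (e : R) : 0 < e ->
  exists N, forall n, (N <= n)%N -> n.+1%:R^-1 <= e.
Proof.
move=> e0; exists (Num.truncn e^-1) => n Nn.
rewrite invf_ple ?posrE// (le_trans (ltW (truncnS_gt _)))// ler_nat.
by rewrite ltnS.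
Qed.

(** Cauchy sequences and limits with real tolerances, as balls here have radii in [R[i]]. *)
Definition rcauchy (V : normedZmodType C) (u : nat -> V) : Prop :=
  forall e : R, 0 < e -> exists N, forall m n, (N <= m)%N -> (N <= n)%N ->
    rnorm (u m - u n) <= e.

Definition rlim (V : normedZmodType C) (u : nat -> V) (l : V) : Prop :=
  forall e : R, 0 < e -> exists N, forall n, (N <= n)%N -> rnorm (u n - l) <= e.

Lemma ball_rnorm (V : normedModType C) (x y : V) (e : C) : 0 < e ->
  ball x e y <-> rnorm (x - y) < complex.Re e.
Proof.
move=> e0; rewrite -ball_normE /=.
by rewrite -ltcR rnormE RRe_real // gtr0_real.
Qed.

Lemma rcauchy_cvg (V : completeNormedModType C) (u : nat -> V) :
  rcauchy u -> exists l, rlim u l.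
Proof.
move=> cu.
have /cauchy_cvg/cvg_ex[l ul] : cauchy (u @ \oo).
  apply/cauchy_exP => e e0.
  have re0 : 0 < complex.Re e by rewrite -ltcR RRe_real // gtr0_real.
  have [N uN] := cu _ (divr_gt0 re0 (ltr0n R 2)).
  exists (u N); exists N => // n /= Nn; apply/ball_rnorm => //.
  apply: le_lt_trans (uN N n (leqnn _) Nn) _; lra.
exists l => e e0.
have /cvgrPdist_lt /(_ e%:C) := ul; rewrite ltcR => /(_ e0)[N _ uN].
exists N => n Nn; rewrite rnormC ltW// -ltcR rnormE; exact: uN.
Qed.

(** A Cauchy filter contains balls of radius 1/(n+1); any two of them meet, so their centres form a
    Cauchy sequence, whose limit is the limit of the filter. *)
Lemma rcauchy_complete (V : normedModType C) :
  (forall u : nat -> V, rcauchy u -> exists l, rlim u l) ->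
  forall F : set_system V, ProperFilter F -> cauchy F -> cvg F.
Proof.
move=> cV F FF /cauchyP cF.
pose r n : R := n.+1%:R^-1.
have r0 n : 0 < r n by rewrite invr_gt0.
have rmono m n : (m <= n)%N -> r n <= r m.
  by move=> mn; rewrite lef_pV2 ?posrE// ler_nat.
have rsmall (e : R) : 0 < e -> exists n, r n < e.
  by move=> e0; exists (Num.truncn e^-1); rewrite /r invf_plt ?posrE// truncnS_gt.
have /choice[u uF] : forall n, exists x, F (ball x (r n)%:C).
  by move=> n; apply: cF; rewrite ltcR.
have uu m n : rnorm (u m - u n) <= r m + r n.
  have [x [bm bn]] := filter_ex (filterI (uF m) (uF n)).
  move/ball_rnorm: bm; move/ball_rnorm: bn; rewrite !ltcR !r0 => /(_ isT)/= bn /(_ isT)/= bm.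
  apply: le_trans (rnorm_triangle x _ _) _.
  by rewrite (rnormC x) lerD// ltW.
have [|l ul] := cV u.
  move=> e e0; have [N rN] := rsmall _ (divr_gt0 e0 (ltr0n R 2)).
  exists N => m n Nm Nn; apply: le_trans (uu m n) _.
  have := rmono _ _ Nm; have := rmono _ _ Nn; lra.
apply/cvg_ex; exists l; apply/cvgrPdist_lt => e e0.
have re0 : 0 < complex.Re e by rewrite -ltcR RRe_real // gtr0_real.
have [N1 rN] := rsmall _ (divr_gt0 re0 (ltr0n R 3)).
have [N2 uN] := ul _ (divr_gt0 re0 (ltr0n R 3)).
pose N := maxn N1 N2.
apply: filterS (uF N) => x /ball_rnorm; rewrite ltcR r0 => /(_ isT)/= ux.
rewrite -rnormE -[e]RRe_real ?gtr0_real// ltcR.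
apply: le_lt_trans (rnorm_triangle (u N) _ _) _; rewrite rnormC.
have := uN N (leq_maxr _ _); have := rmono _ _ (leq_maxl N1 N2 : (N1 <= N)%N).
lra.
Qed.

End RealNorm.

Section InnerProduct.
Context {R : realType} {H : hilbertType R}.
Local Notation C := R[i].
Implicit Types x y z : H.

Definition dotl (y x : H) : C := dot x y.

HB.instance Definition _ (y : H) :=
  GRing.isLinear.Build C H C _ (dotl y) (dot_scalar y).

Lemma dotDl x y z : dot (x + y) z = dot x z + dot y z.
Proof. exact: (linearD (dotl z)). Qed.

Lemma dotZl k x z : dot (k *: x) z = k * dot x z.
Proof. exact: (linearZ_LR (dotl z)). Qed.

Lemma dot0l z : dot 0 z = 0 :> C.
Proof. exact: (linear0 (dotl z)). Qed.

Lemma dotNl x z : dot (- x) z = - dot x z.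
Proof. exact: (linearN (dotl z)). Qed.

Lemma dotBl x y z : dot (x - y) z = dot x z - dot y z.
Proof. exact: (linearB (dotl z)). Qed.

Lemma dot_suml I (r : seq I) (P : pred I) (F : I -> H) z :
  dot (\sum_(i <- r | P i) F i) z = \sum_(i <- r | P i) dot (F i) z.
Proof. exact: (linear_sum (dotl z)). Qed.

Lemma dotDr x y z : dot z (x + y) = dot z x + dot z y.
Proof. by rewrite dot_conj dotDl rmorphD /= -!dot_conj. Qed.

Lemma dotZr k x z : dot z (k *: x) = (k^*)%C * dot z x.
Proof. by rewrite dot_conj dotZl rmorphM /= -!dot_conj. Qed.

Lemma dot0r z : dot z 0 = 0 :> C.
Proof. by rewrite dot_conj dot0l rmorph0. Qed.

Lemma dotNr x z : dot z (- x) = - dot z x.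
Proof. by rewrite dot_conj dotNl rmorphN /= -dot_conj. Qed.

Lemma dot_sumr I (r : seq I) (P : pred I) (F : I -> H) z :
  dot z (\sum_(i <- r | P i) F i) = \sum_(i <- r | P i) dot z (F i).
Proof.
rewrite dot_conj dot_suml rmorph_sum /=.
by apply: eq_bigr => i _; rewrite -dot_conj.
Qed.

Lemma Re_dotC x y : complex.Re (dot x y) = complex.Re (dot y x).
Proof. by rewrite (dot_conj y x); case: (dot y x). Qed.

Lemma dotxx x : dot x x = (rnorm x ^+ 2)%:C.
Proof. by rewrite dot_norm -rnormE rmorphXn. Qed.

Lemma Re_dotxx x : complex.Re (dot x x) = rnorm x ^+ 2.
Proof. by rewrite dotxx. Qed.

Lemma sqr_rnormD x y :
  rnorm (x + y) ^+ 2 = rnorm x ^+ 2 + 2 * complex.Re (dot x y) + rnorm y ^+ 2.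
Proof.
rewrite -!Re_dotxx !dotDl !dotDr !raddfD /= (Re_dotC y x); ring.
Qed.

Lemma sqr_rnormB x y :
  rnorm (x - y) ^+ 2 = rnorm x ^+ 2 - 2 * complex.Re (dot x y) + rnorm y ^+ 2.
Proof. by rewrite sqr_rnormD dotNr raddfN /= rnormN; ring. Qed.

(** Expand the square of the norm of |y| x - |x| y and divide by |x| |y|. *)
Lemma Re_dot_le x y : complex.Re (dot x y) <= rnorm x * rnorm y.
Proof.
have [->|y0] := eqVneq y 0; first by rewrite dot0r rnorm0 mulr0.
have ny : 0 < rnorm y.
  by rewrite lt_neqAle rnorm_ge0 andbT eq_sym; apply: contra y0 => /eqP/rnorm_eq0 ->.
have [->|x0] := eqVneq x 0; first by rewrite dot0l rnorm0 mul0r.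
have nx : 0 < rnorm x.
  by rewrite lt_neqAle rnorm_ge0 andbT eq_sym; apply: contra x0 => /eqP/rnorm_eq0 ->.
have := sqr_ge0 (rnorm ((rnorm y)%:C *: x - (rnorm x)%:C *: y)).
rewrite sqr_rnormB dotZl dotZr !rnormZ !rnormRe !ger0_norm ?rnorm_ge0//.
rewrite conjc_real mulrA -rmorphM /= Re_realM.
have p : 0 < rnorm x * rnorm y by rewrite mulr_gt0.
by move=> h; rewrite -(ler_pM2l p); lra.
Qed.

(** Multiplying x by the conjugate of <x, y> makes the product real, which reduces the claim to
    [Re_dot_le]. *)
Lemma dot_le x y : rnorm (dot x y) <= rnorm x * rnorm y.
Proof.
set z := dot x y; have [->|z0] := eqVneq z 0.
  by rewrite rnorm0 mulr_ge0 ?rnorm_ge0.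
have nz : 0 < rnorm z.
  by rewrite lt_neqAle rnorm_ge0 andbT eq_sym; apply: contra z0 => /eqP/rnorm_eq0 ->.
have := Re_dot_le ((z^*)%C *: x) y; rewrite dotZl rnormZ -/z rnorm_conj.
have -> : (z^*)%C * z = (rnorm z ^+ 2)%:C.
  by rewrite mulrC; case: (z) => a b; rewrite /rnorm normc_def /= sqr_sqrtr ?addr_ge0 ?sqr_ge0//;
    apply/eqP; rewrite eq_complex /=; apply/andP; split; apply/eqP; ring.
by rewrite /= expr2 -mulrA ler_pM2l.
Qed.

Lemma dot_inj x y : (forall z, dot x z = dot y z) -> x = y.
Proof.
move=> xy; apply/eqP; rewrite -subr_eq0; apply/eqP/rnorm_eq0.
by apply/eqP; rewrite -[_ == _](expf_eq0 _ 2) -Re_dotxx dotBl xy subrr.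
Qed.

Lemma dot_injr x y : (forall z, dot z x = dot z y) -> x = y.
Proof. by move=> xy; apply: dot_inj => z; rewrite 2!(dot_conj z) xy. Qed.

End InnerProduct.

(** * Bounded operators *)

Section BoundedOperators.
Context {R : realType} {H : hilbertType R}.
Local Notation C := R[i].
Implicit Types a b : op H.

Lemma op_bound (a : op H) : exists2 M, 0 <= M & forall x, rnorm (a x) <= M * rnorm x.
Proof.
have /continuous_linear_bounded/linear_boundedP : {for 0, continuous a}.
  exact: op_continuous.
case=> M [Mr aM].
have M0 : 0 <= `|M| + 1 by rewrite addr_ge0.
exists (complex.Re (`|M| + 1)) => [|x].
  by rewrite -lecR RRe_real // ger0_real.
rewrite -lecR realCM !rnormE (RRe_real (ger0_real M0)).
by apply: aM; rewrite (le_lt_trans (real_ler_norm Mr))// ltrDl.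
Qed.

Lemma is_op_bounded (f : H -> H) (M : R) :
  linear f -> (forall x, rnorm (f x) <= M * rnorm x) -> f \in @is_op R H.
Proof.
move=> lf fM; apply/is_opP; split => //.
pose f' : {linear H -> H} := HB.pack f (GRing.isLinear.Build C H H *:%R f lf).
apply: (@bounded_linear_continuous _ _ _ f'); apply/linear_boundedP.
exists `|M|%:C; split; first by rewrite ger0_real// lecR.
move=> r Mr x; rewrite -!rnormE.
apply: (@le_trans _ _ (`|M| * rnorm x)%:C).
  by rewrite lecR (le_trans (fM x))// ler_wpM2r ?rnorm_ge0// ler_norm.
by rewrite realCM ler_wpM2r ?lecR ?rnorm_ge0// ltW.
Qed.

Lemma ballnorm_has_sup (a : op H) :
  has_sup [set rnorm (a x) | x in [set x : H | rnorm x <= 1]].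
Proof.
split; first by exists (rnorm (a 0)); exists 0 => //=; rewrite rnorm0.
have [M M0 aM] := op_bound a; exists M => _ [x /= x1 <-].
by apply: le_trans (aM x) _; rewrite ler_piMr.
Qed.

Lemma opnorm_ge0 a : 0 <= opnorm a.
Proof.
apply: le_trans (rnorm_ge0 (a 0)) _.
by apply: (ub_le_sup (ballnorm_has_sup a).2); exists 0 => //=; rewrite rnorm0.
Qed.

Lemma rnorm_gt0 (V : normedZmodType C) (x : V) : x != 0 -> 0 < rnorm x.
Proof.
move=> x0; rewrite lt_neqAle rnorm_ge0 andbT eq_sym.
by apply: contra x0 => /eqP/rnorm_eq0 ->.
Qed.

Lemma opnorm_ub a x : rnorm (a x) <= opnorm a * rnorm x.
Proof.
have [->|x0] := eqVneq x 0; first by rewrite linear0 rnorm0 mulr0.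
have nx := rnorm_gt0 x0.
rewrite -ler_pdivrMr// mulrC.
have -> : (rnorm x)^-1 * rnorm (a x) = rnorm (a ((rnorm x)^-1%:C *: x)).
  by rewrite linearZ rnormZ rnormRe ger0_norm// invr_ge0 ltW.
apply: (ub_le_sup (ballnorm_has_sup a).2); eexists; last reflexivity.
by rewrite /= rnormZ rnormRe ger0_norm ?invr_ge0 ?(ltW nx)// mulVf ?lt0r_neq0.
Qed.

Lemma opnorm_le a c : 0 <= c -> (forall x, rnorm (a x) <= c * rnorm x) ->
  opnorm a <= c.
Proof.
move=> c0 h; apply: ge_sup; first exact: (ballnorm_has_sup a).1.
by move=> _ [x /= x1 <-]; apply: le_trans (h x) _; rewrite ler_piMr.
Qed.

Lemma opnormD a b : opnorm (a + b) <= opnorm a + opnorm b.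
Proof.
apply: opnorm_le; first by rewrite addr_ge0 ?opnorm_ge0.
move=> x; rewrite mulrDl; apply: le_trans (ler_rnormD _ _) _.
by apply: lerD; exact: opnorm_ub.
Qed.

Lemma opnormM a b : opnorm (a * b) <= opnorm a * opnorm b.
Proof.
apply: opnorm_le; first by rewrite mulr_ge0 ?opnorm_ge0.
move=> x; apply: le_trans (opnorm_ub a (b x)) _.
by rewrite -mulrA ler_wpM2l ?opnorm_ge0// opnorm_ub.
Qed.

Lemma opnormZ k a : opnorm (k *: a) <= rnorm k * opnorm a.
Proof.
apply: opnorm_le; first by rewrite mulr_ge0 ?rnorm_ge0 ?opnorm_ge0.
move=> x; have -> : (k *: a) x = k *: a x by [].
by rewrite rnormZ -mulrA ler_wpM2l ?rnorm_ge0// opnorm_ub.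
Qed.

Lemma opnormN a : opnorm (- a) = opnorm a.
Proof.
rewrite /opnorm; congr sup; apply/seteqP; split => _ [x x1 <-];
  by exists x => //; rewrite (_ : (- a) x = - a x)// rnormN.
Qed.

Lemma opnormC a b : opnorm (a - b) = opnorm (b - a).
Proof. by rewrite -opnormN opprB. Qed.

Lemma opnorm_triangle b a c : opnorm (a - c) <= opnorm (a - b) + opnorm (b - c).
Proof. by have := opnormD (a - b) (b - c); rewrite addrA subrK. Qed.

Lemma opnorm0 : opnorm (0 : op H) = 0.
Proof.
apply/le_anti; rewrite opnorm_ge0 andbT; apply: opnorm_le => // x.
by rewrite mul0r (_ : (0 : op H) x = 0)// rnorm0.
Qed.

Lemma opnorm_eq0 a : opnorm a = 0 -> a = 0.
Proof.
move=> a0; apply: opP => x; apply: rnorm_eq0; apply/le_anti.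
by rewrite rnorm_ge0 andbT (le_trans (opnorm_ub a x))// a0 mul0r.
Qed.

Lemma opnorm1 : opnorm (1 : op H) <= 1.
Proof. by apply: opnorm_le => // x; rewrite mul1r. Qed.

Lemma opnorm_small a : (forall e, 0 < e -> opnorm a <= e) -> a = 0.
Proof.
move=> h; apply: opnorm_eq0; apply/le_anti; rewrite opnorm_ge0 andbT.
by apply/ler_addgt0Pr => e /h; rewrite add0r.
Qed.

Lemma adjoint_sym a b : adjoint a b -> adjoint b a.
Proof. by move=> ab x y; rewrite dot_conj -ab -dot_conj. Qed.

Lemma adjoint_uniq a b c : adjoint a b -> adjoint a c -> b = c.
Proof. by move=> ab ac; apply: opP => x; apply: dot_injr => z; rewrite -ab -ac. Qed.

Lemma adjointD a b a' b' : adjoint a a' -> adjoint b b' -> adjoint (a + b) (a' + b').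
Proof. by move=> aa bb x y; rewrite [LHS]dotDl [RHS]dotDr aa bb. Qed.

Lemma adjointZ k a a' : adjoint a a' -> adjoint (k *: a) ((k^*)%C *: a').
Proof. by move=> aa x y; rewrite [LHS]dotZl [RHS]dotZr conjcK aa. Qed.

Lemma adjointM a b a' b' : adjoint a a' -> adjoint b b' -> adjoint (a * b) (b' * a').
Proof. by move=> aa bb x y; rewrite [LHS]aa bb. Qed.

Lemma adjoint0 : adjoint (0 : op H) 0.
Proof. by move=> x y; rewrite [LHS]dot0l [RHS]dot0r. Qed.

Lemma adjointB a b a' b' : adjoint a a' -> adjoint b b' -> adjoint (a - b) (a' - b').
Proof.
move=> aa bb; have := adjointD aa (adjointZ (-1) bb).
by rewrite rmorphN1 !scaleN1r.
Qed.

Lemma adjoint_norm_le a b : adjoint a b -> opnorm b <= opnorm a.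
Proof.
move=> ab; apply: opnorm_le => [|x]; first exact: opnorm_ge0.
have [bx0|bx0] := eqVneq (b x) 0.
  by rewrite bx0 rnorm0 mulr_ge0 ?rnorm_ge0 ?opnorm_ge0.
rewrite -(ler_pM2l (rnorm_gt0 bx0)) -expr2 -Re_dotxx -ab.
apply: le_trans (Re_dot_le _ _) _.
by rewrite mulrCA mulrA ler_wpM2r ?rnorm_ge0// opnorm_ub.
Qed.

Lemma adjoint_norm a b : adjoint a b -> opnorm b = opnorm a.
Proof.
by move=> ab; apply/le_anti; rewrite !adjoint_norm_le//; exact: adjoint_sym.
Qed.

Lemma cstar_identity a b : adjoint a b -> opnorm (b * a) = opnorm a ^+ 2.
Proof.
move=> ab; apply/le_anti/andP; split.
  by rewrite (le_trans (opnormM _ _))// (adjoint_norm ab) expr2.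
rewrite -[leRHS]sqr_sqrtr ?opnorm_ge0// ler_pXn2r ?nnegrE ?opnorm_ge0 ?sqrtr_ge0//.
apply: opnorm_le => [|x]; first exact: sqrtr_ge0.
rewrite -[leLHS]ger0_norm ?rnorm_ge0// -sqrtr_sqr -[rnorm x]ger0_norm ?rnorm_ge0//.
rewrite -sqrtr_sqr -sqrtrM ?opnorm_ge0// ler_wsqrtr// -Re_dotxx ab.
apply: le_trans (Re_dot_le _ _) _; rewrite mulrC expr2 mulrA ler_wpM2r ?rnorm_ge0//.
exact: opnorm_ub (b * a) x.
Qed.

Lemma rlim_uniq (V : normedZmodType C) (u : nat -> V) l m :
  rlim u l -> rlim u m -> l = m.
Proof.
move=> ul um; apply/eqP; rewrite -subr_eq0; apply/eqP/rnorm_eq0/le_anti.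
rewrite rnorm_ge0 andbT; apply/ler_addgt0Pr => e e0; rewrite add0r.
have e2 := divr_gt0 e0 (ltr0n R 2).
have [[N uN] [M uM]] := (ul _ e2, um _ e2).
apply: le_trans (rnorm_triangle (u (maxn N M)) _ _) _.
rewrite (rnormC l) [leRHS]splitr; apply: lerD; first exact: uN (leq_maxl _ _).
exact: uM (leq_maxr _ _).
Qed.

Lemma rlim_le (V : normedZmodType C) (u : nat -> V) l x (c : R) :
  rlim u l -> (exists N, forall n, (N <= n)%N -> rnorm (u n - x) <= c) ->
  rnorm (l - x) <= c.
Proof.
move=> ul [M uM]; apply/ler_addgt0Pr => e e0.
have [N uN] := ul _ e0.
apply: le_trans (rnorm_triangle (u (maxn N M)) _ _) _.
rewrite addrC (rnormC l); apply: lerD; first exact: uM (leq_maxr _ _).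
exact: uN (leq_maxl _ _).
Qed.

(* S e is the set of admissible approximations up to e. *)
Lemma op_limit (S : R -> op H -> Prop) :
  (forall e, 0 < e -> exists a, S e a) ->
  (forall e d a b, 0 < e -> 0 < d -> S e a -> S d b -> opnorm (a - b) <= e + d) ->
  exists b, forall e a, 0 < e -> S e a -> opnorm (a - b) <= e.
Proof.
move=> Sex Sab; pose r n : R := n.+1%:R^-1.
have r0 n : 0 < r n by rewrite invr_gt0.
have rsmall (e : R) : 0 < e -> exists N, forall n, (N <= n)%N -> r n <= e.
  exact: invS_small.
have /choice[s sS] : forall n, exists a, S (r n) a by move=> n; exact: Sex.
have sc x : rcauchy (fun n => s n x).
  move=> e e0; have [x0|x0] := eqVneq (rnorm x) 0.
    by exists 0%N => m n _ _; rewrite /= (rnorm_eq0 x0) !linear0 addr0 rnorm0 ltW.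
  have nx : 0 < rnorm x by rewrite lt_neqAle eq_sym x0 rnorm_ge0.
  have [N rN] := rsmall _ (divr_gt0 (divr_gt0 e0 (ltr0n R 2)) nx).
  exists N => m n Nm Nn; apply: le_trans (opnorm_ub (s m - s n) x) _.
  rewrite -ler_pdivlMr// (le_trans (Sab _ _ _ _ (r0 m) (r0 n) (sS m) (sS n)))//.
  have := rN _ Nm; have := rN _ Nn; lra.
have /choice[f fl] x := rcauchy_cvg (sc x).
have lf : linear f.
  move=> k x y; apply: rlim_uniq (fl _) _ => e e0.
  have k0 : 0 < rnorm k + 1 by rewrite ltr_wpDl ?rnorm_ge0.
  have [N xN] := fl x _ (divr_gt0 (divr_gt0 e0 (ltr0n R 2)) k0).
  have [M yM] := fl y _ (divr_gt0 e0 (ltr0n R 2)).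
  exists (maxn N M) => n; rewrite geq_max => /andP[Nn Mn].
  rewrite linearP.
  have -> : k *: s n x + s n y - (k *: f x + f y) = k *: (s n x - f x) + (s n y - f y).
    by rewrite scalerBr opprD addrACA.
  rewrite (le_trans (ler_rnormD _ _))// [leRHS]splitr lerD ?yM// rnormZ.
  have := xN _ Nn; rewrite ler_pdivlMr//; have := rnorm_ge0 (s n x - f x); lra.
have key e a x : 0 < e -> S e a -> rnorm (f x - a x) <= e * rnorm x.
  move=> e0 Sa; apply/ler_addgt0Pr => d d0.
  apply: rlim_le (fl x) _.
  have nx : 0 < rnorm x + 1 by rewrite ltr_wpDl ?rnorm_ge0.
  have [N rN] := rsmall _ (divr_gt0 d0 nx).
  exists N => n Nn; apply: le_trans (opnorm_ub (s n - a) x) _.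
  have := Sab _ _ _ _ (r0 n) e0 (sS n) Sa.
  have := rN _ Nn; rewrite ler_pdivlMr// => h1 h2.
  apply: le_trans (ler_wpM2r (rnorm_ge0 x) h2) _.
  have := r0 n; rewrite mulrDl; lra.
have [a1 Sa1] := Sex 1 ltr01.
have fop : f \in @is_op R H.
  apply: (@is_op_bounded _ (1 + opnorm a1)) => // x.
  rewrite -(subrK (a1 x) (f x)) mulrDl (le_trans (ler_rnormD _ _))// lerD ?opnorm_ub//.
  exact: key.
exists (Op fop) => e a e0 Sa; apply: opnorm_le => [|x]; first exact: ltW.
by rewrite -[_ x]/(a x - f x) rnormC; exact: key.
Qed.

End BoundedOperators.

(** * Riesz representation and the existence of adjoints *)

Section Riesz.
Context {R : realType} {H : hilbertType R}.
Local Notation C := R[i].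

(** The representing vector is the minimiser of [J y] = |y|^2 - 2 Re f(y), which is bounded below
    because |f(y)| <= M |y|. *)
Lemma riesz (f : H -> C) (M : R) : scalar f ->
  (forall x, rnorm (f x) <= M * rnorm x) -> exists y, forall x, f x = dot x y.
Proof.
move=> lf fM.
pose f' : {scalar H} := HB.pack f (GRing.isLinear.Build C H C _ f lf).
have fD x y : f (x + y) = f x + f y by exact: (linearD f').
have fZ k x : f (k *: x) = k * f x by exact: (linearZ_LR f').
pose J y := rnorm y ^+ 2 - 2 * complex.Re (f y).
have J_ge y : - M ^+ 2 <= J y.
  rewrite /J; have := ler_Re_rnorm (f y); have := fM y.
  by have := sqr_ge0 (rnorm y - M); lra.
pose m := inf (range J).
have hinf : has_inf (range J).
  by split; [exists (J 0); exists 0|exists (- M ^+ 2) => _ [y _ <-]].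
have mJ y : m <= J y by apply: (ge_inf hinf.2); exists y.
have JD x y : J (x + y) = J x + J y + 2 * complex.Re (dot x y).
  by rewrite /J sqr_rnormD fD raddfD /=; ring.
have JZ (t : R) x : J (t%:C *: x) = t ^+ 2 * rnorm x ^+ 2 - 2 * (t * complex.Re (f x)).
  by rewrite /J rnormZ rnormRe exprMn real_normK ?num_real// fZ Re_realM.
have /choice[u uJ] : forall n : nat, exists y, J y <= m + n.+1%:R^-1.
  move=> n; have n0 : 0 < n.+1%:R^-1 :> R by rewrite invr_gt0.
  by have [_ [y _ <-] /ltW] := inf_adherent n0 hinf; exists y.
(* The midpoint of two near-minimisers cannot beat m, so by the parallelogram law they are close. *)
have uu i j : rnorm (u i - u j) ^+ 2 <= 2 * i.+1%:R^-1 + 2 * j.+1%:R^-1.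
  have := mJ (2^-1%:C *: (u i + u j)); have := uJ i; have := uJ j.
  rewrite JZ sqr_rnormB sqr_rnormD fD raddfD /= /J. move: (i.+1%:R^-1) (j.+1%:R^-1) => ri rj; lra.
have [y uy] : exists y, rlim u y.
  apply: rcauchy_cvg => e e0.
  have [N rN] := invS_small (divr_gt0 (exprn_gt0 2 e0) (ltr0n R 4)).
  exists N => i j Ni Nj; rewrite -(ler_pXn2r (n := 2)) ?nnegrE ?rnorm_ge0 ?(ltW e0)//.
  apply: le_trans (uu i j) _; have := rN _ Ni; have := rN _ Nj.
  by move: (i.+1%:R^-1) (j.+1%:R^-1) => ri rj; lra.
(* This is J(y + t x) >= J(y), obtained along the minimising sequence. *)
have key x (t : R) : 0 <= 2 * t * (complex.Re (dot x y) - complex.Re (f x)) + t ^+ 2 * rnorm x ^+ 2.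
  apply/ler_addgt0Pr => e e0.
  have [|N1 rN] := invS_small (e := e / 2); first lra.
  pose c := 2 * (`|t| + 1) * (rnorm x + 1).
  have c0 : 0 < c by rewrite /c; have := rnorm_ge0 x; have := normr_ge0 t; nra.
  have [|N2 uN] := uy (e / 2 / c); first by rewrite !divr_gt0.
  pose N := maxn N1 N2.
  have h1 := rN N (leq_maxl _ _); have := uN N (leq_maxr _ _).
  rewrite ler_pdivlMr// => h2.
  have := mJ (t%:C *: x + u N); rewrite JD JZ dotZl Re_realM; have := uJ N.
  have -> : dot x (u N) = dot x y + dot x (u N - y) by rewrite -dotDr addrC subrK.
  rewrite raddfD /=.
  have : 2 * (t * complex.Re (dot x (u N - y))) <= e / 2.
    apply: le_trans h2; rewrite [leRHS]mulrC /c -!mulrA ler_wpM2l ?ler0n//.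
    apply: le_trans (ler_norm _) _; rewrite normrM.
    have : `|complex.Re (dot x (u N - y))| <= rnorm x * rnorm (u N - y).
      rewrite ler_norml lerNl -raddfN /= -dotNl -(rnormN x).
      by rewrite Re_dot_le rnormN Re_dot_le.
    have := rnorm_ge0 x; have := rnorm_ge0 (u N - y); have := normr_ge0 t.
    have := normr_ge0 (complex.Re (dot x (u N - y))).
    set a := `|t|; set b := `|_|; set p := rnorm x; set q := rnorm _ => *.
    have : a * b <= a * (p * q) by rewrite ler_wpM2l.
    have : 0 <= a * q by rewrite mulr_ge0.
    have : 0 <= p * q by rewrite mulr_ge0.
    nra.
  by move: (N.+1%:R^-1) h1 => rN1; lra.
have ReE x : complex.Re (f x) = complex.Re (dot x y).
  set d := complex.Re (dot x y) - complex.Re (f x); set s := rnorm x ^+ 2.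
  have s0 : 0 <= s by exact: sqr_ge0.
  have k t := key x t; rewrite -/d -/s in k.
  suff : d = 0 by rewrite /d; lra.
  (* A value of t that makes the quadratic negative unless d = 0; the + 1 covers x = 0. *)
  have := k (- d / (s + 1)).
  have -> : 2 * (- d / (s + 1)) * d + (- d / (s + 1)) ^+ 2 * s =
      - d ^+ 2 * ((s + 2) / (s + 1) ^+ 2) by field; lra.
  rewrite mulNr oppr_ge0 pmulr_lle0 ?divr_gt0 ?exprn_gt0//; try lra.
  move=> d0; apply/eqP; rewrite -[_ == _](expf_eq0 _ 2); apply/eqP.
  by apply/le_anti; rewrite d0 sqr_ge0.
exists y => x; apply/eqP; rewrite eq_complex ReE eqxx /=.
(* The imaginary parts agree by the real identity at i x. *)
have := ReE ('i *: x); rewrite fZ dotZl.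
by case: (f x) (dot x y) => p q [r t] /=; rewrite !mul0r !mul1r => ?; apply/eqP; lra.
Qed.

Lemma adjoint_exists (a : op H) : exists b, adjoint a b.
Proof.
have /choice[b ab] : forall y, exists z, forall x, dot (a x) y = dot x z.
  move=> y; apply: (@riesz _ (opnorm a * rnorm y)).
    by move=> k u v; rewrite linearP dotDl dotZl.
  move=> x; apply: le_trans (dot_le _ _) _; rewrite mulrAC.
  by rewrite ler_wpM2r ?rnorm_ge0// opnorm_ub.
have lb : linear b.
  by move=> k x y; apply: dot_injr => z; rewrite -ab dotDr dotZr !ab -dotZr -dotDr.
have bop : b \in @is_op R H.
  apply: (@is_op_bounded _ _ _ (opnorm a)) => // y.
  have [by0|by0] := eqVneq (b y) 0.
    by rewrite by0 rnorm0 mulr_ge0 ?rnorm_ge0 ?opnorm_ge0.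
  rewrite -(ler_pM2l (rnorm_gt0 by0)) -expr2 -Re_dotxx -ab.
  apply: le_trans (Re_dot_le _ _) _.
  by rewrite mulrCA mulrA ler_wpM2r ?rnorm_ge0// opnorm_ub.
by exists (Op bop) => x y; exact: ab.
Qed.

End Riesz.

(** * Hilbert sums and operator matrices *)

Section HilbertSum.
Context (R : realType) (H : hilbertType R) (n : nat).
Local Notation C := R[i].

(** A separate name for the function type, to carry the l2 norm; matrices over [op H] then become
    single operators. *)
Definition hsum : Type := 'I_n -> H.

HB.instance Definition _ := GRing.Lmodule.on hsum.

Fact hsum_normD (x y : hsum) : (l2norm (x + y))%:C <= (l2norm x)%:C + (l2norm y)%:C.
Proof. by rewrite -rmorphD /= lecR; exact: ler_l2normD. Qed.

Fact hsum_normZ (k : C) (x : hsum) : (l2norm (k *: x))%:C = `|k| * (l2norm x)%:C.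
Proof.
rewrite -[`|k|]rnormE -realCM; congr (_%:C).
rewrite -[rnorm k]ger0_norm ?rnorm_ge0// -sqrtr_sqr -sqrtrM ?sqr_ge0//.
congr Num.sqrt; rewrite mulr_sumr; apply: eq_bigr => i _.
by rewrite -exprMn -rnormZ.
Qed.

Fact hsum_norm0_eq0 (x : hsum) : (l2norm x)%:C = 0 -> x = 0.
Proof.
move=> /complexI x0; apply/funext => i; apply: rnorm_eq0; apply/le_anti.
by rewrite rnorm_ge0 andbT -[leRHS]x0 ler_rnorm_l2norm.
Qed.

HB.instance Definition _ :=
  Lmodule_isNormed.Build C hsum hsum_normD hsum_normZ hsum_norm0_eq0.

Lemma rnorm_hsum (x : hsum) : rnorm x = l2norm x.
Proof. by apply: complexI; rewrite rnormE. Qed.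

Lemma sqr_rnorm_hsum (x : hsum) : rnorm x ^+ 2 = \sum_i rnorm (x i) ^+ 2.
Proof. by rewrite rnorm_hsum sqr_l2norm. Qed.

Lemma rnorm_hsum_le (x : hsum) : rnorm x <= \sum_i rnorm (x i).
Proof.
rewrite -(ler_pXn2r (n := 2)) ?nnegrE ?rnorm_ge0 ?sumr_ge0//; last first.
  by move=> i _; exact: rnorm_ge0.
rewrite sqr_rnorm_hsum [leRHS]expr2 mulr_suml; apply: ler_sum => i _.
rewrite expr2 ler_wpM2l ?rnorm_ge0// (bigD1 i)//= lerDl sumr_ge0// => j _.
exact: rnorm_ge0.
Qed.

Lemma rnorm_coord_le (x : hsum) i : rnorm (x i) <= rnorm x.
Proof. by rewrite rnorm_hsum ler_rnorm_l2norm. Qed.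

Fact hsum_complete (F : set_system hsum) : ProperFilter F -> cauchy F -> cvg F.
Proof.
apply: rcauchy_complete => u cu.
have /choice[l ul] : forall i, exists l, rlim (fun k => u k i) l.
  move=> i; apply: rcauchy_cvg => e /cu[N uN]; exists N => p q Np Nq.
  exact: le_trans (rnorm_coord_le (u p - u q) i) (uN _ _ Np Nq).
exists l => e e0.
have n0 : 0 < n%:R + 1 :> R by rewrite ltr_wpDl.
have /choice[N uN] i := ul i _ (divr_gt0 e0 n0).
exists (\max_i N i)%N => p Np.
apply: le_trans (rnorm_hsum_le _) _.
apply: (@le_trans _ _ (\sum_(i < n) e / (n%:R + 1))).
  by apply: ler_sum => i _; apply: uN; apply: leq_trans Np; exact: leq_bigmax.
rewrite sumr_const card_ord -[leLHS]mulr_natl mulrCA ler_piMr ?(ltW e0)//.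
by rewrite ler_pdivrMr// mul1r lerDl.
Qed.

HB.instance Definition _ := Uniform_isComplete.Build hsum hsum_complete.

Definition hsum_dot (x y : hsum) : C := \sum_i dot (x i) (y i).

Fact hsum_dot_scalar (y : hsum) : scalar (hsum_dot^~ y).
Proof.
move=> k u v; rewrite /hsum_dot mulr_sumr -big_split; apply: eq_bigr => i _ /=.
by rewrite dotDl dotZl.
Qed.

Fact hsum_dot_conj (x y : hsum) : hsum_dot y x = (hsum_dot x y)^*%C.
Proof. by rewrite /hsum_dot rmorph_sum; apply: eq_bigr => i _ /=; exact: dot_conj. Qed.

Fact hsum_dot_norm (x : hsum) : hsum_dot x x = `|x| ^+ 2.
Proof.
rewrite -rnormE -rmorphXn /= sqr_rnorm_hsum rmorph_sum /=.
by apply: eq_bigr => i _; rewrite dotxx.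
Qed.

HB.instance Definition _ := isHilbertSpace.Build R hsum
  hsum_dot_scalar hsum_dot_conj hsum_dot_norm.

Lemma dot_hsum (x y : hsum) : dot x y = \sum_i dot (x i) (y i).
Proof. by []. Qed.

Lemma hsum_sumE I (r : seq I) (P : pred I) (F : I -> hsum) i :
  (\sum_(k <- r | P k) F k) i = \sum_(k <- r | P k) F k i.
Proof. by rewrite fct_sumE. Qed.

End HilbertSum.

Section ComplexLine.
Context (R : realType).
Local Notation C := R[i].

(* [R[i]^o] cannot be used directly: its [GRing.regular] key already carries the
   completeness of [realType]. *)
Definition cline : Type := C.

HB.instance Definition _ := NormedModule.copy cline C^o.

Fact complex_complete (F : set_system cline) : ProperFilter F -> cauchy F -> cvg F.
Proof.
apply: rcauchy_complete => u cu.
have re_le (z : C) : `|complex.Re z| <= rnorm z.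
  by rewrite -lecR rnormE; exact: normc_ge_Re.
have im_le (z : C) : `|complex.Im z| <= rnorm z.
  by case: z => a b; rewrite /rnorm normc_def /= -sqrtr_sqr ler_wsqrtr// lerDr sqr_ge0.
have le_re_im (z : C) : rnorm z <= `|complex.Re z| + `|complex.Im z|.
  case: z => a b; rewrite /rnorm normc_def /=.
  rewrite -[leRHS]ger0_norm ?addr_ge0// -sqrtr_sqr ler_wsqrtr//.
  rewrite sqrrD !real_normK ?num_real//.
  by have := normr_ge0 a; have := normr_ge0 b; nra.
have rcv (v : nat -> R) : (forall m n, `|v m - v n| <= rnorm (u m - u n)) ->
    exists l, forall e, 0 < e -> exists N, forall n, (N <= n)%N -> `|v n - l| <= e.
  move=> vu; have /cauchy_cvg/cvg_ex[l vl] : cauchy (v @ \oo).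
    apply/cauchy_exP => e e0; have [|N uN] := cu (e / 2); first by rewrite divr_gt0.
    exists (v N); exists N => // n /= Nn; rewrite /ball /=.
    have := le_trans (vu N n) (uN _ _ (leqnn N) Nn); lra.
  exists l => e e0; have /cvgrPdist_le /(_ e e0)[N _ vN] := vl.
  by exists N => n Nn; rewrite distrC; exact: vN.
have [|a ua] := rcv (fun k => complex.Re (u k)).
  by move=> m n; move: (re_le (u m - u n)); rewrite raddfB.
have [|b ub] := rcv (fun k => complex.Im (u k)).
  by move=> m n; move: (im_le (u m - u n)); rewrite raddfB.
exists (a +i* b)%C => e e0.
have [[N1 N1a] [N2 N2b]] := (ua _ (divr_gt0 e0 (ltr0n R 2)), ub _ (divr_gt0 e0 (ltr0n R 2))).
exists (maxn N1 N2) => n; rewrite geq_max => /andP[/N1a h1 /N2b h2].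
apply: le_trans (le_re_im _) _; rewrite [leRHS]splitr.
by case: (u n) h1 h2 => p q /= h1 h2; apply: lerD.
Qed.

HB.instance Definition _ := Uniform_isComplete.Build cline complex_complete.

Definition complex_dot (x y : cline) : C := x * (y^*)%C.

Fact complex_dot_scalar (y : cline) : scalar (complex_dot^~ y).
Proof. by move=> k u v; rewrite /complex_dot mulrDl -mulrA. Qed.

Fact complex_dot_conj (x y : cline) : complex_dot y x = (complex_dot x y)^*%C.
Proof. by rewrite /complex_dot rmorphM /= conjcK mulrC. Qed.

Fact complex_dot_norm (x : cline) : complex_dot x x = `|x| ^+ 2.
Proof.
by rewrite /complex_dot sqr_normc.
Qed.

HB.instance Definition _ := isHilbertSpace.Build R cline
  complex_dot_scalar complex_dot_conj complex_dot_norm.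

End ComplexLine.

Section OpEval.
Context {R : realType} {H : hilbertType R}.

Lemma op0E (x : H) : (0 : op H) x = 0. Proof. by []. Qed.
Lemma opDE (a b : op H) x : (a + b) x = a x + b x. Proof. by []. Qed.
Lemma opBE (a b : op H) x : (a - b) x = a x - b x. Proof. by []. Qed.
Lemma opZE k (a : op H) x : (k *: a) x = k *: a x. Proof. by []. Qed.
Lemma opME (a b : op H) x : (a * b) x = a (b x). Proof. by []. Qed.
Lemma op1E (x : H) : (1 : op H) x = x. Proof. by []. Qed.

Lemma op_sumE I (r : seq I) (P : pred I) (F : I -> op H) x :
  (\sum_(i <- r | P i) F i) x = \sum_(i <- r | P i) F i x.
Proof. by elim/big_rec2: _ => // i y a _ <-; rewrite opDE. Qed.

Lemma op_scalerAl (k : R[i]) (a b : op H) : k *: a * b = k *: (a * b).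
Proof. by apply: opP => x. Qed.

Lemma op_scalerAr (k : R[i]) (a b : op H) : a * (k *: b) = k *: (a * b).
Proof. by apply: opP => x; rewrite !(opME, opZE) linearZ. Qed.

Lemma opnormX (a : op H) n : opnorm (a ^+ n) <= opnorm a ^+ n.
Proof.
elim: n => [|n IH]; first by rewrite !expr0 opnorm1.
by rewrite !exprS (le_trans (opnormM _ _))// ler_wpM2l ?opnorm_ge0.
Qed.

Lemma opnorm_real_scale (t : R) (a : op H) : 0 <= t -> opnorm (t%:C *: a) <= t * opnorm a.
Proof. by move=> t0; apply: le_trans (opnormZ _ _) _; rewrite rnormRe ger0_norm. Qed.

Lemma isometric_opnorm1 (u v : op H) : adjoint u v -> v * u = 1 ->
  forall x, rnorm (u x) = rnorm x.
Proof.
move=> uv vu x; apply/eqP; rewrite -(eqrXn2 (n := 2)) ?rnorm_ge0//.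
by rewrite -!Re_dotxx uv -opME vu.
Qed.

End OpEval.

Lemma opnorm_approxM (R : realType) (V : hilbertType R) (a b a' b' : op V) (e M : R) :
  e <= 1 -> opnorm a <= M -> opnorm b <= M -> opnorm (a - a') <= e -> opnorm (b - b') <= e ->
  opnorm (a * b - a' * b') <= e * (2 * M + 1).
Proof.
move=> e1 aM bM aa bb.
have -> : a * b - a' * b' = (a - a') * b + a' * (b - b').
  by rewrite mulrBl mulrBr addrA subrK.
have a'M : opnorm a' <= M + 1.
  rewrite -(subrK a a') (le_trans (opnormD _ _))// opnormC; lra.
have e0 : 0 <= e by apply: le_trans aa; exact: opnorm_ge0.
rewrite (le_trans (opnormD _ _))//.
have h1 : opnorm ((a - a') * b) <= e * M.
  by rewrite (le_trans (opnormM _ _))// ler_pM ?opnorm_ge0.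
have h2 : opnorm (a' * (b - b')) <= (M + 1) * e.
  by rewrite (le_trans (opnormM _ _))// ler_pM ?opnorm_ge0.
lra.
Qed.

Lemma opnorm_approxP (R : realType) (V : hilbertType R) k (a b a' b' : op V) :
  opnorm (k *: a + b - (k *: a' + b')) <= rnorm k * opnorm (a - a') + opnorm (b - b').
Proof.
have -> : k *: a + b - (k *: a' + b') = k *: (a - a') + (b - b').
  by rewrite scalerBr opprD addrACA.
by rewrite (le_trans (opnormD _ _))// lerD2r opnormZ.
Qed.

Section BlockOp.
Context {R : realType} {H : hilbertType R} {n : nat}.
Local Notation C := R[i].
Implicit Types (a b : 'M[op H]_n) (x : hsum H n).

Definition blockop_fun a x : hsum H n := fun i => \sum_j a i j (x j).

Fact blockop_fun_linear a : linear (blockop_fun a).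
Proof.
move=> k x y; apply/funext => i; rewrite /blockop_fun.
rewrite -[RHS]/(k *: (\sum_j a i j (x j)) + \sum_j a i j (y j)).
by rewrite scaler_sumr -big_split; apply: eq_bigr => j _ /=; rewrite -linearP.
Qed.

Fact blockop_subproof a : blockop_fun a \in @is_op R (hsum H n).
Proof.
apply: (@is_op_bounded _ _ _ (\sum_i \sum_j opnorm (a i j))) => [|x].
  exact: blockop_fun_linear.
apply: le_trans (rnorm_hsum_le _) _; rewrite mulr_suml; apply: ler_sum => i _.
apply: le_trans (ler_rnorm_sum _) _; rewrite mulr_suml; apply: ler_sum => j _.
apply: le_trans (opnorm_ub _ _) _; rewrite ler_wpM2l ?opnorm_ge0//.
exact: rnorm_coord_le.
Qed.

Definition blockop a : op (hsum H n) := Op (blockop_subproof a).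

Lemma blockopE a x i : blockop a x i = \sum_j a i j (x j).
Proof. by []. Qed.

(** The norm of [hsum] unfolds to [l2norm], so both sides are the same supremum. Facts on operators,
    such as the C*-identity, thus apply to matrices. *)
Lemma opmxnormE a : opmxnorm a = opnorm (blockop a).
Proof.
by rewrite /opmxnorm /opnorm; congr sup.
Qed.

Lemma hsumP (x y : hsum H n) : (forall i, x i = y i) -> x = y.
Proof. by move=> xy; apply/funext. Qed.

Lemma blockopD a b : blockop (a + b) = blockop a + blockop b.
Proof.
apply: opP => x; apply: hsumP => i; rewrite blockopE opDE.
rewrite -[RHS]/(blockop a x i + blockop b x i) !blockopE -big_split.
by apply: eq_bigr => j _ /=; rewrite mxE.
Qed.

Lemma blockopZ (k : C) a : blockop (map_mx ( *:%R k) a) = k *: blockop a.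
Proof.
apply: opP => x; apply: hsumP => i; rewrite blockopE.
rewrite -[RHS]/(k *: blockop a x i) !blockopE scaler_sumr.
by apply: eq_bigr => j _ /=; rewrite mxE.
Qed.

Lemma blockopN a : blockop (- a) = - blockop a.
Proof.
apply: opP => x; apply: hsumP => i; rewrite blockopE.
rewrite -[RHS]/(- blockop a x i) !blockopE -sumrN.
by apply: eq_bigr => j _ /=; rewrite mxE.
Qed.

Lemma blockopB a b : blockop (a - b) = blockop a - blockop b.
Proof. by rewrite blockopD blockopN. Qed.

Lemma blockop1 : blockop 1%:M = 1.
Proof.
apply: opP => x; apply: hsumP => i; rewrite blockopE (bigD1 i)//= big1 => [|j ji].
  by rewrite mxE eqxx addr0.
by rewrite mxE eq_sym (negbTE ji).
Qed.

Lemma blockopM a b : blockop (a *m b) = blockop a * blockop b.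
Proof.
apply: opP => x; apply: hsumP => i; rewrite blockopE opME blockopE.
under eq_bigr do rewrite mxE op_sumE.
rewrite exchange_big /=; apply: eq_bigr => k _.
by rewrite -[RHS]/(a i k (\sum_j b k j (x j))) linear_sum.
Qed.

Lemma blockop_adjoint a b : (forall i j, adjoint (a i j) (b j i)) ->
  adjoint (blockop a) (blockop b).
Proof.
move=> ab x y; rewrite !dot_hsum.
under eq_bigr do rewrite blockopE dot_suml.
under [RHS]eq_bigr do rewrite blockopE dot_sumr.
rewrite exchange_big /=; apply: eq_bigr => j _; apply: eq_bigr => i _.
exact: ab.
Qed.

Lemma dot_blockop a (x y : hsum H n) :
  dot (blockop a x) y = \sum_i \sum_j dot (a i j (x j)) (y i).
Proof. by rewrite dot_hsum; apply: eq_bigr => i _; rewrite blockopE dot_suml. Qed.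

Lemma blockop_norm_le a : opnorm (blockop a) <= \sum_i \sum_j opnorm (a i j).
Proof.
apply: opnorm_le => [|x].
  by apply: sumr_ge0 => i _; apply: sumr_ge0 => j _; exact: opnorm_ge0.
apply: le_trans (rnorm_hsum_le _) _; rewrite mulr_suml; apply: ler_sum => i _.
apply: le_trans (ler_rnorm_sum _) _; rewrite mulr_suml; apply: ler_sum => j _.
apply: le_trans (opnorm_ub _ _) _; rewrite ler_wpM2l ?opnorm_ge0//.
exact: rnorm_coord_le.
Qed.

Definition hsum_inj (k : 'I_n) (x : H) : hsum H n := fun i => if i == k then x else 0.

Lemma rnorm_hsum_inj k (x : H) : rnorm (hsum_inj k x) = rnorm x.
Proof.
apply/eqP; rewrite -(eqrXn2 (n := 2)) ?rnorm_ge0// sqr_rnorm_hsum.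
rewrite (bigD1 k)//= big1 => [|i ik]; rewrite /hsum_inj ?eqxx ?addr0//.
by rewrite (negbTE ik) rnorm0 expr0n.
Qed.

Lemma blockop_hsum_inj a k (x : H) i : blockop a (hsum_inj k x) i = a i k x.
Proof.
rewrite blockopE (bigD1 k)//= big1 => [|j jk]; rewrite /hsum_inj ?eqxx ?addr0//.
by rewrite (negbTE jk) linear0.
Qed.

Lemma entry_norm_le a i j : opnorm (a i j) <= opnorm (blockop a).
Proof.
apply: opnorm_le => [|x]; first exact: opnorm_ge0.
rewrite -(rnorm_hsum_inj j x) -blockop_hsum_inj.
exact: le_trans (rnorm_coord_le _ _) (opnorm_ub _ _).
Qed.

End BlockOp.

Section MatrixOp.
Context {R : realType} {m : nat}.
Local Notation C := R[i].
Implicit Types A B : 'M[C]_m.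
Local Notation Cm := (hsum (cline R) m).

Fact mxop_subproof A : (mxact A : Cm -> Cm) \in @is_op R Cm.
Proof.
apply: (@is_op_bounded _ _ _ (spectral_norm A)) => [k x y|x].
  apply/funext => i; rewrite -[RHS]/(k * mxact A x i + mxact A y i) /mxact.
  rewrite mulr_sumr -big_split; apply: eq_bigr => j _ /=.
  rewrite -[(k *: x + y) j]/(k * x j + y j) mulrDr; congr (_ + _).
  by rewrite mulrCA.
by rewrite !rnorm_hsum; exact: spectral_norm_ub.
Qed.

Definition mxop A : op Cm := Op (mxop_subproof A).

Lemma mxopE A (x : Cm) i : mxop A x i = \sum_j A i j * x j.
Proof. by []. Qed.

Lemma spectral_normE A : spectral_norm A = opnorm (mxop A).
Proof.
by rewrite /spectral_norm /opnorm; congr sup.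
Qed.

Lemma mxopD A B : mxop (A + B) = mxop A + mxop B.
Proof.
apply: opP => x; apply: hsumP => i; rewrite mxopE.
rewrite -[RHS]/(mxop A x i + mxop B x i) !mxopE -big_split.
by apply: eq_bigr => j _ /=; rewrite mxE mulrDl.
Qed.

Lemma mxopZ k A : mxop (k *: A) = k *: mxop A.
Proof.
apply: opP => x; apply: hsumP => i; rewrite mxopE.
rewrite -[RHS]/(k * mxop A x i) !mxopE mulr_sumr.
by apply: eq_bigr => j _ /=; rewrite mxE mulrA.
Qed.

Lemma mxopN A : mxop (- A) = - mxop A.
Proof. by rewrite -scaleN1r mxopZ scaleN1r. Qed.

Lemma mxopB A B : mxop (A - B) = mxop A - mxop B.
Proof. by rewrite mxopD mxopN. Qed.

Lemma mxop0 : mxop 0 = 0.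
Proof. by rewrite -(subrr 0) mxopB subrr. Qed.

Lemma mxop1 : mxop 1%:M = 1.
Proof.
apply: opP => x; apply: hsumP => i; rewrite mxopE (bigD1 i)//= big1 => [|j ji].
  by rewrite mxE eqxx mul1r addr0.
by rewrite mxE eq_sym (negbTE ji) mul0r.
Qed.

Lemma mxopM A B : mxop (A *m B) = mxop A * mxop B.
Proof.
apply: opP => x; apply: hsumP => i; rewrite mxopE opME mxopE.
under eq_bigr do rewrite mxE mulr_suml.
rewrite exchange_big /=; apply: eq_bigr => k _.
rewrite -[RHS]/(A i k * (\sum_j B k j * x j)) mulr_sumr.
by apply: eq_bigr => j _; rewrite mulrA.
Qed.

Lemma mxop_adjoint A B : (forall i j, B j i = (A i j)^*%C) -> adjoint (mxop A) (mxop B).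
Proof.
move=> AB x y; rewrite !dot_hsum.
transitivity (\sum_i \sum_j A i j * x j * (y i)^*%C).
  by apply: eq_bigr => i _; rewrite mxopE -mulr_suml.
rewrite exchange_big /=; apply: eq_bigr => j _.
rewrite -[RHS]/(x j * (mxop B y j)^*%C) mxopE rmorph_sum mulr_sumr /=.
apply: eq_bigr => i _; rewrite rmorphM AB /= conjcK.
by rewrite mulrA [A i j * _]mulrC.
Qed.

End MatrixOp.

(** * Graphs of contractive *-homomorphisms *)

Lemma exp_small (R : realType) (x e : R) : 0 <= x -> x < 1 -> 0 < e ->
  exists N, forall n, (N <= n)%N -> x ^+ n <= e.
Proof.
move=> x0 x1 e0; have : `|x| < 1 by rewrite ger0_norm.
move=> /cvg_expr/cvgrPdist_le/(_ e e0)[N _ xN]; exists N => n Nn.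
by have := xN n Nn; rewrite sub0r normrN ger0_norm// exprn_ge0.
Qed.

(** If y < x then (y/x)^(2^m) tends to 0, whereas c (y/x)^(2^m) >= 1 for every m. *)
Lemma power_trick (R : realType) (x y c : R) : 0 <= x -> 0 <= y ->
  (forall m, x ^+ (2 ^ m) <= c * y ^+ (2 ^ m)) -> x <= y.
Proof.
move=> x0 y0 h; rewrite leNgt; apply/negP => yx.
have xp : 0 < x by apply: le_lt_trans yx.
have c0 : 0 <= c.
  rewrite leNgt; apply/negP => c0; have := h 0%N; rewrite expn0 !expr1; nra.
have yx0 : 0 <= y / x by rewrite divr_ge0.
have yx1 : y / x < 1 by rewrite ltr_pdivrMr// mul1r.
have c1 : 0 < (c + 1)^-1 by rewrite invr_gt0; lra.
have [N hN] := exp_small yx0 yx1 c1.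
have := hN (2 ^ N)%N (ltnW (ltn_expl _ (ltnSn 1))).
rewrite expr_div_n ler_pdivrMr ?exprn_gt0// mulrC ler_pdivlMr; last by lra.
have := h N; have := exprn_gt0 (2 ^ N) xp; have := exprn_ge0 (2 ^ N) y0; nra.
Qed.

Section StarRelation.
Context {R : realType} {K H : hilbertType R}.
Local Notation C := R[i].
Implicit Types (G : op K -> op H -> Prop).

(* The graph of a *-homomorphism between unital *-algebras of operators, before
   it is known to be single-valued. *)
Record star_rel G : Prop := StarRel {
  star_rel1 : G 1 1;
  star_relP : forall (k : C) a b a' b', G a b -> G a' b' ->
    G (k *: a + a') (k *: b + b');
  star_relM : forall a b a' b', G a b -> G a' b' -> G (a * a') (b * b');
  star_rel_adj : forall a b a' b', G a b -> adjoint a a' -> adjoint b b' -> G a' b'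
}.

Definition contractive G : Prop := forall a b, G a b -> opnorm b <= opnorm a.

Section Facts.
Context {G} (sG : star_rel G).

Lemma star_rel0 : G 0 0.
Proof.
by have := star_relP sG (-1) (star_rel1 sG) (star_rel1 sG); rewrite !scaleN1r !addNr.
Qed.

Lemma star_relZ k a b : G a b -> G (k *: a) (k *: b).
Proof. by move=> /(star_relP sG k) /(_ star_rel0); rewrite !addr0. Qed.

Lemma star_relD a b a' b' : G a b -> G a' b' -> G (a + a') (b + b').
Proof. by move=> ab ab'; have := star_relP sG 1 ab ab'; rewrite !scale1r. Qed.

Lemma star_relB a b a' b' : G a b -> G a' b' -> G (a - a') (b - b').
Proof.
by move=> ab ab'; have := star_relP sG (-1) ab' ab; rewrite !scaleN1r ![- _ + _]addrC.
Qed.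

Lemma star_rel_sum I (r : seq I) (P : pred I) (f : I -> op K) (g : I -> op H) :
  (forall i, P i -> G (f i) (g i)) ->
  G (\sum_(i <- r | P i) f i) (\sum_(i <- r | P i) g i).
Proof.
move=> fg; elim/big_ind2: _ => //; first exact: star_rel0.
by move=> *; exact: star_relD.
Qed.

Lemma star_relX a b n : G a b -> G (a ^+ n) (b ^+ n).
Proof.
move=> ab; elim: n => [|n IH]; first by rewrite !expr0; exact: star_rel1.
by rewrite !exprS; exact: (star_relM sG).
Qed.

Lemma star_rel_mxX n (a : 'M[op K]_n) (b : 'M[op H]_n) k :
  (forall i j, G (a i j) (b i j)) -> forall i j, G ((a ^+ k) i j) ((b ^+ k) i j).
Proof.
move=> ab; elim: k => [|k IH] i j.
  rewrite !expr0 !mxE; case: (i == j); first exact: star_rel1.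
  exact: star_rel0.
rewrite !exprS !mxE; apply: star_rel_sum => l _.
exact: (star_relM sG).
Qed.

End Facts.

Lemma blockopX (V : hilbertType R) n (a : 'M[op V]_n) k :
  blockop (a ^+ k) = blockop a ^+ k.
Proof.
elim: k => [|k IH]; first by rewrite !expr0 blockop1.
by rewrite !exprS blockopM IH.
Qed.

Lemma selfadjoint_norm_pow2 (V : hilbertType R) (a : op V) m :
  adjoint a a -> opnorm (a ^+ (2 ^ m)) = opnorm a ^+ (2 ^ m).
Proof.
move=> aa; have aX k : adjoint (a ^+ k) (a ^+ k).
  by elim: k => [//|k IH]; rewrite {1}exprSr exprS; exact: adjointM.
elim: m => [|m IH]; first by rewrite expn0 !expr1.
by rewrite expnS mul2n -addnn !exprD (cstar_identity (aX _)) IH expr2.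
Qed.

(* A contractive *-homomorphism is completely contractive: matrix and entry norms
   differ by a bounded factor, which disappears after taking 2^m-th roots of the
   norms of the powers of a^* a. *)
Lemma star_rel_cc G n (a : 'M[op K]_n) (b : 'M[op H]_n) :
  star_rel G -> contractive G -> (forall i j, G (a i j) (b i j)) ->
  opnorm (blockop b) <= opnorm (blockop a).
Proof.
move=> sG cG ab.
have adjm (V : hilbertType R) (c : 'M[op V]_n) :
    exists c' : 'M[op V]_n, forall i j, adjoint (c i j) (c' j i).
  have /choice[f fP] : forall ij : 'I_n * 'I_n, exists c', adjoint (c ij.1 ij.2) c'.
    by move=> ij; exact: adjoint_exists.
  by exists (\matrix_(j, i) f (i, j)) => i j; rewrite mxE; exact: fP (i, j).
have [[a' aa'] [b' bb']] := (adjm _ a, adjm _ b).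
have ab' i j : G (a' i j) (b' i j) by exact: star_rel_adj (ab j i) (aa' j i) (bb' j i).
have adA := blockop_adjoint aa'; have adB := blockop_adjoint bb'.
pose c := a' *m a; pose d := b' *m b.
have cd i j : G (c i j) (d i j).
  by rewrite !mxE; apply: star_rel_sum => // k _; exact: (star_relM sG).
suff : opnorm (blockop d) <= opnorm (blockop c).
  rewrite !blockopM !cstar_identity//.
  by rewrite ler_pXn2r ?nnegrE ?opnorm_ge0.
(* The constant is n^2, kept as a double sum to be compared with [blockop_norm_le] entry by
   entry. *)
apply: (@power_trick _ _ _ (\sum_(i < n) \sum_(j < n) 1)) => [||m].
- exact: opnorm_ge0.
- exact: opnorm_ge0.
have dd : adjoint (blockop d) (blockop d).
  by rewrite blockopM; apply: adjointM => //; exact: adjoint_sym.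
rewrite -selfadjoint_norm_pow2// -blockopX; apply: le_trans (blockop_norm_le _) _.
rewrite mulr_suml; apply: ler_sum => i _; rewrite mulr_suml; apply: ler_sum => j _.
rewrite mul1r; apply: le_trans (cG _ _ (star_rel_mxX sG _ cd i j)) _.
apply: le_trans (entry_norm_le _ _ _) _.
by rewrite blockopX opnormX.
Qed.

Section Damping.
Context {V : hilbertType R} {c c' : op V} (cc : adjoint c c').
(** With the factor 1/2 the cross term of |h y|^2 is exactly |c y|^2, so that [h] dominates both the
    identity and [c]. *)
Let h : op V := 1 + (2^-1)%:C *: (c' * c).

Lemma sqr_rnorm_damp y :
  rnorm (h y) ^+ 2 = rnorm y ^+ 2 + rnorm (c y) ^+ 2 + 4^-1 * rnorm (c' (c y)) ^+ 2.
Proof.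
rewrite opDE opZE opME op1E sqr_rnormD rnormZ dotZr conjc_real Re_realM.
rewrite -cc Re_dotxx rnormRe exprMn real_normK ?num_real//; by field.
Qed.

Lemma ler_rnorm_damp y : rnorm y <= rnorm (h y).
Proof.
rewrite -(ler_pXn2r (n := 2)) ?nnegrE ?rnorm_ge0// sqr_rnorm_damp.
have := sqr_ge0 (rnorm (c y)); have := sqr_ge0 (rnorm (c' (c y))); lra.
Qed.

Lemma ler_rnorm_damp_op y : rnorm (c y) <= rnorm (h y).
Proof.
rewrite -(ler_pXn2r (n := 2)) ?nnegrE ?rnorm_ge0// sqr_rnorm_damp.
have := sqr_ge0 (rnorm y); have := sqr_ge0 (rnorm (c' (c y))); lra.
Qed.

Lemma Re_dot_damp y : rnorm y ^+ 2 <= complex.Re (dot (h y) y).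
Proof.
rewrite opDE opZE opME op1E dotDl dotZl raddfD /= Re_realM Re_dotxx.
rewrite Re_dotC -cc Re_dotxx.
have := sqr_ge0 (rnorm (c y)); lra.
Qed.

(** As Re h >= 1, |y - t h y|^2 <= (1 - 2 t + t^2 M^2) |y|^2; t = M^-2 is the minimiser and leaves
    the factor 1 - t. *)
Lemma neumann_norm M : 1 <= M -> opnorm h <= M ->
  opnorm (1 - (M ^- 2)%:C *: h) <= Num.sqrt (1 - M ^- 2).
Proof.
move=> M1 hM; have M0 : 0 < M by lra.
have t1 : M ^- 2 <= 1 by rewrite invf_le1 ?exprn_gt0// exprn_ege1.
apply: opnorm_le => [|y]; first exact: sqrtr_ge0.
rewrite -(ler_pXn2r (n := 2)) ?nnegrE ?mulr_ge0 ?rnorm_ge0 ?sqrtr_ge0//.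
rewrite exprMn sqr_sqrtr ?subr_ge0//.
rewrite opBE opZE op1E sqr_rnormB rnormZ dotZr conjc_real Re_realM Re_dotC.
rewrite rnormRe exprMn real_normK ?num_real//.
have t0 : 0 < M ^- 2 by rewrite invr_gt0 exprn_gt0.
have h1 := Re_dot_damp y.
have h2 : rnorm (h y) ^+ 2 <= M ^+ 2 * rnorm y ^+ 2.
  rewrite -exprMn ler_pXn2r ?nnegrE ?mulr_ge0 ?rnorm_ge0 ?(ltW M0)//.
  by apply: le_trans (opnorm_ub _ _) _; rewrite ler_wpM2r ?rnorm_ge0.
have h3 : M ^- 2 ^+ 2 * rnorm (h y) ^+ 2 <= M ^- 2 * rnorm y ^+ 2.
  rewrite expr2 -mulrA ler_pM2l// mulrC ler_pdivrMr ?exprn_gt0//.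
  by rewrite [leRHS]mulrC.
have h4 : M ^- 2 * rnorm y ^+ 2 <= M ^- 2 * complex.Re (dot (h y) y).
  by rewrite ler_pM2l.
lra.
Qed.

End Damping.

(* a is replaced by a (1 + a^* a / 2)^-1, whose norm is at most 1; the inverse is
   truncated in its Neumann series. *)
Lemma star_rel_lift1 G a b : star_rel G -> contractive G -> G a b -> opnorm b <= 1 ->
  exists a' b', [/\ G a' b', opnorm a' <= 2 & opnorm (b - b') <= 3 / 4].
Proof.
move=> sG cG Gab b1.
have [[a' aa'] [b' bb']] := (adjoint_exists a, adjoint_exists b).
pose h (V : hilbertType R) (c c' : op V) : op V := 1 + (2^-1)%:C *: (c' * c).
have Ghh : G (h _ a a') (h _ b b').
  apply: star_relD => //; first exact: star_rel1.
  apply: star_relZ => //; apply: (star_relM sG) => //.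
  exact: star_rel_adj Gab aa' bb'.
(* One bound serves both sides: the relation is contractive, so it also bounds [h] built on b, and
   the same polynomial inverts both approximately. *)
pose M := 1 + opnorm (h _ a a').
have M1 : 1 <= M by rewrite lerDl opnorm_ge0.
have M0 : 0 < M by lra.
have haM : opnorm (h _ a a') <= M by rewrite lerDr.
have hbM : opnorm (h _ b b') <= M by apply: le_trans (cG _ _ Ghh) haM.
pose k := Num.sqrt (1 - M ^- 2).
have t0 : 0 < M ^- 2 by rewrite invr_gt0 exprn_gt0.
have t1 : M ^- 2 <= 1 by rewrite invf_le1 ?exprn_gt0// exprn_ege1.
have k0 : 0 <= k by exact: sqrtr_ge0.
have k1 : k < 1.
  by rewrite -(ltr_pXn2r (n := 2)) ?nnegrE// sqr_sqrtr ?subr_ge0// expr1n; lra.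
(* A remainder of 1/6 gives |h r| <= 7/6 < 2 and, below, an error of (1/2)(7/6) + 1/6 = 3/4. *)
have [|N /(_ N (leqnn N)) kN] := exp_small k0 k1 (e := 6^-1); first by rewrite invr_gt0.
pose x (V : hilbertType R) (c c' : op V) : op V := 1 - (M ^- 2)%:C *: h V c c'.
pose r (V : hilbertType R) (c c' : op V) : op V :=
  (M ^- 2)%:C *: \sum_(i < N) x V c c' ^+ i.
have hr V c c' : h V c c' * r V c c' = 1 - x V c c' ^+ N.
  rewrite op_scalerAr -op_scalerAl -opprB subrX1 -mulNr.
  by congr (_ * _); rewrite /x !opprB addrC subrK.
have xN V c c' : adjoint c c' -> opnorm (h V c c') <= M ->
    opnorm (x V c c' ^+ N) <= 6^-1.
  move=> cc hM; apply: le_trans (opnormX _ _) _; apply: le_trans kN.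
  by rewrite lerXn2r ?nnegrE ?opnorm_ge0//; exact: neumann_norm.
have hrN V c c' : adjoint c c' -> opnorm (h V c c') <= M ->
    opnorm (h V c c' * r V c c') <= 7 / 6.
  move=> cc hM; rewrite hr; apply: le_trans (opnormD _ _) _; rewrite opnormN.
  have := xN _ _ _ cc hM; have := @opnorm1 R V; lra.
exists (a * r _ a a'), (b * r _ b b'); split.
- apply: (star_relM sG) => //; apply: star_relZ => //; apply: star_rel_sum => // i _.
  apply: star_relX => //; apply: star_relB => //; first exact: star_rel1.
  exact: star_relZ.
- apply: opnorm_le => // y; rewrite opME.
  apply: le_trans (ler_rnorm_damp_op aa' _) _; rewrite -[X in rnorm X]opME.
  apply: le_trans (opnorm_ub _ _) _; rewrite ler_wpM2r ?rnorm_ge0//.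
  have := hrN _ _ _ aa' haM; rewrite /h /r; lra.
- have rb : opnorm (r _ b b') <= 7 / 6.
    apply: opnorm_le => [|y]; first lra.
    apply: le_trans (ler_rnorm_damp bb' _) _; rewrite -[X in rnorm X]opME.
    apply: le_trans (opnorm_ub _ _) _; rewrite ler_wpM2r ?rnorm_ge0//.
    exact: hrN.
  (* From h r = 1 - x^N and h = 1 + b^* b / 2 one gets 1 - r = b^* b r / 2 + x^N. *)
  have -> : b - b * r _ b b' =
      b * ((2^-1)%:C *: (b' * b * r _ b b') + x _ b b' ^+ N).
    rewrite -[X in X - _ = _]mulr1 -mulrBr; congr (_ * _).
    have /eqP := hr _ b b'; rewrite eq_sym subr_eq => /eqP ->.
    by rewrite /h mulrDl mul1r op_scalerAl addrAC [X in X - _]addrC addrK.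
  apply: le_trans (opnormM _ _) _.
  apply: (@le_trans _ _ (opnorm ((2^-1)%:C *: (b' * b * r _ b b') + x _ b b' ^+ N))).
    by rewrite ler_piMl ?opnorm_ge0.
  apply: le_trans (opnormD _ _) _.
  have h1 := xN _ _ _ bb' hbM.
  have h2 : opnorm ((2^-1)%:C *: (b' * b * r _ b b')) <= 2^-1 * (7 / 6).
    apply: le_trans (opnorm_real_scale _ _) _; first by rewrite invr_ge0.
    rewrite ler_wpM2l ?invr_ge0// (le_trans (opnormM _ _))//.
    rewrite (cstar_identity bb') (le_trans _ rb)// ler_piMl ?opnorm_ge0//.
    by rewrite expr_le1 ?opnorm_ge0.
  lra.
Qed.

End StarRelation.

(** * Closed graphs: closed domain and closed range *)

Section Closure.
Context {R : realType} {K H : hilbertType R} (G : op K -> op H -> Prop).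
Hypotheses (sG : star_rel G) (cG : contractive G).
Local Notation C := R[i].

Definition closure_rel (a : op K) (b : op H) : Prop := forall e : R, 0 < e ->
  exists a' b', [/\ G a' b', opnorm (a - a') <= e & opnorm (b - b') <= e].

Lemma closure_rel_sub a b : G a b -> closure_rel a b.
Proof. by move=> ab e e0; exists a, b; rewrite !subrr !opnorm0 ltW. Qed.

Lemma contractive_closure : contractive closure_rel.
Proof.
move=> a b ab; apply/ler_addgt0Pr => e e0.
have [a' [b' [ab' aa bb]]] := ab _ (divr_gt0 e0 (ltr0n R 2)).
rewrite -(subrK b' b) (le_trans (opnormD _ _))//.
have := cG ab'; have := opnormD (a' - a) a; rewrite subrK opnormC; lra.
Qed.

Lemma star_rel_closure : star_rel closure_rel.
Proof.
split.
- by apply: closure_rel_sub; exact: (star_rel1 sG).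
- move=> k a b a' b' ab ab' e e0.
  have k0 : 0 < rnorm k + 1 by rewrite ltr_wpDl ?rnorm_ge0.
  have [x [y [xy ax by_]]] := ab _ (divr_gt0 (divr_gt0 e0 (ltr0n R 2)) k0).
  have [x' [y' [xy' ax' by']]] := ab' _ (divr_gt0 e0 (ltr0n R 2)).
  exists (k *: x + x'), (k *: y + y'); split; first exact: (star_relP sG).
  + apply: le_trans (opnorm_approxP _ _ _ _ _) _.
    move: ax; rewrite ler_pdivlMr// => ax.
    have := opnorm_ge0 (a - x); have := rnorm_ge0 k; lra.
  + apply: le_trans (opnorm_approxP _ _ _ _ _) _.
    move: by_; rewrite ler_pdivlMr// => by_.
    have := opnorm_ge0 (b - y); have := rnorm_ge0 k; lra.
- move=> a b a' b' ab ab' e e0.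
  pose M := opnorm a + opnorm b + opnorm a' + opnorm b'.
  have Ma : [/\ opnorm a <= M, opnorm b <= M, opnorm a' <= M & opnorm b' <= M].
    have := (opnorm_ge0 a, opnorm_ge0 b, opnorm_ge0 a', opnorm_ge0 b').
    by move=> [[[? ?] ?] ?]; rewrite /M; split; lra.
  have M0 : 0 <= M by case: Ma => + _ _ _; apply: le_trans; exact: opnorm_ge0.
  pose d := Num.min 1 (e / (2 * M + 1)).
  have d0 : 0 < d by rewrite lt_min ltr01 divr_gt0//; lra.
  have d1 : d <= 1 by rewrite ge_min lexx.
  have de : d * (2 * M + 1) <= e.
    by rewrite -ler_pdivlMr; [rewrite ge_min lexx orbT|lra].
  have [x [y [xy ax by_]]] := ab _ d0.
  have [x' [y' [xy' ax' by']]] := ab' _ d0.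
  case: Ma => aM bM a'M b'M.
  exists (x * x'), (y * y'); split; first exact: (star_relM sG).
  + exact: le_trans (opnorm_approxM d1 aM a'M ax ax') de.
  + exact: le_trans (opnorm_approxM d1 bM b'M by_ by') de.
- move=> a b a' b' ab aa bb e e0.
  have [x [y [xy ax by_]]] := ab _ e0.
  have [[x' xx] [y' yy]] := (adjoint_exists x, adjoint_exists y).
  exists x', y'; split; first exact: (star_rel_adj sG xy xx yy).
  + by rewrite (adjoint_norm (adjointB aa xx)).
  + by rewrite (adjoint_norm (adjointB bb yy)).
Qed.

Lemma closure_rel_fun a b b' : closure_rel a b -> closure_rel a b' -> b = b'.
Proof.
move=> ab ab'; apply/eqP; rewrite -subr_eq0; apply/eqP; apply: opnorm_eq0; apply/le_anti.
rewrite opnorm_ge0 andbT; have := contractive_closure (star_relB star_rel_closure ab ab').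
by rewrite subrr opnorm0.
Qed.

(** By contractivity the images of approximations of a are Cauchy. *)
Lemma closure_rel_dom a :
  (forall e : R, 0 < e -> exists a' b', G a' b' /\ opnorm (a - a') <= e) ->
  exists b, closure_rel a b.
Proof.
move=> happr.
pose S e b' := exists2 a', G a' b' & opnorm (a - a') <= e.
have [||b Sb] := @op_limit R H S.
- by move=> e /happr[a' [b' [ab' aa]]]; exists b', a'.
- move=> e d b1 b2 e0 d0 [a1 ab1 aa1] [a2 ab2 aa2].
  apply: le_trans (cG (star_relB sG ab1 ab2)) _.
  by apply: le_trans (opnorm_triangle a _ _) _; rewrite opnormC lerD.
exists b => e e0; have [a' [b' [ab' aa]]] := happr _ e0.
by exists a', b'; split => //; rewrite opnormC; apply: Sb => //; exists a'.
Qed.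

Let near_range (b : op H) := forall e : R, 0 < e ->
  exists a' b', G a' b' /\ opnorm (b - b') <= e.

Let near_range_lift b g : 0 < g -> near_range b -> opnorm b <= g ->
  exists p : op K * op H, [/\ G p.1 p.2, opnorm p.1 <= 4 * g & opnorm (b - p.2) <= 7 / 8 * g].
Proof.
move=> g0 bG bg.
have [a0 [b0 [ab0 bb0]]] := bG _ (divr_gt0 g0 (ltr0n R 16)).
(* b0 is within g/16 of b, so |b0| <= 17/16 g. The rescaled lift has norm at most 2 (17/16) g <= 4 g
   and the error is at most g/16 + (3/4)(17/16) g = 55/64 g <= 7/8 g. *)
pose g' := 17 / 16 * g; have g'0 : 0 < g' by rewrite /g'; lra.
have b0g : opnorm b0 <= g'.
  rewrite -(subrK b b0) (le_trans (opnormD _ _))// opnormC /g'; lra.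
have b0g1 : opnorm ((g'^-1)%:C *: b0) <= 1.
  rewrite (le_trans (opnorm_real_scale _ _))//; first by rewrite invr_ge0 ltW.
  by rewrite mulrC ler_pdivrMr// mul1r.
have [a1 [b1 [ab1 a12 b01]]] :=
  star_rel_lift1 sG cG (star_relZ sG (g'^-1)%:C ab0) b0g1.
exists (g'%:C *: a1, g'%:C *: b1); split => /=.
- exact: star_relZ.
- apply: le_trans (opnorm_real_scale _ (ltW g'0)) _; rewrite /g'.
  have := opnorm_ge0 a1; nra.
- apply: le_trans (opnorm_triangle b0 _ _) _.
  have -> : b0 - g'%:C *: b1 = g'%:C *: ((g'^-1)%:C *: b0 - b1).
    by rewrite scalerBr scalerA -realCM divff ?gt_eqF// scale1r.
  have := opnorm_real_scale ((g'^-1)%:C *: b0 - b1) (ltW g'0).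
  have : g' * opnorm ((g'^-1)%:C *: b0 - b1) <= g' * (3 / 4) by rewrite ler_pM2l.
  rewrite /g'; lra.
Qed.

(* Open mapping argument: the approximate liftings are summed. *)
Lemma closure_rel_ran b : near_range b -> exists a, closure_rel a b.
Proof.
move=> bG.
(* The side conditions are moved inside the choice, with (0, 0) as default, so that the recursion
   below can use a total function. *)
have /choice[f fP] : forall x : R * op H, exists p : op K * op H,
    0 < x.1 -> near_range x.2 -> opnorm x.2 <= x.1 ->
    [/\ G p.1 p.2, opnorm p.1 <= 4 * x.1 & opnorm (x.2 - p.2) <= 7 / 8 * x.1].
  move=> [g c] /=; have [[g0 cr cg]|nh] := pselect [/\ 0 < g, near_range c & opnorm c <= g].
    by have [p pP] := near_range_lift g0 cr cg; exists p.
  by exists (0, 0) => g0 cr cg; case: nh.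
pose g0 := opnorm b + 1; have g00 : 0 < g0 by rewrite ltr_wpDl ?opnorm_ge0.
pose g n := g0 * (7 / 8) ^+ n.
have gS n : g n.+1 = 7 / 8 * g n by rewrite /g exprS mulrCA.
have gp n : 0 < g n by rewrite mulr_gt0// exprn_gt0//; lra.
pose s := fix s n : op K * op H := if n is m.+1 then
  let p := f (g m, b - (s m).2) in ((s m).1 + p.1, (s m).2 + p.2) else (0, 0).
have sP n : G (s n).1 (s n).2 /\ opnorm (b - (s n).2) <= g n.
  elim: n => [|n [IH1 IH2]] /=.
    split; first exact: star_rel0.
    by rewrite subr0 /g expr0 mulr1 lerDl.
  have [||p1 p2 p3] := fP (g n, b - (s n).2) (gp n) => //=.
    move=> e /bG[a' [b' [ab' bb']]]; exists (a' - (s n).1), (b' - (s n).2).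
    split; first exact: star_relB.
    by rewrite opprB addrA subrK.
  split; first exact: star_relD.
  by rewrite opprD addrA gS.
(* The bound is 4 g_n; since g_{n+1} = 7/8 g_n it equals 32 (g_n - g_{n+1}), a form that
   telescopes. *)
have sstep n : opnorm ((s n.+1).1 - (s n).1) <= 32 * (g n - g n.+1).
  rewrite /= addrC addKr gS; have [_ sn] := sP n.
  have [||p1 p2 p3] := fP (g n, b - (s n).2) (gp n) => //=.
    move=> e /bG[a' [b' [ab' bb']]]; exists (a' - (s n).1), (b' - (s n).2).
    split; first by apply: star_relB => //; exact: (sP n).1.
    by rewrite opprB addrA subrK.
  by move: p2 => /=; lra.
have sdist n k : opnorm ((s (n + k)%N).1 - (s n).1) <= 32 * (g n - g (n + k)%N).
  elim: k => [|k IH]; first by rewrite addn0 !subrr opnorm0 mulr0.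
  rewrite addnS; apply: le_trans (opnorm_triangle (s (n + k)%N).1 _ _) _.
  have := sstep (n + k)%N; lra.
have small (e : R) : 0 < e -> exists n, 32 * g n <= e.
  move=> e0; have e1 : 0 < e / 32 / g0 by rewrite !divr_gt0.
  have [||n /(_ n (leqnn n))] := exp_small (x := 7 / 8) _ _ e1; try lra.
  by rewrite ler_pdivlMr// => h; exists n; rewrite /g; lra.
have sdist' m n : opnorm ((s m).1 - (s n).1) <= 32 * g m + 32 * g n.
  wlog nm : m n / (n <= m)%N.
    move=> h; have [nm|/ltnW mn] := leqP n m; first exact: h.
    by rewrite opnormC [leRHS]addrC; exact: h.
  rewrite -(subnKC nm); have := sdist n (m - n)%N; have := gp (n + (m - n))%N; lra.
pose S e a' := exists2 n, a' = (s n).1 & 32 * g n <= e.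
have [||a aS] := @op_limit R K S.
- by move=> e /small[n ge]; exists (s n).1, n.
- move=> e d a1 a2 _ _ [n -> ne] [m -> me].
  by apply: le_trans (sdist' n m) _; exact: lerD.
exists a => e e0; have [n ne] := small _ e0.
exists (s n).1, (s n).2; split; first exact: (sP n).1.
  by rewrite opnormC; apply: aS => //; exists n.
apply: le_trans (sP n).2 _; have := gp n; lra.
Qed.

End Closure.

(** * Transfer of numerical ranges *)

Section Words.
Context {R : realType} {H : hilbertType R} {L : eqType} (e : L -> op H).
Local Notation C := R[i].

Definition word_op (w : seq L) : op H := \prod_(l <- w) e l.

Definition poly_op (p : seq (C * seq L)) : op H := \sum_(t <- p) t.1 *: word_op t.2.

Lemma word_op_nil : word_op [::] = 1. Proof. exact: big_nil. Qed.

Lemma word_op_cons l w : word_op (l :: w) = e l * word_op w.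
Proof. exact: big_cons. Qed.

Lemma poly_opE p x : poly_op p x = \sum_(t <- p) t.1 *: word_op t.2 x.
Proof. by rewrite op_sumE. Qed.

End Words.

(** Letters of *-polynomials: [(k, true)] is the k-th generator and [(k, false)] its adjoint, so
    [flip] is the adjoint on letters. *)
Definition flip d (l : 'I_d * bool) : 'I_d * bool := (l.1, ~~ l.2).

Section NumericalRange.
Context {R : realType}.

(** Re (a - c) <= 0 gives |1 + t (a - c)|^2 <= 1 + t^2 m^2. The same bound then holds for b;
    expanded at x and divided by t, it leaves 2 Re <(b - c) x, x> <= O(t). *)
Lemma numerical_range_transfer (K H : hilbertType R) (a : op K) (b : op H) (c : R) :
  (forall t : R, 0 < t ->
    opnorm (1 + t%:C *: (b - c%:C *: (1 : op H))) <= opnorm (1 + t%:C *: (a - c%:C *: (1 : op K)))) ->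
  (forall y, complex.Re (dot (a y) y) <= c * rnorm y ^+ 2) ->
  forall x, complex.Re (dot (b x) x) <= c * rnorm x ^+ 2.
Proof.
move=> ab ac x; set m := opnorm (a - c%:C *: (1 : op K)).
have shift (V : hilbertType R) (s : op V) (y : V) :
    complex.Re (dot ((s - c%:C *: (1 : op V)) y) y) = complex.Re (dot (s y) y) - c * rnorm y ^+ 2.
  by rewrite opBE opZE op1E dotBl dotZl raddfB /= Re_realM Re_dotxx.
have expand (V : hilbertType R) (s : op V) (t : R) (y : V) :
    rnorm ((1 + t%:C *: s) y) ^+ 2 =
    rnorm y ^+ 2 + 2 * (t * complex.Re (dot (s y) y)) + t ^+ 2 * rnorm (s y) ^+ 2.
  rewrite opDE opZE op1E sqr_rnormD rnormZ dotZr conjc_real Re_realM Re_dotC.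
  by rewrite rnormRe exprMn real_normK ?num_real.
have a_le t : 0 < t -> opnorm (1 + t%:C *: (a - c%:C *: (1 : op K))) <= Num.sqrt (1 + t ^+ 2 * m ^+ 2).
  move=> t0; apply: opnorm_le => [|y]; first exact: sqrtr_ge0.
  have p0 : 0 <= 1 + t ^+ 2 * m ^+ 2 by rewrite addr_ge0// mulr_ge0// sqr_ge0.
  rewrite -(ler_pXn2r (n := 2)) ?nnegrE ?mulr_ge0 ?rnorm_ge0 ?sqrtr_ge0//.
  rewrite exprMn sqr_sqrtr// expand shift.
  have h1 : rnorm ((a - c%:C *: (1 : op K)) y) ^+ 2 <= m ^+ 2 * rnorm y ^+ 2.
    rewrite -exprMn ler_pXn2r ?nnegrE ?mulr_ge0 ?rnorm_ge0 ?opnorm_ge0//.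
    exact: opnorm_ub.
  have h2 := ac y.
  have h3 : t * (complex.Re (dot (a y) y) - c * rnorm y ^+ 2) <= 0.
    by rewrite pmulr_rle0// subr_le0.
  have := ler_wpM2l (sqr_ge0 t) h1; lra.
set z := complex.Re (dot (b x) x) - c * rnorm x ^+ 2.
suff z0 : z <= 0 by move: z0; rewrite /z; lra.
have key t : 0 < t -> 2 * z <= t * (m ^+ 2 * rnorm x ^+ 2).
  move=> t0; have p0 : 0 <= 1 + t ^+ 2 * m ^+ 2 by rewrite addr_ge0// mulr_ge0// sqr_ge0.
  have : rnorm ((1 + t%:C *: (b - c%:C *: (1 : op H))) x) ^+ 2 <=
      (1 + t ^+ 2 * m ^+ 2) * rnorm x ^+ 2.
    rewrite -[1 + _ * _](sqr_sqrtr p0) -exprMn ler_pXn2r ?nnegrE ?mulr_ge0 ?rnorm_ge0 ?sqrtr_ge0//.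
    apply: le_trans (opnorm_ub _ _) _; rewrite ler_wpM2r ?rnorm_ge0//.
    exact: le_trans (ab _ t0) (a_le _ t0).
  rewrite expand shift -/z => h.
  have h4 := mulr_ge0 (sqr_ge0 t) (sqr_ge0 (rnorm ((b - c%:C *: (1 : op H)) x))).
  by rewrite -(ler_pM2l t0); lra.
apply/ler_addgt0Pr => d d0; rewrite add0r.
set s := m ^+ 2 * rnorm x ^+ 2 in key *.
have s0 : 0 <= s by rewrite mulr_ge0// sqr_ge0.
have s1 : 0 < s + 1 by lra.
have := key _ (divr_gt0 d0 s1).
have : d / (s + 1) * s <= d by rewrite mulrAC ler_pdivrMr//; nra.
lra.
Qed.

End NumericalRange.

Section Forms.
Context {R : realType} {A : algType R[i]} {K H : hilbertType R}.
Context {f : A -> op K} {g : A -> op H}.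
Hypotheses (lf : linear f) (lg : linear g) (f1 : f 1 = 1) (g1 : g 1 = 1).
Local Notation C := R[i].

Let f_lin : {linear A -> op K} := HB.pack f (GRing.isLinear.Build C A (op K) *:%R f lf).
Let g_lin : {linear A -> op H} := HB.pack g (GRing.isLinear.Build C A (op H) *:%R g lg).

Definition mxform {V : hilbertType R} {n} (a : 'M[op V]_n) (y : hsum V n) : R :=
  complex.Re (dot (blockop a y) y).

Lemma mxformD (V : hilbertType R) n (a b : 'M[op V]_n) y :
  mxform (a + b) y = mxform a y + mxform b y.
Proof. by rewrite /mxform blockopD opDE dotDl raddfD. Qed.

Lemma mxformZ (V : hilbertType R) n (t : R) (a : 'M[op V]_n) y :
  mxform (map_mx ( *:%R t%:C) a) y = t * mxform a y.
Proof. by rewrite /mxform blockopZ opZE dotZl Re_realM. Qed.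

Lemma mxform_entry (V : hilbertType R) n (a : 'M[op V]_n) (s : op V) i k y :
  (forall i' k', a i' k' = if (i' == i) && (k' == k) then s else 0) ->
  mxform a y = complex.Re (dot (s (y k)) (y i)).
Proof.
move=> aE; rewrite /mxform dot_blockop; congr complex.Re.
rewrite (bigD1 i)//= [X in _ + X]big1 => [|i' i'i].
  rewrite (bigD1 k)//= big1 => [|k' k'k]; rewrite aE eqxx /=.
    by rewrite eqxx !addr0.
  by rewrite (negbTE k'k) op0E dot0l.
by rewrite big1// => k' _; rewrite aE (negbTE i'i) op0E dot0l.
Qed.

Context {n : nat}.

(* The pairs of quadratic forms given by the images of one matrix over A. *)
Definition form_pair (q : hsum K n -> R) (r : hsum H n -> R) : Prop :=
  exists F : 'M[A]_n, q = mxform (map_mx f F) /\ r = mxform (map_mx g F).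

Lemma form_pairD q r q' r' : form_pair q r -> form_pair q' r' ->
  form_pair (fun y => q y + q' y) (fun y => r y + r' y).
Proof.
move=> [F [-> ->]] [F' [-> ->]]; exists (F + F').
split; apply/funext => y; rewrite -mxformD; congr mxform.
  exact: (esym (map_mxD f_lin _ _)).
exact: (esym (map_mxD g_lin _ _)).
Qed.

Lemma form_pairZ t q r : form_pair q r ->
  form_pair (fun y => t * q y) (fun y => t * r y).
Proof.
move=> [F [-> ->]]; exists (map_mx ( *:%R t%:C) F).
split; apply/funext => y; rewrite -mxformZ; congr mxform; apply/matrixP => i k;
  rewrite !mxE.
  exact: (esym (linearZ_LR f_lin _ _)).
exact: (esym (linearZ_LR g_lin _ _)).
Qed.

Lemma form_pair_entry (a : A) i k :
  form_pair (fun y => complex.Re (dot (f a (y k)) (y i)))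
            (fun y => complex.Re (dot (g a (y k)) (y i))).
Proof.
exists (\matrix_(i', k') if (i' == i) && (k' == k) then a else 0).
split; apply/funext => y; apply/esym/mxform_entry => i' k'; rewrite !mxE.
  by case: ifP => // _; exact: (linear0 f_lin).
by case: ifP => // _; exact: (linear0 g_lin).
Qed.

Lemma form_pair0 : form_pair (fun=> 0) (fun=> 0).
Proof.
have z V (y : hsum V n) : mxform (0 : 'M[op V]_n) y = 0.
  by rewrite /mxform -(subrr 0) blockopB subrr dot0l.
exists 0; split; apply/funext => y; rewrite -(z _ y); congr mxform.
  by apply/matrixP => i k; rewrite !mxE; exact: (esym (linear0 f_lin)).
by apply/matrixP => i k; rewrite !mxE; exact: (esym (linear0 g_lin)).
Qed.

Lemma form_pair_sum I (s : seq I) (q : I -> hsum K n -> R) (r : I -> hsum H n -> R) :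
  (forall i, form_pair (q i) (r i)) ->
  form_pair (fun y => \sum_(i <- s) q i y) (fun y => \sum_(i <- s) r i y).
Proof.
move=> qr; elim: s => [|i s IH].
  have := form_pair0; congr form_pair; apply/funext => y; exact/esym/big_nil.
have := form_pairD (qr i) IH.
by congr form_pair; apply/funext => y; rewrite big_cons.
Qed.

(** The matrix [s] lives only on the side of K: adding entries of [I] cannot bring the norm below
    that of the image under [g], so it may help to bound q and is invisible in r. *)
Lemma form_pair_transfer (I : set (op K)) (q : hsum K n -> R) (r : hsum H n -> R)
    (s : 'M[op K]_n) (c : R) :
  (forall k b, I b -> I (k *: b)) ->
  (forall (F : 'M[A]_n) (b : 'M[op K]_n), (forall i k, I (b i k)) ->
    opmxnorm (map_mx g F) <= opmxnorm (map_mx f F + b)) ->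
  form_pair q r -> (forall i k, I (s i k)) ->
  (forall y, q y + mxform s y <= c * rnorm y ^+ 2) ->
  forall x, r x <= c * rnorm x ^+ 2.
Proof.
move=> IZ fg [F [-> ->]] Is qs.
apply: (@numerical_range_transfer _ _ _ (blockop (map_mx f F + s))); last first.
  by move=> y; rewrite blockopD opDE dotDl raddfD; exact: qs.
move=> t t0.
(* 1 + t (F - c) is again a matrix over A, because A is unital. *)
pose F' : 'M[A]_n := 1%:M + map_mx ( *:%R t%:C) (F - (c%:C%:A)%:M).
have E (V : hilbertType R) (h : {linear A -> op V}) : h 1 = 1 ->
    blockop (map_mx h F') = 1 + t%:C *: (blockop (map_mx h F) - c%:C *: (1 : op (hsum V n))).
  move=> h1; have -> : map_mx h F' = (1%:M : 'M[op V]_n) +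
      map_mx ( *:%R t%:C) (map_mx h F - map_mx ( *:%R c%:C) (1%:M : 'M[op V]_n)).
    apply/matrixP => i k; rewrite !mxE linearD linearZ_LR linearB /= !linearMn h1.
    by case: (i == k); rewrite ?mulr1n ?mulr0n ?linearZ_LR ?h1 ?scaler0 //= linearZ_LR h1.
  by rewrite blockopD blockopZ blockopB blockopZ blockop1.
have Ef : blockop (map_mx f F') =
    1 + t%:C *: (blockop (map_mx f F) - c%:C *: (1 : op (hsum K n))) := E _ f_lin f1.
have Eg : blockop (map_mx g F') =
    1 + t%:C *: (blockop (map_mx g F) - c%:C *: (1 : op (hsum H n))) := E _ g_lin g1.
have := fg F' (map_mx ( *:%R t%:C) s).
rewrite !opmxnormE blockopD Ef Eg !blockopZ blockopD -addrA -scalerDr addrAC.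
by apply => i k; rewrite mxE; exact: IZ.
Qed.

End Forms.

(** Operators act on the left, so the vector of l :: v is the letter l applied to the vector of v;
    hence the index set is closed under tails. Both the quadratic form and the compression use it,
    with [r] as root, [p] as parent and [g] as lookup. *)
Lemma suffix_family (L : eqType) (ws : seq (seq L)) :
  exists (n : nat) (w : 'I_n -> seq L) (r : 'I_n) (p : 'I_n -> 'I_n) (g : seq L -> 'I_n),
    [/\ w r = [::], forall i, w i = [::] -> i = r,
        forall i l v, w i = l :: v -> w (p i) = v &
        {in ws, forall v, w (g v) = v}].
Proof.
(* The empty word is added by hand, so that the root exists even when ws is empty. *)
pose W := undup ([::] :: flatten [seq [seq drop k v | k <- iota 0 (size v).+1] | v <- ws]).
have W0 : [::] \in W by rewrite mem_undup inE eqxx.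
have Wws v : v \in ws -> v \in W.
  move=> vws; rewrite mem_undup inE; apply/orP; right; apply/flattenP.
  exists [seq drop k v | k <- iota 0 (size v).+1]; first exact: map_f.
  by apply/mapP; exists 0%N; rewrite ?drop0// mem_iota.
have Wtl l v : l :: v \in W -> v \in W.
  rewrite !mem_undup !inE => /orP[//|] /flattenP[_ /mapP[u uws ->] /mapP[k]].
  rewrite mem_iota add0n ltnS => /andP[_ ku] uk; apply/orP; right; apply/flattenP.
  exists [seq drop k u | k <- iota 0 (size u).+1]; first exact: map_f.
  apply/mapP; exists k.+1; last by rewrite -addn1 addnC -drop_drop -uk /= drop0.
  rewrite mem_iota add0n ltnS /=.
  by have := congr1 size uk; rewrite size_drop /= -subn_gt0 => <-.
have Wu : uniq W by exact: undup_uniq.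
have idx v : v \in W -> (index v W < size W)%N by rewrite index_mem.
pose r := Ordinal (idx _ W0).
pose g v : 'I_(size W) := odflt r (insub (index v W)).
pose w (i : 'I_(size W)) := nth [::] W i.
have wg v : v \in W -> w (g v) = v.
  by move=> vW; rewrite /w /g insubT ?idx//= => _; rewrite nth_index.
exists (size W), w, r, (fun i => g (behead (w i))), g; split.
- by rewrite /w /= nth_index.
- by move=> i wi; apply: val_inj; rewrite /= -wi /w index_uniq.
- move=> i l v wi; rewrite wi wg //=; apply: (Wtl l); rewrite -wi.
  exact: mem_nth.
- by move=> v /Wws; exact: wg.
Qed.

Section Collect.
Context {R : realType} {L : eqType} {n : nat} (p : seq (R[i] * seq L)) (g : seq L -> 'I_n).

(** A word may occur several times in the list p; its coefficients are merged into one per index. *)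
Definition collect_coef (i : 'I_n) : R[i] := \sum_(t <- p | g t.2 == i) t.1.

Lemma collect_coefE (V : lmodType R[i]) (x : 'I_n -> V) :
  \sum_i collect_coef i *: x i = \sum_(t <- p) t.1 *: x (g t.2).
Proof.
under eq_bigr do rewrite scaler_suml big_mkcond.
rewrite exchange_big /=; apply: eq_bigr => t _.
by rewrite -big_mkcond (big_pred1 (g t.2)) // => i; rewrite eq_sym.
Qed.

End Collect.
Lemma flipK d : involutive (@flip d).
Proof. by move=> [k s]; rewrite /flip negbK. Qed.

(** * The quadratic form on words *)

Section RigidityEstimate.
Context {R : realType} {d : nat} {A : algType R[i]} {K H : hilbertType R}.
Context {f : A -> op K} {g : A -> op H} {z : 'I_d -> A}.
Context {eT : 'I_d * bool -> op K} {eU : 'I_d * bool -> op H}.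
Hypotheses (lf : linear f) (lg : linear g) (f1 : f 1 = 1) (g1 : g 1 = 1).
Hypotheses (eTE : forall k, eT (k, true) = f (z k)) (eUE : forall k, eU (k, true) = g (z k)).
Hypotheses (eTadj : forall l, adjoint (eT l) (eT (flip l))).
Hypotheses (eUadj : forall l, adjoint (eU l) (eU (flip l))).
Hypotheses (eT1 : forall k, opnorm (eT (k, true)) <= 1).
Hypotheses (eU1 : forall l, eU l * eU (flip l) = 1).
Local Notation C := R[i].
Local Notation word := (seq ('I_d * bool)).

Context {n : nat} {w : 'I_n -> word} {r : 'I_n} {p : 'I_n -> 'I_n}.
Hypotheses (wr : w r = [::]) (w_nil : forall i, w i = [::] -> i = r)
  (w_cons : forall i l v, w i = l :: v -> w (p i) = v).

(* For y i = (word w i) (y r) the i-th defect vanishes when the letters are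
   unitary; it involves the images of the generators linearly. *)
Definition defect {V : hilbertType R} (e : 'I_d * bool -> op V) (i : 'I_n) (y : hsum V n) : R :=
  if w i is (k, s) :: _ then
    rnorm (y i) ^+ 2 + rnorm (y (p i)) ^+ 2 - 2 * complex.Re
      (dot (e (k, true) (y (if s then p i else i))) (y (if s then i else p i)))
  else 0.

Lemma eT_contr l x : rnorm (eT l x) <= rnorm x.
Proof.
have : opnorm (eT l) <= 1.
  by case: l => k []; rewrite ?eT1// (adjoint_norm (eTadj (k, true))) eT1.
have := opnorm_ub (eT l) x; have := rnorm_ge0 x; nra.
Qed.

(** The defect exceeds the square by |y_v|^2 - |l y_v|^2, which is nonnegative for a contraction;
    for an adjoint letter the scalar product is moved across first. *)
Lemma defect_ge i l v (y : hsum K n) : w i = l :: v ->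
  rnorm (y i - eT l (y (p i))) ^+ 2 <= defect eT i y.
Proof.
rewrite /defect => ->; case: l => k s; rewrite sqr_rnormB.
have := eT_contr (k, s) (y (p i)).
rewrite -(ler_pXn2r (n := 2)) ?nnegrE ?rnorm_ge0//.
case: s => h; first by rewrite (Re_dotC (y i)); lra.
by rewrite -(eTadj (k, true)); lra.
Qed.

Lemma defect_ge0 i (y : hsum K n) : 0 <= defect eT i y.
Proof.
case wi : (w i) => [|l v]; first by rewrite /defect wi.
exact: le_trans (sqr_ge0 _) (defect_ge y wi).
Qed.

(** Induction along the tails of the word: each letter costs at most the root of the total defect,
    and contractions do not amplify earlier errors. *)
Lemma defect_path (y : hsum K n) i :
  rnorm (y i - word_op eT (w i) (y r)) <=
  (size (w i))%:R * Num.sqrt (\sum_i defect eT i y).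
Proof.
set S := Num.sqrt _.
have Si j l v : w j = l :: v -> rnorm (y j - eT l (y (p j))) <= S.
  move=> wj; rewrite -[leLHS]ger0_norm ?rnorm_ge0// -sqrtr_sqr ler_wsqrtr//.
  apply: le_trans (defect_ge y wj) _; rewrite (bigD1 j)//= lerDl sumr_ge0// => k _.
  exact: defect_ge0.
move wi : (w i) => v; elim: v i wi => [|l v IH] i wi.
  by rewrite (w_nil wi) word_op_nil op1E subrr rnorm0 mul0r.
apply: le_trans (rnorm_triangle (eT l (y (p i))) _ _) _.
rewrite word_op_cons opME -linearB /= -natr1 mulrDl mul1r addrC.
apply: lerD; last exact: Si wi.
exact: le_trans (eT_contr _ _) (IH _ (w_cons wi)).
Qed.

Lemma eU_iso l x : rnorm (eU l x) = rnorm x.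
Proof.
apply: (isometric_opnorm1 (eUadj l)).
by have := eU1 (flip l); rewrite flipK.
Qed.

Lemma word_eU_iso v x : rnorm (word_op eU v x) = rnorm x.
Proof.
elim: v => [|l v IH]; first by rewrite word_op_nil.
by rewrite word_op_cons opME eU_iso.
Qed.

Lemma defect_unitary (x : H) i : defect eU i (fun i => word_op eU (w i) x) = 0.
Proof.
rewrite /defect; case wi : (w i) => [//|[k s] v].
rewrite !word_eU_iso; case: s wi => wi; rewrite (w_cons wi) wi word_op_cons opME.
  by rewrite Re_dotxx eU_iso word_eU_iso; ring.
rewrite -[X in dot X]opME (eU1 (k, true)) op1E Re_dotxx word_eU_iso; ring.
Qed.

Lemma form_pair_sqr_rnorm i : form_pair (f := f) (g := g)
  (fun y : hsum K n => rnorm (y i) ^+ 2) (fun y : hsum H n => rnorm (y i) ^+ 2).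
Proof.
have := form_pair_entry (f := f) (g := g) lf lg 1 i i.
by congr form_pair; apply/funext => y; rewrite ?f1 ?g1 op1E Re_dotxx.
Qed.

Lemma form_pair_defect i : form_pair (f := f) (g := g) (defect eT i) (defect eU i).
Proof.
rewrite /defect; case: (w i) => [|[k s] v]; first exact: form_pair0.
have := form_pairD lf lg (form_pairD lf lg (form_pair_sqr_rnorm i)
    (form_pair_sqr_rnorm (p i)))
  (form_pairZ lf lg (-2) (form_pair_entry (f := f) (g := g) lf lg (z k)
     (if s then i else p i) (if s then p i else i))).
by congr form_pair; apply/funext => y; rewrite ?eTE ?eUE mulNr.
Qed.

Lemma sqr_rnorm_comb (V : hilbertType R) (c : 'I_n -> C) (y : 'I_n -> V) :
  rnorm (\sum_i c i *: y i) ^+ 2 =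
  \sum_i \sum_k complex.Re (dot ((c k * (c i)^*%C) *: y k) (y i)).
Proof.
rewrite -Re_dotxx dot_sumr raddf_sum; apply: eq_bigr => i _ /=.
rewrite dot_suml raddf_sum; apply: eq_bigr => k _ /=.
by rewrite dotZr !dotZl; congr complex.Re; ring.
Qed.

Lemma linear_scalar (V : hilbertType R) (h : A -> op V) k :
  linear h -> h 1 = 1 -> h k%:A = k *: (1 : op V).
Proof.
move=> lh h1; pose h' : {linear A -> op V} := HB.pack h (GRing.isLinear.Build C A (op V) *:%R h lh).
by rewrite -[h]/(h' : A -> op V) linearZ_LR /= h1.
Qed.

Lemma form_pair_comb (c : 'I_n -> C) : form_pair (f := f) (g := g)
  (fun y : hsum K n => rnorm (\sum_i c i *: y i) ^+ 2)
  (fun y : hsum H n => rnorm (\sum_i c i *: y i) ^+ 2).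
Proof.
have := form_pair_sum lf lg (index_enum 'I_n) (fun i => form_pair_sum lf lg (index_enum 'I_n)
  (fun k => form_pair_entry (f := f) (g := g) lf lg ((c k * (c i)^*%C)%:A) i k)).
by congr form_pair; apply/funext => y; rewrite sqr_rnorm_comb; apply: eq_bigr => i _;
  apply: eq_bigr => k _; rewrite linear_scalar.
Qed.

(* The ideal part of the form: 2 Re <b y_r, sum_i c_i y_i> + |b y_r|^2. *)
Definition ideal_mx (c : 'I_n -> C) (b b' : op K) : 'M[op K]_n :=
  \matrix_(i, k) ((if k == r then ((2 : R)%:C * (c i)^*%C) else 0) *: b +
                  (if (i == r) && (k == r) then 1 else 0) *: (b' * b)).

Lemma mxform_ideal_mx c b b' (y : hsum K n) : adjoint b b' ->
  mxform (ideal_mx c b b') y =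
  2 * complex.Re (dot (b (y r)) (\sum_i c i *: y i)) + rnorm (b (y r)) ^+ 2.
Proof.
move=> bb; pose m1 : 'M[op K]_n :=
  \matrix_(i, k) ((if k == r then ((2 : R)%:C * (c i)^*%C) else 0) *: b).
pose m2 : 'M[op K]_n := \matrix_(i, k) (if (i == r) && (k == r) then b' * b else 0).
have -> : ideal_mx c b b' = m1 + m2.
  apply/matrixP => i k; rewrite !mxE; case: ifP => // _; case: ifP => // _;
  by rewrite ?scale1r ?scale0r.
rewrite mxformD (@mxform_entry _ _ _ m2 (b' * b) r r); last by move=> i k; rewrite mxE.
rewrite opME (adjoint_sym bb) Re_dotxx; congr (_ + _).
rewrite /mxform dot_blockop dot_sumr -Re_realM; congr complex.Re.
rewrite mulr_sumr; apply: eq_bigr => i _.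
rewrite (bigD1 r)//= big1 => [|k kr]; rewrite mxE.
  by rewrite eqxx opZE dotZl dotZr addr0 mulrA.
by rewrite (negbTE kr) scale0r op0E dot0l.
Qed.

(** Expanding |sum c_i y_i + b y_r|^2 produces terms in b and in b^* b; both must lie in [I] for the
    form to be compared modulo [I]. *)
Lemma rigidity_estimate (I : set (op K)) (q : seq (C * word)) (b b' : op K) (h : word -> 'I_n) :
  (forall k a, I a -> I (k *: a)) -> (forall a a', I a -> I a' -> I (a + a')) ->
  (forall (F : 'M[A]_n) (a : 'M[op K]_n), (forall i k, I (a i k)) ->
    opmxnorm (map_mx g F) <= opmxnorm (map_mx f F + a)) ->
  I b -> I (b' * b) -> adjoint b b' ->
  {in map snd q, forall v, w (h v) = v} ->
  opnorm (poly_op eU q) <= opnorm (poly_op eT q + b).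
Proof.
move=> IZ ID fg Ib Ibb bb hq; set rho := opnorm (_ + b).
have rho0 : 0 <= rho by exact: opnorm_ge0.
pose c := collect_coef q h.
have cE (V : hilbertType R) (e : 'I_d * bool -> op V) (x : V) :
    \sum_i c i *: word_op e (w i) x = poly_op e q x.
  rewrite (collect_coefE q h (fun i => word_op e (w i) x)) poly_opE.
  apply: eq_big_seq => t tq; rewrite hq//; exact: map_f.
(* By [defect_path], sum c_i y_i differs from q(T) y_r by at most M times the root of the total
   defect. *)
pose M := \sum_i rnorm (c i) * (size (w i))%:R.
have M0 : 0 <= M by apply: sumr_ge0 => i _; rewrite mulr_ge0 ?rnorm_ge0.
(* In (rho |y_r| + M S)^2, with S^2 the total defect, the cross term is split by Young's inequality
   into dl |y_r|^2 and rho^2 M^2 / dl S^2; this fixes the coefficient of the defect. *)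
have Tbound (dl : R) (y : hsum K n) : 0 < dl ->
    rnorm (\sum_i c i *: y i) ^+ 2 + (- rho ^+ 2) * rnorm (y r) ^+ 2 +
      (- (M ^+ 2 + rho ^+ 2 * M ^+ 2 / dl)) * (\sum_i defect eT i y) +
      mxform (ideal_mx c b b') y <= dl * rnorm y ^+ 2.
  move=> dl0; rewrite (mxform_ideal_mx _ _ bb).
  set s := \sum_i c i *: y i; set D := \sum_i defect eT i y.
  have D0 : 0 <= D by apply: sumr_ge0 => i _; exact: defect_ge0.
  set S := Num.sqrt D; have SD : S ^+ 2 = D by exact: sqr_sqrtr.
  have S0 : 0 <= S by exact: sqrtr_ge0.
  have yr := rnorm_coord_le y r.
  have : rnorm (s + b (y r)) <= rho * rnorm (y r) + M * S.
    have -> : s + b (y r) = (poly_op eT q + b) (y r) +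
        \sum_i c i *: (y i - word_op eT (w i) (y r)).
      rewrite opDE -cE -addrA addrCA addrC -big_split /=; congr (_ + _).
      by apply: eq_bigr => i _; rewrite scalerBr addrC subrK.
    apply: le_trans (ler_rnormD _ _) _; apply: lerD; first exact: opnorm_ub.
    apply: le_trans (ler_rnorm_sum _) _; rewrite /M mulr_suml; apply: ler_sum => i _.
    rewrite rnormZ -mulrA ler_wpM2l ?rnorm_ge0//; exact: defect_path.
  rewrite -(ler_pXn2r (n := 2)) ?nnegrE ?rnorm_ge0 ?addr_ge0 ?mulr_ge0 ?rnorm_ge0//.
  rewrite sqr_rnormD (Re_dotC s) => hs.
  have hy : rnorm (y r) ^+ 2 <= rnorm y ^+ 2.
    by rewrite ler_pXn2r ?nnegrE ?rnorm_ge0.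
  have hdl : dl * rnorm (y r) ^+ 2 <= dl * rnorm y ^+ 2 by rewrite ler_pM2l.
  have hsq : 2 * (rho * rnorm (y r) * (M * S)) <=
      dl * rnorm (y r) ^+ 2 + rho ^+ 2 * M ^+ 2 / dl * S ^+ 2.
    have := sqr_ge0 (dl * rnorm (y r) - rho * M * S).
    rewrite -(pmulr_rge0 (x := dl^-1)) ?invr_gt0// => h0.
    rewrite -subr_ge0; apply: le_trans h0 _; rewrite le_eqVlt; apply/orP; left.
    by apply/eqP; field; rewrite gt_eqF.
  rewrite -SD; lra.
(* At y_w = U_w x the defects vanish and every |y_w| is |x|, so |y|^2 = n |x|^2 and only dl n is
   lost. *)
have Ubound (dl : R) (x : H) : 0 < dl ->
    rnorm (poly_op eU q x) ^+ 2 <= (rho ^+ 2 + dl * n%:R) * rnorm x ^+ 2.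
  move=> dl0.
  have := form_pair_transfer lf lg f1 g1 IZ fg
    (form_pairD lf lg (form_pairD lf lg (form_pair_comb c)
      (form_pairZ lf lg (- rho ^+ 2) (form_pair_sqr_rnorm r)))
      (form_pairZ lf lg (- (M ^+ 2 + rho ^+ 2 * M ^+ 2 / dl))
        (form_pair_sum lf lg (index_enum 'I_n) form_pair_defect)))
    _ (fun y => Tbound dl y dl0).
  move=> /(_ _ (fun i => word_op eU (w i) x)).
  rewrite /= cE big1 => [|i _]; last exact: defect_unitary.
  rewrite mulr0 addr0 sqr_rnorm_hsum wr word_op_nil op1E.
  have -> : \sum_i rnorm (word_op eU (w i) x) ^+ 2 = n%:R * rnorm x ^+ 2.
    under eq_bigr do rewrite word_eU_iso.
    by rewrite sumr_const card_ord -[LHS]mulr_natl.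
  move=> h0; have /h0 : forall i k, I (ideal_mx c b b' i k).
    by move=> i k; rewrite mxE; apply: ID; apply: IZ.
  lra.
apply: opnorm_le => // x.
rewrite -(ler_pXn2r (n := 2)) ?nnegrE ?mulr_ge0 ?rnorm_ge0//.
apply/ler_addgt0Pr => e e0; rewrite exprMn.
pose D := n%:R * rnorm x ^+ 2 + 1; have D0 : 0 < D.
  have := mulr_ge0 (ler0n R n) (sqr_ge0 (rnorm x)); rewrite /D; lra.
have := Ubound _ x (divr_gt0 e0 D0).
have : e / D * (n%:R * rnorm x ^+ 2) <= e.
  by rewrite mulrAC ler_pdivrMr// ler_pM2l// /D lerDl.
lra.
Qed.

End RigidityEstimate.

(** * Compression to a finite-dimensional subspace *)

(** Bernoulli's inequality; it bounds the change of a word of length k when its letters are scaled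
    by r. *)
Lemma exprB_le (R : realType) (r : R) k : 0 <= r -> r <= 1 -> 1 - r ^+ k <= k%:R * (1 - r).
Proof.
move=> r0 r1; elim: k => [|k IH]; first by rewrite expr0 subrr mul0r.
rewrite exprS -natr1; have := exprn_ge0 k r0; have := exprn_ile1 k r0 r1; nra.
Qed.

Lemma mulr_conj (R : realType) (z : R[i]) : z * (z^*)%C = (rnorm z ^+ 2)%:C.
Proof. by rewrite -sqr_normc -rnormE rmorphXn. Qed.

Section SubOrthonormal.
Context {R : realType} {H : hilbertType R}.
Local Notation C := R[i].

(* Zero vectors are allowed, so that Gram-Schmidt needs no case on dependence. *)
Definition suborthonormal (e : nat -> H) : Prop :=
  (forall a b, a != b -> dot (e a) (e b) = 0) /\
  (forall a, e a = 0 \/ rnorm (e a) = 1).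

Definition famproj (m : nat) (e : nat -> H) (v : H) : H :=
  \sum_(a < m) dot v (e a) *: e a.

Lemma famprojP m e : linear (famproj m e).
Proof.
move=> k u v; rewrite /famproj scaler_sumr -big_split; apply: eq_bigr => a _ /=.
by rewrite dotDl dotZl scalerDl scalerA.
Qed.

Lemma dot_comb m e (x : nat -> C) a : suborthonormal e -> (a < m)%N ->
  dot (\sum_(b < m) x b *: e b) (e a) = x a * (rnorm (e a) ^+ 2)%:C.
Proof.
move=> [eo _] am; rewrite dot_suml (bigD1 (Ordinal am))//= big1 => [|b ba].
  by rewrite addr0 dotZl dotxx.
by rewrite dotZl eo ?mulr0.
Qed.

Lemma sqr_rnorm_le1 e a : suborthonormal e -> rnorm (e a) ^+ 2 <= 1.
Proof. by move=> [_ /(_ a)[->|->]]; rewrite ?rnorm0 ?expr0n ?expr1n. Qed.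

Lemma comb_norm_le m e (x : nat -> C) : suborthonormal e ->
  rnorm (\sum_(b < m) x b *: e b) ^+ 2 <= \sum_(b < m) rnorm (x b) ^+ 2.
Proof.
move=> se; rewrite -Re_dotxx dot_sumr raddf_sum; apply: ler_sum => a _ /=.
rewrite dotZr (dot_comb _ se)// mulrA [(_^*)%C * _]mulrC mulr_conj -realCM /=.
by rewrite ler_piMr ?sqr_ge0// sqr_rnorm_le1.
Qed.

Lemma Re_dot_famproj m e v :
  complex.Re (dot v (famproj m e v)) = \sum_(a < m) rnorm (dot v (e a)) ^+ 2.
Proof.
rewrite /famproj dot_sumr raddf_sum; apply: eq_bigr => a _ /=.
by rewrite dotZr mulrC mulr_conj.
Qed.

Lemma bessel m e v : suborthonormal e ->
  \sum_(a < m) rnorm (dot v (e a)) ^+ 2 <= rnorm v ^+ 2.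
Proof.
move=> se; have := sqr_ge0 (rnorm (v - famproj m e v)).
rewrite sqr_rnormB Re_dot_famproj.
have := comb_norm_le m (fun a => dot v (e a)) se; rewrite -/(famproj m e v); lra.
Qed.

Lemma parseval m e v : famproj m e v = v ->
  \sum_(a < m) rnorm (dot v (e a)) ^+ 2 = rnorm v ^+ 2.
Proof. by move=> pv; rewrite -Re_dot_famproj pv Re_dotxx. Qed.

Lemma gram_schmidt (vs : seq H) : exists m e,
  [/\ suborthonormal e, forall a, (m <= a)%N -> e a = 0 &
      {in vs, forall v, famproj m e v = v}].
Proof.
elim: vs => [|v vs [m [e [se e0 evs]]]].
  by exists 0%N, (fun=> 0); do !split => //; [move=> *; rewrite dot0l|left].
pose u := v - famproj m e v.
have uo a : (a < m)%N -> dot u (e a) = 0.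
  move=> am; rewrite dotBl (dot_comb (fun a => dot v (e a)) se am).
  case: se => _ /(_ a)[->|->]; first by rewrite !dot0r mul0r subrr.
  by rewrite expr1n mulr1 subrr.
pose u' := (rnorm u)^-1%:C *: u.
have uo' a : dot u' (e a) = 0.
  by case: (ltnP a m) => am; [rewrite dotZl uo ?mulr0|rewrite e0// dot0r].
have uoc a : dot (e a) u' = 0 by rewrite dot_conj uo' rmorph0.
pose e' a := if a == m then u' else e a.
have e'E v1 : famproj m.+1 e' v1 = famproj m e v1 + dot v1 u' *: u'.
  rewrite /famproj big_ord_recr /= /e' eqxx; congr (_ + _).
  by apply: eq_bigr => a _; rewrite ltn_eqF.
have u'n : u' = 0 \/ rnorm u' = 1.
  have [u0|u0] := eqVneq u 0; [left|right]; first by rewrite /u' u0 scaler0.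
  have := rnorm_gt0 u0 => nu.
  by rewrite rnormZ rnormRe ger0_norm ?invr_ge0 ?(ltW nu)// mulVf// gt_eqF.
have se' : suborthonormal e'.
  split=> [a b|a]; rewrite /e'; last by case: ifP => // _; case: se => _; exact.
  have [am|am] := boolP (a == m); have [bm|bm] := boolP (b == m) => ab.
  - by rewrite (eqP am) (eqP bm) eqxx in ab.
  - exact: uo'.
  - exact: uoc.
  - by case: se => eo _; exact: eo.
exists m.+1, e'; split => // [a ma|x].
  by rewrite /e' gtn_eqF// e0// ltnW.
rewrite inE => /orP[/eqP ->|/evs xE]; rewrite e'E; last first.
  rewrite xE -[X in dot X]xE /famproj dot_suml big1 ?scale0r ?addr0// => a _.
  by rewrite dotZl uoc mulr0.
have -> : dot v u' = dot u u'.
  rewrite -[v in LHS](subrK (famproj m e v)) dotDl -/u /famproj dot_suml.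
  rewrite [X in _ + X]big1 ?addr0// => a _.
  by rewrite dotZl uoc mulr0.
have -> : dot u u' *: u' = u; last by rewrite addrC subrK.
have [u0|u0] := eqVneq u 0; first by rewrite u0 dot0l scale0r.
have nu := rnorm_gt0 u0.
rewrite /u' dotZr conjc_real dotxx scalerA -!realCM.
have -> : (rnorm u)^-1 * rnorm u ^+ 2 * (rnorm u)^-1 = 1 by field; rewrite gt_eqF.
exact: scale1r.
Qed.

End SubOrthonormal.

Section Compression.
Context {R : realType} {d : nat} {H : hilbertType R} {e : 'I_d -> op H}.
Hypothesis (e1 : forall k, opnorm (e k) <= 1).
Local Notation C := R[i].

Context {m : nat} {b : nat -> H}.
Hypothesis (sb : suborthonormal b).
Local Notation Cm := (hsum (cline R) m).

Definition coords (v : H) : Cm := fun a => dot v (b a).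

Lemma coordsP : linear coords.
Proof. by move=> k u v; apply/funext => a; rewrite /coords dotDl dotZl. Qed.

(** The compression of t e_k to the span of [b], written in these vectors; t < 1 will put the tuple
    in the open polydisk. *)
Definition compress (t : R) (k : 'I_d) : 'M[C]_m :=
  \matrix_(i, j) (t%:C * dot (e k (b j)) (b i)).

(** Synthesis from coefficients is contractive by [comb_norm_le], and taking coordinates by Bessel's
    inequality. *)
Lemma compress_norm t k : 0 <= t -> spectral_norm (compress t k) <= t.
Proof.
move=> t0; rewrite spectral_normE; apply: opnorm_le => // x.
pose s := \sum_(j < m) x j *: b j.
have xE : mxop (compress t k) x = (t%:C *: coords (e k s) : Cm).
  apply/funext => i; rewrite mxopE -[RHS]/(t%:C * dot (e k s) (b i)).
  rewrite linear_sum dot_suml mulr_sumr; apply: eq_bigr => j _.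
  by rewrite mxE linearZ dotZl; ring.
rewrite xE rnormZ rnormRe ger0_norm// ler_wpM2l//.
apply: (@le_trans _ _ (rnorm (e k s))).
  rewrite -(ler_pXn2r (n := 2)) ?nnegrE ?rnorm_ge0// sqr_rnorm_hsum.
  exact: bessel.
apply: le_trans (opnorm_ub _ _) _; apply: (@le_trans _ _ (rnorm s)).
  by rewrite ler_piMl ?rnorm_ge0.
rewrite -(ler_pXn2r (n := 2)) ?nnegrE ?rnorm_ge0// sqr_rnorm_hsum.
pose x' (a : nat) : C := if insub a is Some i then x i else 0.
have -> : s = \sum_(j < m) x' j *: b j by apply: eq_bigr => j _; rewrite /x' valK.
apply: le_trans (comb_norm_le _ _ sb) _; rewrite le_eqVlt; apply/orP; left; apply/eqP.
by apply: eq_bigr => j _; rewrite /x' valK.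
Qed.

(** Only v has to lie in the span: the coordinates of e_k v project it back. *)
Lemma compressE t k v : famproj m b v = v ->
  mxop (compress t k) (coords v) = (t%:C *: coords (e k v) : Cm).
Proof.
move=> pv; apply/funext => i; rewrite mxopE -[RHS]/(t%:C * dot (e k v) (b i)).
rewrite -[v in RHS]pv linear_sum dot_suml mulr_sumr; apply: eq_bigr => j _.
by rewrite mxE linearZ dotZl /coords; ring.
Qed.

Lemma rnorm_coords v : famproj m b v = v -> rnorm (coords v) = rnorm v.
Proof.
move=> pv; apply/eqP; rewrite -(eqrXn2 (n := 2)) ?rnorm_ge0// sqr_rnorm_hsum.
by rewrite -(parseval pv).
Qed.

End Compression.

Section Polydisk.
Context {R : realType} {d : nat}.
Local Notation C := R[i].

Lemma mxop_ncpoly (X : polydisk R d) (p : ncpoly R d) :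
  mxop (ncpoly_fun p X) = poly_op (fun k => mxop (pd_point X k)) p.
Proof.
have wE v : mxop ((\prod_(k <- v) nccoord k : ncfun R d) X) =
    word_op (fun k => mxop (pd_point X k)) v.
  elim: v => [|k v IH]; first by rewrite big_nil word_op_nil -mxop1.
  by rewrite big_cons word_op_cons -IH -mxopM.
rewrite /ncpoly_fun /poly_op; elim: p => [|t p IH]; first by rewrite !big_nil -mxop0.
by rewrite !big_cons -IH -wE -mxopZ -mxopD.
Qed.

Definition polydisk_mx (n : nat) (P : 'I_n -> 'I_n -> ncpoly R d) (X : polydisk R d) :
  op (hsum (hsum (cline R) (pd_pred_size X).+1) n) :=
  blockop (\matrix_(i, j) mxop (ncpoly_fun (P i j) X)).

Section CompressionBound.
Context {H : hilbertType R} {e : 'I_d -> op H}.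
Hypothesis (e1 : forall k, opnorm (e k) <= 1).
Context {n : nat} (P : 'I_n -> 'I_n -> ncpoly R d) (N : R).
Hypothesis (PN : forall X, opnorm (polydisk_mx P X) <= N).

(** This is P(t e) x: a word of length k is scaled by t^k. *)
Let scaled_value (t : R) (x : hsum H n) : hsum H n :=
  fun i => \sum_j \sum_(s <- P i j) (s.1 * (t ^+ size s.2)%:C) *: word_op e s.2 (x j).

Lemma scaled_value_bound t x : 0 <= t -> t < 1 -> rnorm (scaled_value t x) <= N * rnorm x.
Proof.
move=> t0 t1.
have [m' [w [r [p [h [wr _ w_cons wh]]]]]] := suffix_family
  [seq s.2 | s <- flatten [seq P ij.1 ij.2 | ij <- enum {: 'I_n * 'I_n}]].
have whP i j s : s \in P i j -> w (h s.2) = s.2.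
  move=> sP; apply/wh/map_f/flattenP; exists (P i j) => //.
  by apply/mapP; exists (i, j); rewrite ?mem_enum.
have [m [b [sb b0 bspan]]] := gram_schmidt
  [seq word_op e (w ij.1) (x ij.2) | ij <- enum {: 'I_m' * 'I_n}].
(* The vector [b m] is zero, so one more index changes nothing; it makes the matrices nonempty, as
   points of the polydisk must be. *)
have span i j : famproj m.+1 b (word_op e (w i) (x j)) = word_op e (w i) (x j).
  rewrite /famproj big_ord_recr /= b0// scaler0 addr0; apply: bspan.
  by apply/mapP; exists (i, j); rewrite ?mem_enum.
have Xlt1 k : spectral_norm (@compress R d H e m.+1 b t k) < 1.
  exact: le_lt_trans (compress_norm e1 sb _ t0) t1.
pose X := Polydisk Xlt1.
pose c : {linear H -> hsum (cline R) m.+1} := HB.pack (coords (m := m.+1) (b := b))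
  (GRing.isLinear.Build C H (hsum (cline R) m.+1) *:%R _ (coordsP (m := m.+1) (b := b))).
pose pl : {linear H -> H} := HB.pack (famproj m.+1 b)
  (GRing.isLinear.Build C H H *:%R _ (famprojP m.+1 b)).
(* Every tail of a word gives a vector of the span, so the compressions never lose anything before
   the next letter is applied. *)
have wordE i j : word_op (fun k => mxop (pd_point X k)) (w i) (c (x j)) =
    (t ^+ size (w i))%:C *: c (word_op e (w i) (x j)).
  move wi : (w i) => v; elim: v i wi => [|k v IH] i wi.
    by rewrite !word_op_nil expr0 scale1r.
  have wp := w_cons _ _ _ wi.
  rewrite !word_op_cons !opME (IH _ wp) linearZ_LR.
  have kE : mxop (pd_point X k) (c (word_op e v (x j))) =
      t%:C *: c (e k (word_op e v (x j))).
    by apply: compressE; rewrite -wp; exact: span.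
  rewrite -[LHS]/((t ^+ size v)%:C *: mxop (pd_point X k) (c (word_op e v (x j)))).
  rewrite kE; apply: etrans (scalerA _ _ _) _.
  by rewrite -realCM -exprSr.
pose y := scaled_value t x; pose cx : hsum (hsum (cline R) m.+1) n := fun j => c (x j).
have yE i : polydisk_mx P X cx i = c (y i).
  rewrite blockopE /y /scaled_value linear_sum; apply: eq_bigr => j _.
  rewrite mxE mxop_ncpoly poly_opE linear_sum; apply: eq_big_seq => s sP.
  by rewrite -(whP i j s sP) wordE scalerA linearZ.
have yspan i : famproj m.+1 b (y i) = y i.
  rewrite -[LHS]/(pl (y i)) /y /scaled_value linear_sum; apply: eq_bigr => j _.
  rewrite linear_sum; apply: eq_big_seq => s sP.
  by rewrite linearZ -(whP i j s sP); congr (_ *: _); exact: span.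
have xspan j : famproj m.+1 b (x j) = x j.
  by have := span r j; rewrite wr word_op_nil.
have cn v : famproj m.+1 b v = v -> rnorm (c v) = rnorm v by exact: rnorm_coords.
have norm_c (z : hsum H n) (cz : hsum (hsum (cline R) m.+1) n) :
    (forall i, cz i = c (z i)) -> (forall i, famproj m.+1 b (z i) = z i) ->
    rnorm cz = rnorm z.
  move=> zE zs; apply/eqP; rewrite -(eqrXn2 (n := 2)) ?rnorm_ge0// !sqr_rnorm_hsum.
  by apply/eqP; apply: eq_bigr => i _; rewrite zE cn.
rewrite -/y -(norm_c y _ yE yspan) -(norm_c x cx _ xspan)//.
apply: le_trans (opnorm_ub _ _) _; rewrite ler_wpM2r ?rnorm_ge0//.
exact: (PN X).
Qed.

Lemma compression_bound : opnorm (blockop (\matrix_(i, j) poly_op e (P i j))) <= N.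
Proof.
have N0 : 0 <= N by apply: le_trans (PN (disk0 R d)); exact: opnorm_ge0.
apply: opnorm_le => // x.
(* A Lipschitz constant at t = 1 for t |-> P(t e) x, by Bernoulli's inequality. *)
pose D := \sum_i \sum_j \sum_(s <- P i j) rnorm s.1 * ((size s.2)%:R * rnorm (x j)).
have we v y : rnorm (word_op e v y) <= rnorm y.
  elim: v => [|k v IH]; first by rewrite word_op_nil.
  rewrite word_op_cons opME; apply: le_trans (opnorm_ub _ _) _.
  by apply: le_trans IH; rewrite ler_piMl ?rnorm_ge0.
have close t : 0 <= t -> t <= 1 ->
    rnorm (blockop (\matrix_(i, j) poly_op e (P i j)) x - scaled_value t x) <= (1 - t) * D.
  move=> t0 t1; apply: le_trans (rnorm_hsum_le _) _; rewrite /D mulr_sumr; apply: ler_sum => i _.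
  rewrite -[X in rnorm X]/(blockop _ x i - scaled_value t x i) blockopE -sumrB mulr_sumr.
  apply: le_trans (ler_rnorm_sum _) _; apply: ler_sum => j _.
  rewrite mxE poly_opE -sumrB mulr_sumr.
  elim: (P i j) => [|s p IH]; first by rewrite !big_nil rnorm0.
  rewrite !big_cons; apply: le_trans (ler_rnormD _ _) _; apply: lerD IH.
  have -> : s.1 *: word_op e s.2 (x j) - (s.1 * (t ^+ size s.2)%:C) *: word_op e s.2 (x j) =
     (s.1 * (1 - t ^+ size s.2)%:C) *: word_op e s.2 (x j).
    by rewrite -scalerBl rmorphB mulrBr mulr1.
  rewrite rnormZ rnormM rnormRe ger0_norm ?subr_ge0 ?exprn_ile1//.
  rewrite -mulrA [leRHS]mulrCA ler_wpM2l ?rnorm_ge0// [leRHS]mulrA [(1 - t) * _]mulrC.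
  by rewrite ler_pM ?rnorm_ge0 ?subr_ge0 ?exprn_ile1 ?exprB_le.
have D0 : 0 <= D.
  do 2![apply: sumr_ge0 => ? _]; apply: sumr_ge0 => s _.
  by rewrite !mulr_ge0 ?rnorm_ge0.
apply/ler_addgt0Pr => dl dl0.
pose t := 1 - Num.min 1 (dl / (D + 1)).
have D1 : 0 < D + 1 by lra.
have mn : 0 < Num.min 1 (dl / (D + 1)) by rewrite lt_min ltr01 divr_gt0.
have m1 : Num.min 1 (dl / (D + 1)) <= 1 by rewrite ge_min lexx.
have m2 : Num.min 1 (dl / (D + 1)) * (D + 1) <= dl by rewrite -ler_pdivlMr// ge_min lexx orbT.
have t0 : 0 <= t by rewrite /t; lra.
have t1 : t < 1 by rewrite /t; lra.
have := scaled_value_bound x t0 t1; have := close _ t0 (ltW t1).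
have := ler_rnormD (blockop (\matrix_(i, j) poly_op e (P i j)) x - scaled_value t x) (scaled_value t x).
rewrite subrK [in (1 - t) * D]/t; nra.
Qed.

End CompressionBound.

End Polydisk.

(** * Unitary dilation of matrices *)

Section Defect.
Context {R : realType} {m : nat}.
Local Notation C := R[i].
Local Open Scope sesquilinear_scope.
Implicit Types A : 'M[C]_m.

Lemma adjmxE A i j : A^t* i j = (A j i)^*%C.
Proof. by rewrite !mxE. Qed.

Lemma mxop_adj A : adjoint (mxop A) (mxop (A^t*)).
Proof. by apply: mxop_adjoint => i j; rewrite adjmxE. Qed.

Lemma adjmxM n p q (A : 'M[C]_(n, p)) (B : 'M[C]_(p, q)) : (A *m B)^t* = B^t* *m A^t*.
Proof. by rewrite trmx_mul map_mxM. Qed.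

Lemma spectral_norm_adj A : spectral_norm (A^t*) = spectral_norm A.
Proof. by rewrite !spectral_normE (adjoint_norm (mxop_adj A)). Qed.

Lemma dot_defect A (x : hsum (cline R) m) :
  dot (mxop (1%:M - A^t* *m A) x) x = (rnorm x ^+ 2 - rnorm (mxop A x) ^+ 2)%:C.
Proof.
rewrite mxopB mxop1 mxopM opBE dotBl op1E opME (adjoint_sym (mxop_adj A)).
by rewrite !dotxx -rmorphB.
Qed.

(** Diagonalise 1 - A^* A by a unitary P and take the roots of the eigenvalues times P; the factor
    need not be Hermitian. *)
Lemma defect_factor A : spectral_norm A <= 1 ->
  exists D : 'M[C]_m, D^t* *m D = 1%:M - A^t* *m A.
Proof.
move=> A1; set G := 1%:M - _.
have Gadj : G^t* = G.
  by rewrite /G linearB /= map_mxB -/(_^t*) adjmxM trmxCK trmx1 map_mx1.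
have Gn : G \is normalmx by apply/normalmxP; rewrite Gadj.
have /orthomx_spectralP := Gn.
set P := spectralmx G; set sp := spectral_diag G => GE.
have Pu : P \is unitarymx := spectral_unitarymx G.
rewrite invmx_unitary// in GE.
have dE : diag_mx sp = P *m G *m P^t*.
  rewrite GE !mulmxA; move/unitarymxP: (Pu) => ->; rewrite mul1mx -mulmxA.
  by move/unitarymxP: (Pu) => ->; rewrite mulmx1.
(* An eigenvalue is the value |x|^2 - |A x|^2 of the form at the conjugate of a row of P. *)
have spE i : exists2 s : R, 0 <= s & sp 0 i = s%:C.
  pose x : hsum (cline R) m := fun j => (P i j)^*%C.
  exists (rnorm x ^+ 2 - rnorm (mxop A x) ^+ 2).
    rewrite subr_ge0 ler_pXn2r ?nnegrE ?rnorm_ge0//.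
    apply: le_trans (opnorm_ub _ _) _; rewrite -spectral_normE.
    by rewrite ler_piMl ?rnorm_ge0.
  rewrite -dot_defect -/G dot_hsum.
  have := congr1 (fun M : 'M[C]_m => M i i) dE; rewrite [LHS]mxE eqxx mulr1n => ->.
  rewrite -mulmxA mxE; apply: eq_bigr => j _.
  rewrite -[RHS]/(mxop G x j * (x j)^*%C) mxopE mxE /x conjcK mulrC.
  by congr (_ * _); apply: eq_bigr => k _; rewrite adjmxE.
have /choice[s sP] : forall i, exists s : R, 0 <= s /\ sp 0 i = s%:C.
  by move=> i; have [s] := spE i; exists s.
pose D := diag_mx (\row_i (Num.sqrt (s i))%:C) *m P.
exists D; rewrite adjmxM GE -!mulmxA; congr (_ *m _); rewrite mulmxA; congr (_ *m _).
apply/matrixP => i j; rewrite mul_mx_diag !mxE.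
case: (eqVneq i j) => [->|ij]; last by rewrite !mulr0n rmorph0 mul0r.
rewrite !mulr1n; have [s0 ->] := sP j.
by rewrite -[LHS]/(((Num.sqrt (s j))%:C^*)%C * (Num.sqrt (s j))%:C) conjc_real -realCM -expr2 sqr_sqrtr.
Qed.

(** A null vector x would satisfy |A x| = |x|. Row vectors are conjugated into columns, which is
    harmless as the matrix is self-adjoint. *)
Lemma defect_unit A : spectral_norm A < 1 -> 1%:M - A^t* *m A \in unitmx.
Proof.
move=> A1; rewrite -row_free_unit; apply: inj_row_free => v vG.
set G := _ - _ in vG.
have Gadj : G^t* = G.
  by rewrite /G linearB /= map_mxB -/(_^t*) adjmxM trmxCK trmx1 map_mx1.
pose x : hsum (cline R) m := fun j => (v 0 j)^*%C.
have Gx : mxop G x = 0.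
  apply: hsumP => i; rewrite mxopE -[RHS]/(0 : C).
  transitivity ((v *m G) 0 i)^*%C; last by rewrite vG mxE rmorph0.
  rewrite mxE rmorph_sum; apply: eq_bigr => j _ /=.
  by rewrite rmorphM mulrC /= -[in LHS]Gadj adjmxE.
have := dot_defect A x; rewrite -/G Gx dot0l => /esym/complexI xA.
have x0 : x = 0.
  apply: rnorm_eq0; apply/le_anti; rewrite rnorm_ge0 andbT.
  have := opnorm_ub (mxop A) x; rewrite -spectral_normE.
  have -> : rnorm (mxop A x) = rnorm x.
    by apply/eqP; rewrite -(eqrXn2 (n := 2)) ?rnorm_ge0// eq_sym -subr_eq0 xA.
  rewrite -subr_ge0 -[X in _ - X]mul1r -mulrBl.
  by rewrite nmulr_rge0// subr_lt0.
apply/rowP => j; rewrite mxE.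
have : (x j)^*%C = (0 : C)^*%C by rewrite x0.
by rewrite conjcK rmorph0.
Qed.

(** The usual corner -A^* works with Hermitian roots, which intertwine with A. For arbitrary
    factors, orthogonality of the columns forces D^* Z = A^* E^*, and D is invertible by
    strictness. *)
Lemma julia A : spectral_norm A < 1 -> exists D D' Z : 'M[C]_m,
  let V := block_mx A D' D (- Z) in V^t* *m V = 1%:M.
Proof.
move=> A1; have A1' : spectral_norm (A^t*) < 1 by rewrite spectral_norm_adj.
have [D DE] := defect_factor (ltW A1).
have [E EE] := defect_factor (ltW A1'); rewrite trmxCK in EE.
have := defect_unit A1; rewrite -DE unitmx_mul => /andP[Du' Du].
have := defect_unit A1'; rewrite trmxCK -EE unitmx_mul => /andP[Eu' Eu].
exists D, (E^t*), (invmx (D^t*) *m A^t* *m E^t*) => /=; set Z := _ *m _ *m _.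
have DZ : D^t* *m Z = A^t* *m E^t* by rewrite /Z !mulmxA mulmxV ?mul1mx.
have ZD : Z^t* *m D = E *m A by rewrite -[D]trmxCK -adjmxM DZ adjmxM !trmxCK.
have -> : (block_mx A (E^t*) D (- Z))^t* = block_mx (A^t*) (D^t*) E (- Z^t*).
  by rewrite tr_block_mx map_block_mx linearN /= map_mxN trmxCK.
rewrite mulmx_block !mulNmx !mulmxN opprK DE DZ ZD addrCA subrr addr0 !subrr.
rewrite scalar_mx_block; congr block_mx.
(* The last corner needs E E^* + Z^* Z = 1. Here Z^* Z = E X E^* and X is the inverse of E^* E minus
   1. *)
pose N := 1%:M - A^t* *m A; pose X := A *m invmx N *m A^t*.
have Nu : N \in unitmx by rewrite /N -DE unitmx_mul Du' Du.
have EEu : E^t* *m E \in unitmx by rewrite unitmx_mul Eu' Eu.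
have XE : X *m (E^t* *m E) = 1%:M - E^t* *m E.
  rewrite /X EE -mulmxA mulmxBr mulmx1 mulmxA.
  have -> : A^t* - A^t* *m A *m A^t* = N *m A^t* by rewrite mulmxBl mul1mx.
  by rewrite mulmxA mulmxKV// subKr.
have {}XE : X = invmx (E^t* *m E) - 1%:M.
  by apply: (can_inj (mulmxK EEu)); rewrite XE mulmxBl mulVmx// mul1mx.
have -> : Z^t* *m Z = E *m X *m E^t*.
  have NE : invmx N = invmx D *m invmx (D^t*).
    apply: (can_inj (mulKmx Nu)); rewrite mulmxV// /N -DE -mulmxA.
    by rewrite [D *m _]mulmxA mulmxV// mul1mx mulmxV.
  have ZsE : Z^t* = E *m A *m invmx D.
    by apply: (can_inj (mulmxK Du)); rewrite mulmxKV.
  by rewrite ZsE /X NE /Z !mulmxA.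
rewrite XE mulmxBr mulmx1 mulmxBl addrC subrK.
apply: (can_inj (mulmxK Eu)).
by rewrite -!mulmxA mulVmx// mulmx1 mul1mx.
Qed.

End Defect.

(* The matrix [[a, e], [c, - z]] over op H is unitary. *)
Record julia_op (R : realType) (H : hilbertType R) (a a' c c' e e' z z' : op H) : Prop := JuliaOp {
  julia_adja : adjoint a a'; julia_adjc : adjoint c c';
  julia_adje : adjoint e e'; julia_adjz : adjoint z z';
  julia_l11 : a' * a + c' * c = 1; julia_l12 : a' * e = c' * z;
  julia_l21 : e' * a = z' * c; julia_l22 : e' * e + z' * z = 1;
  julia_r11 : a * a' + e * e' = 1; julia_r12 : a * c' = e * z';
  julia_r21 : c * a' = z * e'; julia_r22 : c * c' + z * z' = 1
}.

Section JuliaOp.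
Local Open Scope sesquilinear_scope.

Lemma julia_op_exists (R : realType) m (A : 'M[R[i]]_m) : spectral_norm A < 1 ->
  exists a' c c' e e' z z', julia_op (mxop A) a' c c' e e' z z'.
Proof.
move=> /julia[D [E [Z /= VV]]]; have VV' := mulmx1C VV.
have VE : (block_mx A E D (- Z))^t* = block_mx (A^t*) (D^t*) (E^t*) (- Z^t*).
  by rewrite tr_block_mx map_block_mx linearN /= map_mxN.
rewrite VE mulmx_block !mulNmx !mulmxN opprK scalar_mx_block in VV.
rewrite VE mulmx_block !mulNmx !mulmxN opprK scalar_mx_block in VV'.
have [l11 /subr0_eq l12 /subr0_eq l21 l22] := eq_block_mx VV.
have [r11 /subr0_eq r12 /subr0_eq r21 r22] := eq_block_mx VV'.
exists (mxop (A^t*)), (mxop D), (mxop (D^t*)), (mxop E), (mxop (E^t*)), (mxop Z), (mxop (Z^t*)).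
by split; rewrite -?mxopM -?mxopD ?l11 ?l12 ?l21 ?l22 ?r11 ?r12 ?r21 ?r22 ?mxop1//;
  exact: mxop_adj.
Qed.

End JuliaOp.

Section Dilation.
Context {R : realType} {H : hilbertType R} {N : nat}.
Context {a a' c c' e e' z z' : op H} (J : julia_op a a' c c' e e' z z').
Local Notation K := (hsum H N.+2).

(** The Julia operator takes coordinates 0 and max to 0 and 1, and the others are shifted up by one.
    A vector supported at 0 reaches the last coordinate only after N + 1 steps, so up to then [e]
    and [z] are not felt. *)
Definition dil_mx : 'M[op H]_N.+2 := \matrix_(i, j)
  match val i with
  | 0%N => if j == ord0 then a else if j == ord_max then e else 0
  | 1%N => if j == ord0 then c else if j == ord_max then - z else 0
  | k.+2 => if val j == k.+1 then 1 else 0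
  end.

Definition dil_adj_mx : 'M[op H]_N.+2 := \matrix_(j, i)
  match val i with
  | 0%N => if j == ord0 then a' else if j == ord_max then e' else 0
  | 1%N => if j == ord0 then c' else if j == ord_max then - z' else 0
  | k.+2 => if val j == k.+1 then 1 else 0
  end.

Definition dil : op K := blockop dil_mx.
Definition dil_adj : op K := blockop dil_adj_mx.

Lemma dil_adjoint : adjoint dil dil_adj.
Proof.
apply: blockop_adjoint => i j; rewrite !mxE.
have neg (u v : op H) : adjoint u v -> adjoint (- u) (- v).
  by move=> /(adjointB (@adjoint0 R H)); rewrite !sub0r.
case: J => ja jc je jz *.
case: (val i) => [|[|k]]; repeat case: ifP => _ //; try exact: adjoint0; exact: neg.
Qed.

Let ord1 : 'I_N.+2 := lift ord0 ord0.

Lemma dil0 g : dil g ord0 = a (g ord0) + e (g ord_max).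
Proof.
rewrite blockopE (bigD1 ord0)//= (bigD1 ord_max)//= big1 ?addr0 => [|j /andP[j0 jm]].
  by rewrite !mxE /= eqxx.
by rewrite mxE /= (negbTE j0) (negbTE jm).
Qed.

Lemma dil1 g : dil g ord1 = c (g ord0) - z (g ord_max).
Proof.
rewrite blockopE (bigD1 ord0)//= (bigD1 ord_max)//= big1 ?addr0 => [|j /andP[j0 jm]].
  by rewrite !mxE /= eqxx.
by rewrite mxE /= (negbTE j0) (negbTE jm).
Qed.

Lemma dilS g (i j : 'I_N.+2) : (0 < j)%N -> i = j.+1 :> nat -> dil g i = g j.
Proof.
case: j => [[//|j] jN] _ ij; rewrite /= in ij.
rewrite blockopE (bigD1 (Ordinal jN))//= big1 ?addr0 => [|k kj].
  by rewrite mxE /= ij eqxx.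
by rewrite mxE /= ij ifF//; apply: contra_neqF kj => /eqP kj; exact: val_inj.
Qed.

Lemma dil_adj0 g : dil_adj g ord0 = a' (g ord0) + c' (g ord1).
Proof.
rewrite blockopE (bigD1 ord0)//= (bigD1 ord1)//= big1 ?addr0 => [|j /andP[j0 j1]].
  by rewrite !mxE.
by rewrite mxE; case: j j0 j1 => [[|[|j]] jN].
Qed.

Lemma dil_adj_max g : dil_adj g ord_max = e' (g ord0) - z' (g ord1).
Proof.
rewrite blockopE (bigD1 ord0)//= (bigD1 ord1)//= big1 ?addr0 => [|j /andP[j0 j1]].
  by rewrite !mxE /= eqxx.
rewrite mxE; case: j j0 j1 => [[|[|j]] jN]//= _ _.
by rewrite ifF//; apply/negbTE; rewrite gtn_eqF//; rewrite -ltnS.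
Qed.

Lemma dil_adjS g (i j : 'I_N.+2) : (0 < j)%N -> i = j.+1 :> nat -> dil_adj g j = g i.
Proof.
move=> j0 ij; rewrite blockopE (bigD1 i)//= big1 ?addr0 => [|k ki].
  by rewrite mxE; case: j j0 ij => [[//|j] jN] _ /= ->; rewrite /= eqxx.
have iN := ltn_ord i; rewrite ij in iN.
rewrite mxE; case: k ki => [[|[|k]] kN] ki /=.
- by rewrite -!val_eqE /= gtn_eqF// ltn_eqF// -ltnS.
- by rewrite -!val_eqE /= gtn_eqF// ltn_eqF// -ltnS.
- by rewrite ifF//; apply: contra_neqF ki => /eqP jk; apply: val_inj; rewrite /= ij jk.
Qed.

Lemma ord_dil_cases (P : 'I_N.+2 -> Prop) : P ord0 -> P ord1 ->
  (forall i j : 'I_N.+2, (0 < j)%N -> i = j.+1 :> nat -> P i) -> forall i, P i.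
Proof.
move=> P0 P1 PS [[|[|i]] iN].
- by rewrite (_ : Ordinal iN = ord0)//; exact: val_inj.
- by rewrite (_ : Ordinal iN = ord1)//; exact: val_inj.
- by apply: (PS _ (Ordinal (ltnW iN))).
Qed.

(** The case split for the outputs of [dil_adj], which come from the coordinates that [dil] reads:
    0, the last one, and those shifted. *)
Lemma ord_dil_cases_max (P : 'I_N.+2 -> Prop) : P ord0 -> P ord_max ->
  (forall i j : 'I_N.+2, (0 < j)%N -> i = j.+1 :> nat -> P j) -> forall i, P i.
Proof.
move=> P0 PM PS i; have [i0|i0] := posnP i.
  by rewrite (_ : i = ord0)//; exact: val_inj.
have [im|im] := eqVneq i ord_max; first by rewrite im.
have iN : (i.+1 < N.+2)%N.
  by rewrite ltnS ltn_neqAle -val_eqE /= in im *; rewrite im -ltnS ltn_ord.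
by apply: (PS (Ordinal iN)).
Qed.

Lemma dil_left : dil_adj * dil = 1.
Proof.
have l11 x : a' (a x) + c' (c x) = x by rewrite -[LHS]/((a' * a + c' * c) x) (julia_l11 J).
have l12 x : a' (e x) = c' (z x) by rewrite -[LHS]/((a' * e) x) (julia_l12 J).
have l21 x : e' (a x) = z' (c x) by rewrite -[LHS]/((e' * a) x) (julia_l21 J).
have l22 x : e' (e x) + z' (z x) = x by rewrite -[LHS]/((e' * e + z' * z) x) (julia_l22 J).
apply: opP => g; apply: hsumP; rewrite opME op1E.
apply: ord_dil_cases_max.
- by rewrite dil_adj0 dil0 dil1 linearD linearB /= addrACA l12 subrr addr0 l11.
- by rewrite dil_adj_max dil0 dil1 linearD linearB /= l21 opprB
    [X in _ + X]addrC addrACA subrr add0r l22.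
- by move=> i j j0 ij; rewrite (dil_adjS _ j0 ij) (dilS _ j0 ij).
Qed.

Lemma dil_right : dil * dil_adj = 1.
Proof.
have r11 x : a (a' x) + e (e' x) = x by rewrite -[LHS]/((a * a' + e * e') x) (julia_r11 J).
have r12 x : a (c' x) = e (z' x) by rewrite -[LHS]/((a * c') x) (julia_r12 J).
have r21 x : c (a' x) = z (e' x) by rewrite -[LHS]/((c * a') x) (julia_r21 J).
have r22 x : c (c' x) + z (z' x) = x by rewrite -[LHS]/((c * c' + z * z') x) (julia_r22 J).
apply: opP => g; apply: hsumP; rewrite opME op1E.
apply: ord_dil_cases.
- by rewrite dil0 dil_adj0 dil_adj_max linearD linearB /= addrACA r12 subrr addr0 r11.
- by rewrite dil1 dil_adj0 dil_adj_max linearD linearB /= r21 opprB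
    [X in _ + X]addrC addrACA subrr add0r r22.
- by move=> i j j0 ij; rewrite (dilS _ j0 ij) (dil_adjS _ j0 ij).
Qed.

End Dilation.

Section DilationBound.
Context {R : realType} {d : nat}.
Local Notation C := R[i].

Lemma dilation_exists (X : polydisk R d) (N : nat) :
  exists W W' : 'I_d -> op (hsum (hsum (cline R) (pd_pred_size X).+1) N.+2),
    [/\ forall k, adjoint (W k) (W' k), forall k, W k * W' k = 1, forall k, W' k * W k = 1 &
      forall v x, (size v <= N.+1)%N ->
        word_op W v (hsum_inj ord0 x) ord0 = word_op (fun k => mxop (pd_point X k)) v x].
Proof.
have /choice[w wP] : forall k, exists w : op (hsum (hsum (cline R) (pd_pred_size X).+1) N.+2) *
    op (hsum (hsum (cline R) (pd_pred_size X).+1) N.+2),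
    [/\ adjoint w.1 w.2, w.1 * w.2 = 1, w.2 * w.1 = 1,
      forall g, g ord_max = 0 -> w.1 g ord0 = mxop (pd_point X k) (g ord0) &
      forall g (i j : 'I_N.+2), (0 < j)%N -> i = j.+1 :> nat -> w.1 g i = g j].
  move=> k; have [a' [c [c' [e [e' [z [z' J]]]]]]] := julia_op_exists (pd_lt1 X k).
  exists (@dil _ _ N (mxop (pd_point X k)) c e z, @dil_adj _ _ N a' c' e' z'); split => /=.
  - exact: (dil_adjoint J).
  - exact: (dil_right J).
  - exact: (dil_left J).
  - by move=> g g0; apply: etrans (dil0 g) _; rewrite g0 linear0 addr0.
  - by move=> g i j; exact: dilS.
exists (fun k => (w k).1), (fun k => (w k).2); split => [k|k|k|v x vN].
- by have [] := wP k.
- by have [] := wP k.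
- by have [] := wP k.
set W := fun k => _.
(* The support is tracked as well: after a word of length k it lies in the coordinates 0 to k, so
   the last one is still empty when the next letter acts. *)
suff [] : word_op W v (hsum_inj ord0 x) ord0 = word_op (fun k => mxop (pd_point X k)) v x /\
    forall i : 'I_N.+2, (size v < i)%N -> word_op W v (hsum_inj ord0 x) i = 0 by [].
elim: v vN => [|k v IH] vN.
  rewrite !word_op_nil !op1E; split => [|i i0]; rewrite /hsum_inj ?eqxx//.
  by rewrite -val_eqE /= gtn_eqF.
have [IH0 IHi] := IH (ltnW vN); have [_ _ _ w0 wS] := wP k.
rewrite !word_op_cons !opME; split.
  by rewrite w0 ?IH0// IHi.
case=> [[//|[|i]] iN] //= vi.
rewrite (wS _ _ (Ordinal (ltnW iN)))//; exact: IHi.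
Qed.

Lemma dilation_bound n (P : 'I_n -> 'I_n -> ncpoly R d) (X : polydisk R d) :
  exists (K : hilbertType R) (W W' : 'I_d -> op K),
    [/\ forall k, adjoint (W k) (W' k), forall k, W k * W' k = 1, forall k, W' k * W k = 1 &
      opnorm (polydisk_mx P X) <= opnorm (blockop (\matrix_(i, j) poly_op W (P i j)))].
Proof.
pose N := (\max_i \max_j \max_(s <- P i j) size s.2)%N.
have PN i j s : s \in P i j -> (size s.2 <= N.+1)%N.
  move=> sP; apply/leqW.
  apply: leq_trans (leq_bigmax (F := fun i => \max_j \max_(s <- P i j) size s.2)%N i).
  apply: leq_trans (leq_bigmax (F := fun j => \max_(s <- P i j) size s.2)%N j).
  exact: (leq_bigmax_seq (F := fun s => size s.2) s).
have [W [W' [Wadj W1 W2 WE]]] := dilation_exists X N.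
exists (hsum (hsum (cline R) (pd_pred_size X).+1) N.+2), W, W'; split => //.
apply: opnorm_le => [|x]; first exact: opnorm_ge0.
pose y : hsum (hsum (hsum (cline R) (pd_pred_size X).+1) N.+2) n :=
  fun j => hsum_inj ord0 (x j).
have -> : rnorm x = rnorm y.
  apply/eqP; rewrite -(eqrXn2 (n := 2)) ?rnorm_ge0// !sqr_rnorm_hsum; apply/eqP.
  by apply: eq_bigr => j _; rewrite rnorm_hsum_inj.
apply: le_trans (opnorm_ub _ _).
rewrite -(ler_pXn2r (n := 2)) ?nnegrE ?rnorm_ge0// !sqr_rnorm_hsum.
apply: ler_sum => i _; rewrite ler_pXn2r ?nnegrE ?rnorm_ge0//.
apply: le_trans (rnorm_coord_le _ ord0); rewrite le_eqVlt; apply/orP; left; apply/eqP.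
congr rnorm; rewrite !blockopE hsum_sumE; apply: eq_bigr => j _.
rewrite !mxE mxop_ncpoly !poly_opE hsum_sumE; apply: eq_big_seq => s sP.
by rewrite -[RHS]/(s.1 *: word_op W s.2 (y j) ord0) WE// (PN i j).
Qed.

End DilationBound.

(** * Unitary representations of free groups *)

Section UnitaryGroup.
Context (R : realType) (H : hilbertType R).

(* The adjoint is carried along, so that inversion needs no choice. *)
Definition unitary_pair : {pred op H * op H} :=
  fun p => `[< [/\ adjoint p.1 p.2, p.1 * p.2 = 1 & p.2 * p.1 = 1] >].

Definition unitary_group : Type := {p | p \in unitary_pair}.

HB.instance Definition _ := Choice.on unitary_group.

Lemma unitary_pairP p :
  reflect [/\ adjoint p.1 p.2, p.1 * p.2 = 1 & p.2 * p.1 = 1] (p \in unitary_pair).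
Proof. exact: asboolP. Qed.

Fact unitary_one_subproof : (1, 1) \in unitary_pair.
Proof. by apply/unitary_pairP; split; rewrite ?mulr1. Qed.

Fact unitary_inv_subproof (u : unitary_group) : ((val u).2, (val u).1) \in unitary_pair.
Proof.
case: u => p /= /unitary_pairP[pa p1 p2]; apply/unitary_pairP; split => //.
exact: adjoint_sym.
Qed.

Fact unitary_mul_subproof (u v : unitary_group) :
  ((val u).1 * (val v).1, (val v).2 * (val u).2) \in unitary_pair.
Proof.
case: u v => [p /= /unitary_pairP[pa p1 p2]] [q /= /unitary_pairP[qa q1 q2]].
apply/unitary_pairP; split => /=; first exact: adjointM.
  by rewrite mulrA -[_ * q.1 * _]mulrA q1 mulr1.
by rewrite mulrA -[_ * p.2 * _]mulrA p2 mulr1.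
Qed.

Definition unitary_one : unitary_group := exist (fun p => p \in unitary_pair) _ unitary_one_subproof.
Definition unitary_inv (u : unitary_group) : unitary_group :=
  exist (fun p => p \in unitary_pair) _ (unitary_inv_subproof u).
Definition unitary_mul (u v : unitary_group) : unitary_group :=
  exist (fun p => p \in unitary_pair) _ (unitary_mul_subproof u v).

Fact unitary_mulA : associative unitary_mul.
Proof. by move=> u v w; apply: val_inj; rewrite /= !mulrA. Qed.
Fact unitary_mul1 : left_id unitary_one unitary_mul.
Proof. by move=> [[u v] uv]; apply: val_inj; rewrite /= mul1r mulr1. Qed.
Fact unitary_1mul : right_id unitary_one unitary_mul.
Proof. by move=> [[u v] uv]; apply: val_inj; rewrite /= mul1r mulr1. Qed.
Fact unitary_mulV : left_inverse unitary_one unitary_inv unitary_mul.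
Proof. by move=> [[u v] uv]; apply: val_inj; have /unitary_pairP[/= _ _ ->] := uv. Qed.
Fact unitary_Vmul : right_inverse unitary_one unitary_inv unitary_mul.
Proof. by move=> [[u v] uv]; apply: val_inj; have /unitary_pairP[/= _ -> _] := uv. Qed.

HB.instance Definition _ := isGroup.Build unitary_group
  unitary_mulA unitary_mul1 unitary_1mul unitary_mulV unitary_Vmul.

End UnitaryGroup.

Section GroupWords.
Context {d : nat} {F : groupType} (s : 'I_d -> F).

Definition letter_val (l : 'I_d * bool) : F := if l.2 then s l.1 else ((s l.1)^-1)%g.

Definition word_val (w : seq ('I_d * bool)) : F := foldr (fun l g => letter_val l * g)%g 1%g w.

Lemma word_val_cat v w : word_val (v ++ w) = (word_val v * word_val w)%g.
Proof. by elim: v => [|l v IH] /=; rewrite ?mul1g// IH mulgA. Qed.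

Lemma letter_val_flip l : letter_val (flip l) = ((letter_val l)^-1)%g.
Proof. by case: l => k []; rewrite /letter_val //= invgK. Qed.

Lemma word_val_inv w : ((word_val w)^-1)%g = word_val (rev (map (@flip d) w)).
Proof.
elim: w => [|l w IH] /=; first by rewrite invg1.
by rewrite rev_cons -cats1 word_val_cat /= mulg1 -IH letter_val_flip invgM.
Qed.

Definition is_word_val : {pred F} := fun g => `[< exists w, g = word_val w >].

Lemma is_word_valP g : reflect (exists w, g = word_val w) (g \in is_word_val).
Proof. exact: asboolP. Qed.

Definition word_group : Type := {g | g \in is_word_val}.

HB.instance Definition _ := Choice.on word_group.

Fact word_one_subproof : 1%g \in is_word_val.
Proof. by apply/is_word_valP; exists [::]. Qed.

Fact word_inv_subproof (g : word_group) : ((val g)^-1)%g \in is_word_val.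
Proof.
case: g => g /= /is_word_valP[w ->]; apply/is_word_valP.
by rewrite word_val_inv; eexists.
Qed.

Fact word_mul_subproof (g h : word_group) : (val g * val h)%g \in is_word_val.
Proof.
case: g h => [g /= /is_word_valP[v ->]] [h /= /is_word_valP[w ->]].
by apply/is_word_valP; rewrite -word_val_cat; eexists.
Qed.

Definition word_one : word_group := exist (fun g => g \in is_word_val) _ word_one_subproof.
Definition word_inv g : word_group := exist (fun g => g \in is_word_val) _ (word_inv_subproof g).
Definition word_mul g h : word_group := exist (fun g => g \in is_word_val) _ (word_mul_subproof g h).

Fact word_mulA : associative word_mul.
Proof. by move=> g h k; apply: val_inj; rewrite /= mulgA. Qed.
Fact word_mul1 : left_id word_one word_mul.
Proof. by move=> g; apply: val_inj; rewrite /= mul1g. Qed.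
Fact word_1mul : right_id word_one word_mul.
Proof. by move=> g; apply: val_inj; rewrite /= mulg1. Qed.
Fact word_mulV : left_inverse word_one word_inv word_mul.
Proof. by move=> g; apply: val_inj; rewrite /= mulVg. Qed.
Fact word_Vmul : right_inverse word_one word_inv word_mul.
Proof. by move=> g; apply: val_inj; rewrite /= mulgV. Qed.

HB.instance Definition _ := isGroup.Build word_group
  word_mulA word_mul1 word_1mul word_mulV word_Vmul.

(** Freeness maps F into the subgroup of word values; followed by the inclusion this fixes the
    generators, so by uniqueness it is the identity. *)
Lemma free_on_word g : free_on s -> exists w, g = word_val w.
Proof.
move=> fs.
have sW k : s k \in is_word_val.
  by apply/is_word_valP; exists [:: (k, true)]; rewrite /= mulg1.
have [f [[fM fs'] _]] := fs word_group (fun k => exist (fun g => g \in is_word_val) _ (sW k)).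
have [h [_ hu]] := fs F s.
have idE : h = id by apply: hu.
have fE : h = val \o f.
  apply: hu; split => [x y|k] /=; first by rewrite fM.
  by rewrite fs'.
have -> : g = val (f g) by rewrite -[RHS]/((val \o f) g) -fE idE.
by case: (f g) => x /= /is_word_valP.
Qed.

End GroupWords.

(** * Star-polynomials and the universal representation *)

Section PolyStar.
Context {R : realType} {d : nat}.
Local Notation C := R[i].
Local Notation letter := ('I_d * bool)%type.

Definition padj (p : seq (C * seq letter)) : seq (C * seq letter) :=
  [seq ((t.1^*)%C, rev (map (@flip d) t.2)) | t <- p].

Section One.
Context {L : eqType} {H : hilbertType R} {e : L -> op H}.

Lemma word_op_cat v w : word_op e (v ++ w) = word_op e v * word_op e w.
Proof. exact: big_cat. Qed.

Lemma poly_op_cat p q : poly_op e (p ++ q) = poly_op e p + poly_op e q.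
Proof. exact: big_cat. Qed.

Lemma poly_op_scale k p : poly_op e [seq (k * t.1, t.2) | t <- p] = k *: poly_op e p.
Proof.
by rewrite /poly_op big_map scaler_sumr; apply: eq_bigr => t _; rewrite scalerA.
Qed.

Lemma poly_op_mul p q :
  poly_op e [seq (t.1 * u.1, t.2 ++ u.2) | t <- p, u <- q] = poly_op e p * poly_op e q.
Proof.
rewrite /poly_op big_allpairs_dep mulr_suml; apply: eq_bigr => t _.
rewrite mulr_sumr; apply: eq_bigr => u _.
by rewrite word_op_cat op_scalerAl op_scalerAr scalerA.
Qed.

Lemma poly_op1 : poly_op e [:: (1, [::])] = 1.
Proof. by rewrite /poly_op big_seq1 scale1r word_op_nil. Qed.

Lemma poly_op_letter l : poly_op e [:: (1, [:: l])] = e l.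
Proof. by rewrite /poly_op big_seq1 scale1r word_op_cons word_op_nil mulr1. Qed.

End One.

Lemma poly_op_adj (H : hilbertType R) (e : letter -> op H) p :
  (forall l, adjoint (e l) (e (flip l))) -> adjoint (poly_op e p) (poly_op e (padj p)).
Proof.
move=> ea; rewrite /poly_op; elim: p => [|t p IH]; first by rewrite !big_nil; exact: adjoint0.
rewrite !big_cons; apply: adjointD IH; apply: adjointZ => /=.
elim: t.2 => [|l w IHw]; first by rewrite !word_op_nil.
rewrite /= rev_cons -cats1 word_op_cat !word_op_cons word_op_nil mulr1.
exact: adjointM.
Qed.

Definition poly_graph (K H : hilbertType R) (e1 : letter -> op K) (e2 : letter -> op H)
  (a : op K) (b : op H) : Prop := exists p, a = poly_op e1 p /\ b = poly_op e2 p.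

Lemma star_rel_poly (K H : hilbertType R) (e1 : letter -> op K) (e2 : letter -> op H) :
  (forall l, adjoint (e1 l) (e1 (flip l))) -> (forall l, adjoint (e2 l) (e2 (flip l))) ->
  star_rel (poly_graph e1 e2).
Proof.
move=> ea1 ea2; split.
- by exists [:: (1, [::])]; rewrite !poly_op1.
- move=> k _ _ _ _ [p [-> ->]] [q [-> ->]].
  by exists ([seq (k * t.1, t.2) | t <- p] ++ q); rewrite !poly_op_cat !poly_op_scale.
- move=> _ _ _ _ [p [-> ->]] [q [-> ->]].
  by exists [seq (t.1 * u.1, t.2 ++ u.2) | t <- p, u <- q]; rewrite !poly_op_mul.
- move=> _ _ a' b' [p [-> ->]] aa bb; exists (padj p); split.
    exact: adjoint_uniq aa (poly_op_adj _ ea1).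
  exact: adjoint_uniq bb (poly_op_adj _ ea2).
Qed.

Definition star_embed (p : ncpoly R d) : seq (C * seq letter) :=
  [seq (t.1, [seq (k, true) | k <- t.2]) | t <- p].

Lemma poly_op_star_embed (H : hilbertType R) (e : letter -> op H) p :
  poly_op e (star_embed p) = poly_op (fun k => e (k, true)) p.
Proof.
rewrite /poly_op big_map; apply: eq_bigr => t _; congr (_ *: _).
by rewrite /word_op big_map.
Qed.

End PolyStar.

Section Universal.
Context {R : realType} {d : nat} {F : groupType} {s : 'I_d -> F}.
Context {H : hilbertType R} {U : F -> op H}.
Local Notation C := R[i].

Definition rep_letter (V : hilbertType R) (W : F -> op V) (l : 'I_d * bool) : op V :=
  W (letter_val s l).

Lemma rep_word (V : hilbertType R) (W : F -> op V) w : unitary_rep W ->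
  word_op (rep_letter W) w = W (word_val s w).
Proof.
move=> [W1 WM _]; elim: w => [|l w IH]; first by rewrite word_op_nil W1.
by rewrite word_op_cons IH /= WM.
Qed.

(** Different words may have the same value in F, so their coefficients are added and each group
    element is listed once. The list and coefficients do not depend on W, as the comparison of norms
    requires. *)
Lemma rep_poly (V : hilbertType R) (W : F -> op V) (q : seq (C * seq ('I_d * bool))) :
  unitary_rep W -> poly_op (rep_letter W) q =
  group_alg_eval W (undup [seq word_val s t.2 | t <- q])
    (fun g => \sum_(t <- q | word_val s t.2 == g) t.1).
Proof.
move=> Wr; rewrite /poly_op /group_alg_eval.
under [RHS]eq_bigr do rewrite scaler_suml big_mkcond.
rewrite exchange_big /=; apply: eq_big_seq => t tq.
rewrite (bigD1_seq (word_val s t.2)) ?undup_uniq ?mem_undup//=; last first.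
  exact: (map_f (fun t => word_val s t.2)).
rewrite eqxx big1 ?addr0 ?rep_word// => g gt.
by rewrite eq_sym (negbTE gt).
Qed.

Lemma rep_letter_adj (V : hilbertType R) (W : F -> op V) : unitary_rep W ->
  forall l, adjoint (rep_letter W l) (rep_letter W (flip l)).
Proof.
move=> [W1 WM Wu] l; rewrite /rep_letter letter_val_flip.
have [v [wv w1 w2]] := Wu (letter_val s l).
suff -> : W ((letter_val s l)^-1)%g = v by [].
rewrite -[LHS]mul1r -w2 -mulrA -WM mulgV W1 mulr1//.
Qed.

Lemma rep_letter_unitary (V : hilbertType R) (W : F -> op V) : unitary_rep W ->
  forall l, rep_letter W l * rep_letter W (flip l) = 1.
Proof. by move=> [W1 WM _] l; rewrite /rep_letter letter_val_flip -WM mulgV. Qed.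

Hypotheses (fs : free_on s) (univ : universal_rep U).

(** Freeness extends any tuple of unitaries to a representation of F, with which U is compared. *)
Lemma universal_letters (K : hilbertType R) (W W' : 'I_d -> op K) q :
  (forall k, adjoint (W k) (W' k)) -> (forall k, W k * W' k = 1) ->
  (forall k, W' k * W k = 1) ->
  opnorm (poly_op (fun l => if l.2 then W l.1 else W' l.1) q) <=
  opnorm (poly_op (rep_letter U) q).
Proof.
move=> Wa W1 W2.
have WP k : (W k, W' k) \in @unitary_pair R K.
  by apply/unitary_pairP; split; [exact: Wa|exact: W1|exact: W2].
have [f [[fM fE] _]] := fs
  (fun k => exist (fun p => p \in @unitary_pair R K) _ (WP k) : unitary_group K).
have f1 : f 1%g = 1%g by apply: (mulgI (f 1%g)); rewrite -fM !mulg1.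
have fV g : f (g^-1)%g = ((f g)^-1)%g.
  by apply: (mulgI (f g)); rewrite -fM !mulgV f1.
pose V g := (val (f g)).1.
have Vr : unitary_rep V.
  split; first by rewrite /V f1.
    by move=> g h; rewrite /V fM.
  by move=> g; have /unitary_pairP[a b c] := valP (f g); exists (val (f g)).2.
have -> : (fun l : 'I_d * bool => if l.2 then W l.1 else W' l.1) = rep_letter V.
  apply/funext => -[k b]; rewrite /rep_letter /V /letter_val /=.
  by case: b; rewrite ?fV fE.
case: univ => Ur Umax.
by rewrite !rep_poly//; exact: Umax.
Qed.

Lemma polydisk_le_universal n (P : 'I_n -> 'I_n -> ncpoly R d) (X : polydisk R d) :
  opnorm (polydisk_mx P X) <=
  opnorm (blockop (\matrix_(i, j) poly_op (fun k => U (s k)) (P i j))).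
Proof.
have [K [W [W' [Wa W1 W2 XW]]]] := dilation_bound P X.
apply: le_trans XW _.
pose eW (l : 'I_d * bool) := if l.2 then W l.1 else W' l.1.
have Ur : unitary_rep U by case: univ.
have eWa l : adjoint (eW l) (eW (flip l)).
  by case: l => k []; rewrite /eW //=; exact: adjoint_sym.
apply: (star_rel_cc (star_rel_poly (rep_letter_adj Ur) eWa)).
  by move=> _ _ [q [-> ->]]; exact: universal_letters.
by move=> i j; exists (star_embed (P i j)); rewrite !mxE !poly_op_star_embed.
Qed.

End Universal.

(** * The polydisk algebra *)

Section BlockMatrixNorm.
Context {R : realType} {m n : nat}.
Local Notation C := R[i].

Lemma sum_Rank (V : nmodType) (f : 'I_(\sum_(i < n) m)%N -> V) :
  \sum_s f s = \sum_i \sum_j f (tagnat.Rank i j).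
Proof.
rewrite (reindex _ (@tagnat.rank_bij_on n (fun=> m))) /=.
rewrite (sig_big_dep _ _ (fun i j => f (tagnat.Rank i j))) /=.
by apply: eq_bigr => p _; rewrite tagnat.rankE.
Qed.

Lemma mxblockE (B : 'I_n -> 'I_n -> 'M[C]_m) i j a b :
  (\mxblock_(i < n, j < n) B i j) (tagnat.Rank i a) (tagnat.Rank j b) = B i j a b.
Proof. by rewrite -[in RHS](mxblockK (fun i j => B i j)) [RHS]mxE. Qed.

Lemma spectral_norm_mxblock (B : 'I_n -> 'I_n -> 'M[C]_m) :
  spectral_norm (\mxblock_(i < n, j < n) B i j) =
  opnorm (blockop (\matrix_(i, j) mxop (B i j))).
Proof.
rewrite spectral_normE; set M := \mxblock_(i, j) _; set BB := blockop _.
pose split_ (x : hsum (cline R) (\sum_(i < n) m)%N) : hsum (hsum (cline R) m) n :=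
  fun j b => x (tagnat.Rank j b).
have split_norm x : rnorm (split_ x) = rnorm x.
  apply/eqP; rewrite -(eqrXn2 (n := 2)) ?rnorm_ge0// !sqr_rnorm_hsum sum_Rank.
  by apply/eqP; apply: eq_bigr => j _; rewrite sqr_rnorm_hsum.
have split_act x : split_ (mxop M x) = BB (split_ x).
  apply: hsumP => i; apply: hsumP => a.
  rewrite blockopE hsum_sumE -[LHS]/(mxop M x (tagnat.Rank i a)) mxopE sum_Rank.
  apply: eq_bigr => j _; rewrite mxE mxopE.
  by apply: eq_bigr => b _; rewrite mxblockE.
apply/le_anti/andP; split; apply: opnorm_le => [|x]; try exact: opnorm_ge0.
  by rewrite -split_norm split_act -[rnorm x]split_norm opnorm_ub.
pose y : hsum (cline R) (\sum_(i < n) m)%N := fun s => x (tagnat.sig1 s) (tagnat.sig2 s).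
have -> : x = split_ y.
  apply: hsumP => j; apply: hsumP => b; rewrite /split_ /y.
  rewrite /tagnat.sig2 /tagnat.sig1 /tagnat.Rank.
  by rewrite tagnat.rankK.
by rewrite -split_act !split_norm opnorm_ub.
Qed.

End BlockMatrixNorm.

Lemma opnorm_blockop1 (R : realType) (V : hilbertType R) (a : 'M[op V]_1) :
  opnorm (blockop a) = opnorm (a ord0 ord0).
Proof.
apply/le_anti; rewrite entry_norm_le andbT.
by have := blockop_norm_le a; rewrite !big_ord1.
Qed.

(** It brings the limits given by [op_limit] back to matrices. *)
Lemma mxop_surj (R : realType) m (b : op (hsum (cline R) m)) : exists A, mxop A = b.
Proof.
pose u j : hsum (cline R) m := hsum_inj (H := cline R) j (1 : R[i]).
exists (\matrix_(i, j) (b (u j) i : R[i])); apply: opP => x.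
have -> : x = \sum_j (x j : R[i]) *: u j.
  apply: hsumP => i; rewrite hsum_sumE (bigD1 i)//= big1 => [|j ji].
    by rewrite addr0 -[RHS]/(x i * (if i == i then 1 else 0)) eqxx mulr1.
  by rewrite -[LHS]/(x j * (if i == j then 1 else 0)) eq_sym (negbTE ji) mulr0.
rewrite !linear_sum; apply: eq_bigr => j _; rewrite !linearZ; congr (_ *: _).
apply: hsumP => i; apply: etrans (mxopE _ _ _) _; rewrite (bigD1 j)//= big1 => [|k kj].
  by rewrite mxE /u /hsum_inj eqxx mulr1 addr0.
by rewrite /u /hsum_inj (negbTE kj) mulr0.
Qed.

Section PolydiskAlgebra.
Context {R : realType} {d : nat} {H : hilbertType R} {e : 'I_d -> op H}.
Hypotheses (e1 : forall k, opnorm (e k) <= 1)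
  (eX : forall n (P : 'I_n -> 'I_n -> ncpoly R d) X,
    opnorm (polydisk_mx P X) <= opnorm (blockop (\matrix_(i, j) poly_op e (P i j)))).
Local Notation C := R[i].

Lemma poly_op_le (p : ncpoly R d) (N : R) :
  (forall X, spectral_norm (ncpoly_fun p X) <= N) -> opnorm (poly_op e p) <= N.
Proof.
move=> pN; have := @compression_bound R d H e e1 1 (fun _ _ => p) N.
rewrite opnorm_blockop1 mxE; apply=> X.
by rewrite /polydisk_mx opnorm_blockop1 mxE -spectral_normE.
Qed.

Lemma ncpoly_fun_le (p : ncpoly R d) X : spectral_norm (ncpoly_fun p X) <= opnorm (poly_op e p).
Proof.
have := @eX 1 (fun _ _ => p) X.
by rewrite /polydisk_mx !opnorm_blockop1 !mxE -spectral_normE.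
Qed.

Definition poly_sub (p q : ncpoly R d) : ncpoly R d := [seq (-1 * t.1, t.2) | t <- q] ++ p.

Lemma ncpoly_fun_sub p q : ncpoly_fun (poly_sub p q) = ncpoly_fun p - ncpoly_fun q.
Proof. by rewrite ncpoly_funD ncpoly_funZ scaleN1r addrC. Qed.

Lemma poly_op_sub p q : poly_op e (poly_sub p q) = poly_op e p - poly_op e q.
Proof. by rewrite poly_op_cat poly_op_scale scaleN1r addrC. Qed.

(* [calculus f a] reads a = f(e). *)
Definition calculus (f : ncfun R d) (a : op H) : Prop := forall r : R, 0 < r ->
  exists p : ncpoly R d, (forall X, spectral_norm (f X - ncpoly_fun p X) <= r) /\
    opnorm (a - poly_op e p) <= r.

Lemma calculus_poly p : calculus (ncpoly_fun p) (poly_op e p).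
Proof.
by move=> r r0; exists p; split => [X|]; rewrite subrr ?spectral_norm0 ?opnorm0 ltW.
Qed.

Lemma spectral_normC m (A B : 'M[C]_m) : spectral_norm (A - B) = spectral_norm (B - A).
Proof. by rewrite !spectral_normE !mxopB opnormC. Qed.

Lemma spectral_norm_triangle m (B A D : 'M[C]_m) :
  spectral_norm (A - D) <= spectral_norm (A - B) + spectral_norm (B - D).
Proof. by rewrite !spectral_normE !mxopB opnorm_triangle. Qed.

Lemma calculus_exists f : f \in @in_ncA R d -> exists a, calculus f a.
Proof.
move=> /in_ncAP fA.
pose S r a := exists2 p, a = poly_op e p & forall X, spectral_norm (f X - ncpoly_fun p X) <= r.
have [||a aS] := @op_limit R H S.
- by move=> r /fA[p pf]; exists (poly_op e p), p.
- move=> r t a b r0 t0 [p -> pf] [q -> qf]; rewrite -poly_op_sub; apply: poly_op_le => X.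
  rewrite ncpoly_fun_sub; apply: le_trans (spectral_norm_triangle (f X) _ _) _.
  by rewrite spectral_normC lerD.
exists a => r r0; have [p pf] := fA _ r0; exists p; split => //.
by rewrite opnormC; apply: aS => //; exists p.
Qed.

(** Evaluation at X is contractive for the norm of p(e), so polynomials that approximate a converge
    at every point of the polydisk, uniformly. *)
Lemma calculus_onto a : (forall r : R, 0 < r -> exists p, opnorm (a - poly_op e p) <= r) ->
  exists2 f, f \in @in_ncA R d & calculus f a.
Proof.
move=> aP.
have lim X : exists A, forall r p, 0 < r -> opnorm (a - poly_op e p) <= r ->
    spectral_norm (A - ncpoly_fun p X) <= r.
  pose S r b := exists2 p, b = mxop (ncpoly_fun p X) & opnorm (a - poly_op e p) <= r.
  have [||b bS] := @op_limit R _ S.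
  - by move=> r /aP[p pa]; exists (mxop (ncpoly_fun p X)), p.
  - move=> r t b c r0 t0 [p -> pa] [q -> qa].
    rewrite -mxopB -spectral_normE -[X in spectral_norm X]/((ncpoly_fun p - ncpoly_fun q) X).
    rewrite -ncpoly_fun_sub; apply: le_trans (ncpoly_fun_le _ _) _; rewrite poly_op_sub.
    by apply: le_trans (opnorm_triangle a _ _) _; rewrite opnormC lerD.
  have [A AE] := mxop_surj b; exists A => r p r0 pa.
  by rewrite spectral_normC spectral_normE mxopB AE; apply: bS => //; exists p.
pose f : ncfun R d := fun X => sval (cid (lim X)).
have fP X r p : 0 < r -> opnorm (a - poly_op e p) <= r ->
    spectral_norm (f X - ncpoly_fun p X) <= r.
  by move=> r0 pa; exact: (svalP (cid (lim X)) r p r0 pa).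
exists f.
  by apply/in_ncAP => r r0; have [p pa] := aP _ r0; exists p => X; exact: fP.
by move=> r r0; have [p pa] := aP _ r0; exists p; split => // X; exact: fP.
Qed.

Lemma calculus_fun f a b : calculus f a -> calculus f b -> a = b.
Proof.
move=> fa fb; apply/eqP; rewrite -subr_eq0; apply/eqP/opnorm_small => r r0.
have r4 : 0 < r / 4 by rewrite divr_gt0.
have [[p [pf pa]] [q [qf qb]]] := (fa _ r4, fb _ r4).
have pq : opnorm (poly_op e p - poly_op e q) <= r / 4 + r / 4.
  rewrite -poly_op_sub; apply: poly_op_le => X; rewrite ncpoly_fun_sub.
  apply: le_trans (spectral_norm_triangle (f X) _ _) _.
  by rewrite spectral_normC lerD.
have := opnorm_triangle (poly_op e p) a b.
have := opnorm_triangle (poly_op e q) (poly_op e p) b.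
rewrite opnormC in qb; lra.
Qed.

Lemma calculusP k f g a b : calculus f a -> calculus g b -> calculus (k *: f + g) (k *: a + b).
Proof.
move=> fa gb r r0; have k0 : 0 < rnorm k + 1 by rewrite ltr_wpDl ?rnorm_ge0.
have [p [pf pa]] := fa _ (divr_gt0 (divr_gt0 r0 (ltr0n R 2)) k0).
have [q [qg qb]] := gb _ (divr_gt0 r0 (ltr0n R 2)).
have est x y : x <= r / 2 / (rnorm k + 1) -> y <= r / 2 -> 0 <= x ->
    rnorm k * x + y <= r.
  by rewrite ler_pdivlMr// => *; have := rnorm_ge0 k; lra.
exists ([seq (k * t.1, t.2) | t <- p] ++ q); split => [X|].
  rewrite ncpoly_funD ncpoly_funZ spectral_normE.
  rewrite -[X in mxop X]/(k *: f X + g X - (k *: ncpoly_fun p X + ncpoly_fun q X)).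
  rewrite mxopB !mxopD !mxopZ; apply: le_trans (opnorm_approxP _ _ _ _ _) _.
  by rewrite -!mxopB -!spectral_normE; apply: est; rewrite ?spectral_norm_ge0.
rewrite poly_op_cat poly_op_scale; apply: le_trans (opnorm_approxP _ _ _ _ _) _.
by apply: est; rewrite ?opnorm_ge0.
Qed.

Lemma calculusM f g a b : ncbounded f -> ncbounded g ->
  calculus f a -> calculus g b -> calculus (f * g) (a * b).
Proof.
move=> /ncbounded_ge0[Mf Mf0 fM] /ncbounded_ge0[Mg Mg0 gM] fa gb r r0.
pose M := Mf + Mg + opnorm a + opnorm b.
have := opnorm_ge0 a; have := opnorm_ge0 b => b0 a0.
have M0 : 0 <= M by rewrite /M; lra.
pose t := Num.min 1 (r / (2 * M + 1)).
have t0 : 0 < t by rewrite lt_min ltr01 divr_gt0//; lra.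
have t1 : t <= 1 by rewrite ge_min lexx.
have tr : t * (2 * M + 1) <= r.
  by rewrite -ler_pdivlMr; [rewrite ge_min lexx orbT|lra].
have [p [pf pa]] := fa _ t0; have [q [qg qb]] := gb _ t0.
exists [seq (x.1 * y.1, x.2 ++ y.2) | x <- p, y <- q]; split => [X|].
  rewrite ncpoly_funM spectral_normE.
  rewrite -[X in mxop X]/(f X *m g X - ncpoly_fun p X *m ncpoly_fun q X).
  rewrite mxopB !mxopM; apply: le_trans (opnorm_approxM t1 _ _ _ _) tr.
  - by rewrite -spectral_normE (le_trans (fM X))// /M; lra.
  - by rewrite -spectral_normE (le_trans (gM X))// /M; lra.
  - by rewrite -mxopB -spectral_normE.
  - by rewrite -mxopB -spectral_normE.
by rewrite poly_op_mul; apply: le_trans (opnorm_approxM t1 _ _ pa qb) tr; rewrite /M; lra.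
Qed.

Lemma calculus1 : calculus 1 1.
Proof.
have := calculus_poly [:: (1, [::])]; rewrite poly_op1.
by rewrite /ncpoly_fun big_seq1 big_nil scale1r.
Qed.

Lemma calculus_coord k : calculus (nccoord k) (e k).
Proof. by have := calculus_poly [:: (1, [:: k])]; rewrite poly_op_letter -nccoordE. Qed.

Lemma blockop_mx_approx (V : hilbertType R) n (a b : 'M[op V]_n) (r : R) :
  (forall i j, opnorm (a i j - b i j) <= r) ->
  opnorm (blockop a) <= opnorm (blockop b) + n%:R * n%:R * r.
Proof.
move=> ab; rewrite -(subrK b a) blockopD addrC; apply: le_trans (opnormD _ _) _.
rewrite lerD2l; apply: le_trans (blockop_norm_le _) _.
apply: (@le_trans _ _ (\sum_(i < n) \sum_(j < n) r)).
  by do 2![apply: ler_sum => ? _]; rewrite !mxE.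
by rewrite !sumr_const !card_ord -mulrA !mulr_natl.
Qed.

(** Approximating each entry within r changes all matrix norms by at most n^2 r. For polynomials one
    inequality is [eX] and the other [compression_bound]. *)
Lemma calculus_norm n (F : 'M[ncA R d]_n) (a : 'M[op H]_n) :
  (forall i j, calculus (F i j) (a i j)) -> opmxnorm a = ncA_mxnorm n F.
Proof.
move=> Fa; rewrite opmxnormE.
pose FX X := opnorm (blockop (\matrix_(i, j) mxop (ncA_fun (F i j) X))).
have approx r : 0 < r -> exists P : 'I_n -> 'I_n -> ncpoly R d,
    [/\ forall X, FX X <= opnorm (polydisk_mx P X) + n%:R * n%:R * r,
        forall X, opnorm (polydisk_mx P X) <= FX X + n%:R * n%:R * r,
        opnorm (blockop a) <= opnorm (blockop (\matrix_(i, j) poly_op e (P i j))) + n%:R * n%:R * r &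
        opnorm (blockop (\matrix_(i, j) poly_op e (P i j))) <= opnorm (blockop a) + n%:R * n%:R * r].
  move=> r0; have /choice[P PP] : forall ij : 'I_n * 'I_n, exists p : ncpoly R d,
      (forall X, spectral_norm (ncA_fun (F ij.1 ij.2) X - ncpoly_fun p X) <= r) /\
      opnorm (a ij.1 ij.2 - poly_op e p) <= r by move=> ij; exact: Fa.
  exists (fun i j => P (i, j)); split => [X|X||]; apply: blockop_mx_approx => i j;
    rewrite !mxE ?[opnorm (mxop (ncpoly_fun _ _) - _)]opnormC
      ?[opnorm (poly_op _ _ - _)]opnormC -?mxopB -?spectral_normE;
    by have [] := PP (i, j).
have small (x y : R) : (forall r, 0 < r -> x <= y + 2 * (n%:R * n%:R * r)) -> x <= y.
  move=> h; apply/ler_addgt0Pr => t t0.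
  have N0 : 0 <= n%:R * n%:R :> R by rewrite mulr_ge0.
  have := h (t / 2 / (n%:R * n%:R + 1)).
  have N1 : 0 < n%:R * n%:R + 1 :> R by lra.
  rewrite !divr_gt0// => /(_ isT); set q := t / 2 / _.
  have : q * (n%:R * n%:R + 1) = t / 2 by rewrite divfK// gt_eqF.
  have : 0 < q by rewrite !divr_gt0.
  lra.
have FXa X : FX X <= opnorm (blockop a).
  apply: small => r r0; have [P [h1 _ _ h4]] := approx _ r0.
  have := h1 X; have := eX P X; lra.
have -> : ncA_mxnorm n F = sup [set FX X | X in [set: polydisk R d]].
  congr sup; apply/seteqP; split => _ [X _ <-]; exists X => //=;
  by rewrite spectral_norm_mxblock.
have ub : has_ubound [set FX X | X in [set: polydisk R d]].
  by exists (opnorm (blockop a)) => _ [X _ <-].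
apply/le_anti/andP; split; last first.
  by apply: ge_sup; [exists (FX (disk0 R d)), (disk0 R d)|move=> _ [X _ <-]].
set N := sup _; have FN X : FX X <= N by apply: ub_le_sup => //; exists X.
apply: small => r r0; have [P [_ h2 h3 _]] := approx _ r0.
have := compression_bound e1 (P := P) (N := N + n%:R * n%:R * r).
have hP X : opnorm (polydisk_mx P X) <= N + n%:R * n%:R * r.
  by apply: le_trans (h2 X) _; rewrite lerD2r.
move=> /(_ hP); lra.
Qed.

End PolydiskAlgebra.

Section CompletelyIsometric.
Context {R : realType} {d : nat} {K : hilbertType R} {j : ncA R d -> op K}.
Hypothesis (jh : completely_isometric_hom ncA_mxnorm j).
Local Notation C := R[i].

Let j_lin : linear j. Proof. by case: jh. Qed.
Let jL : {linear ncA R d -> op K} :=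
  HB.pack j (GRing.isLinear.Build C (ncA R d) (op K) *:%R j j_lin).

Lemma hom_one : j 1 = 1. Proof. by case: jh => _ []. Qed.
Lemma homM f g : j (f * g) = j f * j g. Proof. by case: jh => _ []. Qed.
Lemma homB f g : j (f - g) = j f - j g. Proof. exact: (linearB jL). Qed.

Lemma hom_norm_le (f : ncA R d) (N : R) :
  (forall X, spectral_norm (ncA_fun f X) <= N) -> opnorm (j f) <= N.
Proof.
move=> fN; case: jh => _ _ jn.
pose F : 'M[ncA R d]_1 := const_mx f.
have -> : opnorm (j f) = opmxnorm (map_mx j F).
  by rewrite opmxnormE opnorm_blockop1 !mxE.
rewrite jn; apply: ge_sup; first by eexists; exists (disk0 R d).
move=> _ [X _ <-]; rewrite spectral_norm_mxblock opnorm_blockop1 !mxE.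
by rewrite -spectral_normE.
Qed.

Definition ncA_poly (p : ncpoly R d) : ncA R d := NcA (ncpoly_in_ncA p).

Lemma hom_poly p : j (ncA_poly p) = poly_op (fun k => j (ncA_coord k)) p.
Proof.
have wE w : exists2 f : ncA R d, ncA_fun f = \prod_(k <- w) nccoord k &
    j f = word_op (fun k => j (ncA_coord k)) w.
  elim: w => [|k w [f fE jf]]; first by exists 1; rewrite ?hom_one ?word_op_nil ?big_nil.
  exists (ncA_coord k * f); last by rewrite homM jf word_op_cons.
  by rewrite big_cons -fE.
elim: p => [|t p IH].
  have -> : ncA_poly [::] = 0 by apply: val_inj; rewrite /= /ncpoly_fun big_nil.
  by rewrite /poly_op big_nil; exact: (linear0 jL).
have [f fE jf] := wE t.2.
have -> : ncA_poly (t :: p) = t.1 *: f + ncA_poly p.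
  by apply: val_inj; rewrite /= /ncpoly_fun big_cons -fE.
by rewrite j_lin IH jf /poly_op big_cons.
Qed.

Lemma hom_approx (f : ncA R d) (p : ncpoly R d) (r : R) :
  (forall X, spectral_norm (ncA_fun f X - ncpoly_fun p X) <= r) ->
  opnorm (j f - poly_op (fun k => j (ncA_coord k)) p) <= r.
Proof. by move=> fp; rewrite -hom_poly -homB; exact: hom_norm_le. Qed.

Lemma hom_coord_contr k : opnorm (j (ncA_coord k)) <= 1.
Proof. by apply: hom_norm_le => X; exact/ltW/pd_lt1. Qed.

Lemma hom_calculus (f : ncA R d) : calculus (e := fun k => j (ncA_coord k)) f (j f).
(* Approximation by polynomials forces the form of [j]: it is the calculus at the images of the
   coordinates. Uniqueness of the isomorphism follows. *)
Proof.
move=> r r0; case: f => f fA; move/in_ncAP: (fA) => /(_ _ r0)[p fp].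
by exists p; split => //; exact: hom_approx.
Qed.

End CompletelyIsometric.

(** * The C*-envelope *)

Section Envelope.
Context {R : realType} {d : nat} {F : groupType} {s : 'I_d -> F}.
Context {H : hilbertType R} {U : F -> op H}.
Hypotheses (fs : free_on s) (Ur : unitary_rep U).
Context {phi : ncA R d -> op H}.
Hypotheses (phih : completely_isometric_hom ncA_mxnorm phi)
  (phiE : forall k, phi (ncA_coord k) = U (s k)).
Context {K : hilbertType R} {j : ncA R d -> op K}.
Hypothesis (jh : completely_isometric_hom ncA_mxnorm j).
Local Notation C := R[i].

Context {T' : 'I_d -> op K}.
Hypothesis (Tadj : forall k, adjoint (j (ncA_coord k)) (T' k)).

Let eT (l : 'I_d * bool) : op K := if l.2 then j (ncA_coord l.1) else T' l.1.
Let eU : 'I_d * bool -> op H := rep_letter (s := s) U.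
Let B := cstar_gen (range j).
Let G := poly_graph eT eU.

Let eTadj l : adjoint (eT l) (eT (flip l)).
Proof. by case: l => k []; rewrite /eT //=; exact: adjoint_sym. Qed.

(** Used twice: for the zero ideal it gives contractivity of q(T) |-> q(U), and for a boundary ideal
    it shows that this map kills the ideal. *)
Lemma rigidity (I : set (op K)) q b :
  (forall k a, I a -> I (k *: a)) -> (forall a a', I a -> I a' -> I (a + a')) ->
  (forall a a' : op K, I a -> adjoint a a' -> I (a' * a)) ->
  (forall n (f : 'M[ncA R d]_n) (a : 'M[op K]_n), (forall i k, I (a i k)) ->
    opmxnorm (map_mx j f) <= opmxnorm (map_mx j f + a)) ->
  I b -> opnorm (poly_op eU q) <= opnorm (poly_op eT q + b).
Proof.
move=> IZ ID IM In Ib.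
have [n [w [r [p [h [wr w_nil w_cons wh]]]]]] := suffix_family (map snd q).
have [b' bb] := adjoint_exists b.
case: (phih) => phil phim phin; case: (jh) => jl jm jn.
apply: (@rigidity_estimate R d (ncA R d) K H j phi ncA_coord eT eU jl phil
  (hom_one jh) (hom_one phih) _ _ eTadj _ _ _ n w r p wr w_nil w_cons I q b b' h) => //.
- exact: rep_letter_adj.
- by move=> k; exact: hom_coord_contr.
- exact: rep_letter_unitary.
- by move=> f a Ia; rewrite phin -jn; exact: In.
- exact: IM.
Qed.

Let sG : star_rel G.
Proof. by apply: star_rel_poly => //; exact: rep_letter_adj. Qed.

Let cG : contractive G.
Proof.
move=> _ _ [q [-> ->]]; rewrite -[poly_op eT q]addr0.
apply: (@rigidity [set 0]) => //=.
- by move=> k _ ->; rewrite scaler0.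
- by move=> _ _ -> ->; rewrite addr0.
- by move=> _ a' -> _; rewrite mulr0.
- by move=> n f a a0; have -> : a = 0 by [apply/matrixP => i k; rewrite a0 mxE]; rewrite addr0.
Qed.

Let Gc := closure_rel G.
Let sGc : star_rel Gc := star_rel_closure sG.
Let cGc : contractive Gc := contractive_closure cG.
Let Gc_fun b a a' : Gc b a -> Gc b a' -> a = a' := @closure_rel_fun _ _ _ _ sG cG b a a'.

Let Gc_hom f : Gc (j f) (phi f).
Proof.
move=> r r0; case: f => f fA; move/in_ncAP: (fA) => /(_ _ r0)[p fp].
exists (poly_op eT (star_embed p)), (poly_op eU (star_embed p)).
rewrite !poly_op_star_embed; split; first by exists (star_embed p); rewrite !poly_op_star_embed.
  exact: (hom_approx jh).
have -> : (fun k => eU (k, true)) = (fun k => phi (ncA_coord k)).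
  by apply/funext => k; rewrite phiE.
exact: (hom_approx phih).
Qed.

Lemma cstar_poly (V : hilbertType R) (S : set (op V)) (e : 'I_d * bool -> op V) q :
  cstar_algebra S -> (forall l, S (e l)) -> S (poly_op e q).
Proof.
move=> [[[S0 SP] S1 SM Scl] Sadj] Se; elim: q => [|t q IH].
  by rewrite /poly_op big_nil.
rewrite /poly_op big_cons; apply: SP => //.
by elim: t.2 => [|l w IHw]; rewrite ?word_op_nil ?word_op_cons//; exact: SM.
Qed.

Let closed_limit (V : hilbertType R) (S : set (op V)) a :
  norm_closed S -> (forall r : R, 0 < r -> exists2 b, S b & opnorm (a - b) <= r) -> S a.
Proof.
move=> Scl h; apply: Scl => r r0; have [b Sb ab] := h _ (divr_gt0 r0 (ltr0n R 2)).
by exists b => //; apply: le_lt_trans ab _; rewrite ltr_pdivrMr//; lra.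
Qed.

Let cstar_smallest (V : hilbertType R) (S : set (op V)) : cstar_algebra (cstar_gen S).
Proof.
split; [split|].
- split; first by move=> A [[[[]]]].
  by move=> k a b Sa Sb A AS; have [[[[_ +] _ _ _] _] _] := AS; apply; [exact: Sa|exact: Sb].
- by move=> A [[[_ +]]].
- by move=> a b Sa Sb A AS; have [[[_ _ + _] _] _] := AS; apply; [exact: Sa|exact: Sb].
- move=> a h A AS; have [[[_ _ _ +] _] _] := AS; apply => r /h[b Sb ab].
  by exists b => //; exact: Sb.
- move=> a b Sa ab A AS; have [[_ +] _] := AS; apply; [exact: (Sa _ AS)|exact: ab].
Qed.

Let gen_sub (V : hilbertType R) (S : set (op V)) a : S a -> cstar_gen S a.
Proof. by move=> Sa A [_]; exact. Qed.

(** The domain of the closed relation is itself a C*-algebra containing the range of [j], and its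
    elements are limits of *-polynomials in T. *)
Let domP b : B b <-> exists a, Gc b a.
Proof.
split; last first.
  move=> [a ab]; have BC := cstar_smallest (range j).
  have [[_ _ _ Bcl] Badj] := BC; apply: closed_limit => // r r0.
  have [_ [_ [[q [-> ->]] bq _]]] := ab _ r0; exists (poly_op eT q) => //.
  apply: cstar_poly => // -[k [|]]; rewrite /eT /=; first by apply: gen_sub; exists (ncA_coord k).
  by apply: Badj (Tadj k); apply: gen_sub; exists (ncA_coord k).
move=> Bb; apply: (Bb [set b | exists a, Gc b a]).
split; last by move=> _ [f _ <-]; exists (phi f); exact: Gc_hom.
split; [split|].
- split; first by exists 0; exact: (star_rel0 sGc).
  by move=> k a b' [x ax] [y by_]; exists (k *: x + y); exact: (star_relP sGc).
- by exists 1; exact: (star_rel1 sGc).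
- by move=> a b' [x ax] [y by_]; exists (x * y); exact: (star_relM sGc).
- move=> a h; apply: closure_rel_dom => // r r0.
  have [c [x cx] ac] := h _ (divr_gt0 r0 (ltr0n R 2)).
  have [c' [x' [G' cc _]]] := cx _ (divr_gt0 r0 (ltr0n R 2)).
  exists c', x'; split => //; apply: le_trans (opnorm_triangle c _ _) _; lra.
- move=> a b' [x ax] ab; have [x' xx] := adjoint_exists x.
  by exists x'; exact: (star_rel_adj sGc ax ab xx).
Qed.

(** The range is closed by the lifting argument [closure_rel_ran], and it contains every [U g]
    because g is a word in the generators. *)
Let ranP a : cstar_gen (range U) a <-> exists b, Gc b a.
Proof.
split; last first.
  move=> [b ab]; have EC := cstar_smallest (range U).
  have [[_ _ _ Ecl] _] := EC; apply: closed_limit => // r r0.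
  have [_ [_ [[q [-> ->]] _ aq]]] := ab _ r0; exists (poly_op eU q) => //.
  by apply: cstar_poly => // l; apply: gen_sub; eexists.
move=> Ea; apply: (Ea [set a | exists b, Gc b a]).
split; last first.
  move=> _ [g _ <-]; have [w ->] := free_on_word g fs.
  exists (word_op eT w); apply: closure_rel_sub; exists [:: (1, w)].
  by rewrite /poly_op !big_seq1 !scale1r -rep_word.
split; [split|].
- split; first by exists 0; exact: (star_rel0 sGc).
  by move=> k x y [a' ax] [b by_]; exists (k *: a' + b); exact: (star_relP sGc).
- by exists 1; exact: (star_rel1 sGc).
- by move=> x y [a' ax] [b by_]; exists (a' * b); exact: (star_relM sGc).
- move=> x h; apply: closure_rel_ran => // r r0.
  have [c [b bc] xc] := h _ (divr_gt0 r0 (ltr0n R 2)).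
  have [b' [c' [G' _ cc]]] := bc _ (divr_gt0 r0 (ltr0n R 2)).
  exists b', c'; split => //; apply: le_trans (opnorm_triangle c _ _) _; lra.
- move=> x y [b bx] xy; have [b' bb] := adjoint_exists b.
  by exists b'; exact: (star_rel_adj sGc bx bb xy).
Qed.

(** The function whose graph is [Gc]; its value is 0 outside the domain. *)
Let pi (b : op K) : op H := xget 0 [set a | Gc b a].

Let piP b a : Gc b a -> pi b = a.
Proof.
move=> ba; apply: (Gc_fun (b := b)) => //.
exact: (xgetPex 0 (ex_intro (fun a => Gc b a) a ba)).
Qed.

Let J : set (op K) := [set b | Gc b 0].

Let pi_iso : quotient_star_iso B J (cstar_gen (range U)) pi.
Proof.
split.
- move=> k a b /domP[x ax] /domP[y by_]; rewrite (piP ax) (piP by_).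
  by apply: piP; exact: (star_relP sGc).
- move=> a b /domP[x ax] /domP[y by_]; rewrite (piP ax) (piP by_).
  by apply: piP; exact: (star_relM sGc).
- move=> a b /domP[x ax] ab; have [x' xx] := adjoint_exists x.
  by rewrite (piP ax) (piP (star_rel_adj sGc ax ab xx)).
- apply/seteqP; split => [_ [b /domP[a ba] <-]|a /ranP[b ba]].
    by rewrite (piP ba); apply/ranP; exists b.
  by exists b; [apply/domP; exists a|exact: piP].
- move=> b /domP[a ba]; split => [|/piP//].
  by rewrite (piP ba) => a0; rewrite /J /= -a0.
Qed.

Let mx_inf_bound (I : set (op K)) n (a : 'M[op K]_n) :
  has_lbound [set opmxnorm (a + c) | c in [set c : 'M[op K]_n | forall i k, I (c i k)]].
Proof. by exists 0 => _ [c _ <-]; rewrite opmxnormE opnorm_ge0. Qed.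

(** For c in the kernel, j(f) + c is still sent to phi(f), and the map is completely contractive; so
    |j(f)| = |phi(f)| <= |j(f) + c| at every matrix level. *)
Let J_boundary : boundary_ideal (range j) B J.
Proof.
split; first split.
- by move=> b Jb; apply/domP; exists 0.
- split; first exact: (star_rel0 sGc).
  by move=> k a b Ja Jb; have := star_relP sGc k Ja Jb; rewrite scaler0 addr0.
- move=> b h; have [a ba] : exists a, Gc b a.
    apply/domP; have [[_ _ _ Bcl] _] := cstar_smallest (range j).
    by apply: Bcl => r /h[c Jc bc]; exists c => //; apply/domP; exists 0.
  suff a0 : a = 0 by rewrite /J /= -a0.
  apply: opnorm_small => r /h[c Jc /ltW bc].
  by have := cGc (star_relB sGc ba Jc); rewrite subr0 => /le_trans; apply.
- move=> b c /domP[a ba] Jc; split.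
    by have := star_relM sGc ba Jc; rewrite mulr0.
  by have := star_relM sGc Jc ba; rewrite mul0r.
move=> n a aA.
have /choice[f fP] : forall ik : 'I_n * 'I_n, exists f, j f = a ik.1 ik.2.
  by move=> ik; have [f _ fE] := aA ik.1 ik.2; exists f.
pose f_ : 'M[ncA R d]_n := \matrix_(i, k) f (i, k).
have aE : a = map_mx j f_ by apply/matrixP => i k; rewrite !mxE fP.
apply/le_anti/andP; split.
  apply: ge_inf; first exact: mx_inf_bound.
  by exists 0; rewrite /= ?addr0// => i k; rewrite mxE; exact: (star_rel0 sGc).
apply: lb_le_inf; first by exists (opmxnorm (a + 0)), 0 => //= i k; rewrite mxE; exact: (star_rel0 sGc).
move=> _ [c Jc <-]; case: (phih) (jh) => _ _ phin [_ _ jn].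
rewrite {1}aE jn -phin !opmxnormE; apply: (star_rel_cc sGc cGc) => i k.
have -> : (a + c) i k = j (f_ i k) + c i k by rewrite mxE [in LHS]aE mxE.
have -> : map_mx phi f_ i k = phi (f_ i k) + 0 by rewrite mxE addr0.
by apply: (star_relD sGc); [exact: Gc_hom|exact: Jc].
Qed.

(** If q(T) approximates b in I, rigidity gives |q(U)| <= |q(T) - b|; so the image of b, a limit of
    such q(U), vanishes. *)
Let J_max I : boundary_ideal (range j) B I -> I `<=` J.
Proof.
move=> [[IB [I0 IP] Icl IM] In] b Ib; have [a ba] := (domP b).1 (IB _ Ib).
suff a0 : a = 0 by rewrite /J /= -a0.
have IZ k c : I c -> I (k *: c) by move=> Ic; have := IP k c 0 Ic I0; rewrite addr0.
apply: opnorm_small => r r0.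
have [_ [_ [[q [-> ->]] bq aq]]] := ba _ (divr_gt0 r0 (ltr0n R 2)).
have : opnorm (poly_op eU q) <= opnorm (poly_op eT q + (-1) *: b).
  apply: (@rigidity I) => //.
  - by move=> c c' Ic Ic'; have := IP 1 c c' Ic Ic'; rewrite scale1r.
  - move=> c c' Ic cc; have [_ Badj] := cstar_smallest (range j).
    by have [] := IM c' c (Badj _ _ (IB _ Ic) cc) Ic.
  - move=> n f c Ic; rewrite -(In n (map_mx j f)); last first.
      by move=> i k; rewrite mxE; exists (f i k).
    by apply: ge_inf; [exact: mx_inf_bound|exists c].
  - exact: IZ.
rewrite scaleN1r opnormC in bq * => qb.
rewrite -(subrK (poly_op eU q) a); apply: le_trans (opnormD _ _) _; lra.
Qed.

Lemma envelope_iso : exists2 J, shilov_ideal (range j) (cstar_gen (range j)) J &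
  exists2 pi, quotient_star_iso (cstar_gen (range j)) J (cstar_gen (range U)) pi &
    forall f, pi (j f) = phi f.
Proof.
exists J; first by split; [exact: J_boundary|exact: J_max].
by exists pi; [exact: pi_iso|move=> f; apply: piP; exact: Gc_hom].
Qed.

End Envelope.

Theorem theorem2p9 (R : realType) (d : nat) (F : groupType) (s : 'I_d -> F)
    (H : hilbertType R) (U : F -> op H) :
  free_on s -> universal_rep U ->
  exists phi : ncA R d -> op H,
    unique
      (fun f : ncA R d -> op H =>
        [/\ completely_isometric_hom ncA_mxnorm f,
            range f = closed_algebra_gen (range (fun j => U (s j)))
          & forall j, f (ncA_coord j) = U (s j)])
      phi /\
    is_cstar_envelope ncA_mxnorm (cstar_gen (range U)) phi.
Proof.
move=> fs univ; have Ur : unitary_rep U by case: univ.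
pose e k := U (s k).
have e1 k : opnorm (e k) <= 1.
  have [_ _ /(_ (s k))[v [uv _ vu]]] := Ur.
  apply: opnorm_le => // x; rewrite mul1r.
  by rewrite (isometric_opnorm1 uv vu).
have eX := @polydisk_le_universal R d F s H U fs univ.
have /choice[phi phiP] : forall f : ncA R d, exists a, calculus (e := e) f a.
  by case=> f fA; exact: (calculus_exists e1).
have phi_eq f a : calculus (e := e) (ncA_fun f) a -> phi f = a.
  by move=> fa; apply: (calculus_fun e1 (phiP f)).
have phi_poly p : phi (ncA_poly p) = poly_op e p by apply: phi_eq; exact: calculus_poly.
have phih : completely_isometric_hom ncA_mxnorm phi.
  split.
  - by move=> k f g; apply: phi_eq; exact: calculusP (phiP f) (phiP g).
  - split; first by apply: phi_eq; exact: calculus1.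
    move=> f g; apply: phi_eq; apply: calculusM (phiP f) (phiP g);
      by [case: f => f; exact: ncA_bounded|case: g => g; exact: ncA_bounded].
  - by move=> n f; apply: (calculus_norm e1 eX) => i k; rewrite mxE; exact: phiP.
have phic k : phi (ncA_coord k) = U (s k) by apply: phi_eq; exact: calculus_coord.
exists phi; split; last first.
  move=> K j jh.
  have /choice[T' TP] : forall k, exists b, adjoint (j (ncA_coord k)) b.
    by move=> k; exact: adjoint_exists.
  exact: (envelope_iso fs Ur phih phic jh TP).
split; last first.
  (* A competitor [g] is the calculus at its own coordinates, which are again the [U (s k)], and the
     calculus is single-valued. *)
  move=> g [gh _ gc]; apply/funext => f; apply: phi_eq.
  have -> : e = (fun k => g (ncA_coord k)) by apply/funext => k; rewrite gc.
  exact: hom_calculus.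
split => //; apply/seteqP; split => [_ [f _ <-] S [[[S0 SP] S1 SM Scl] GS]|].
  apply: Scl => r r0; have [p [_ pa]] := phiP f _ (divr_gt0 r0 (ltr0n R 2)).
  exists (poly_op e p); last by apply: le_lt_trans pa _; rewrite ltr_pdivrMr//; lra.
  elim: p {pa} => [|t p IH]; first by rewrite /poly_op big_nil.
  rewrite /poly_op big_cons; apply: SP => //.
  elim: t.2 => [|k w IHw]; rewrite ?word_op_nil ?word_op_cons//.
  by apply: SM => //; apply: GS; exists k.
move=> a aS; apply: (aS (range phi)).
split; last by move=> _ [k _ <-]; exists (ncA_coord k).
case: (phih) => phil [phi1 phiM] _.
split.
- split; first by exists 0 => //; have := phil (-1) 0 0; rewrite scaler0 addr0 scaleN1r addNr.
  by move=> k _ _ [f _ <-] [g _ <-]; exists (k *: f + g); rewrite ?phil.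
- by exists 1.
- by move=> _ _ [f _ <-] [g _ <-]; exists (f * g); rewrite ?phiM.
(* The range is norm closed: a limit of values of [phi] is a limit of polynomials in U, hence a
   value of the calculus. *)
- move=> b h; have [r r0|f fA fa] := calculus_onto eX (a := b).
    have [_ [f _ <-] af] := h _ (divr_gt0 r0 (ltr0n R 2)).
    have [p [_ pa]] := phiP f _ (divr_gt0 r0 (ltr0n R 2)).
    exists p; apply: le_trans (opnorm_triangle (phi f) _ _) _.
    by move/ltW: af; lra.
  by exists (NcA fA) => //; apply: phi_eq.
Qed.
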